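(* Let $\pi$ and $\pi'$ be $\ell$-modular representations of Whittaker type of $G_n$ and $G_m$, and let $\tau$ and $\tau'$ be Whittaker lifts of $\pi$ and $\pi'$ respectively. Let $\theta$ be a nontrivial smooth $\ell$-adic character of $(F,+)$. Then: (1) $L(X,\pi,\pi')$ divides $r_\ell(L(X,\tau,\tau'))$. Moreover, the division may fail to be an equality, i.e. there are a non-archimedean local field $F$ of residual characteristic $p$, a prime $\ell\neq p$, $\ell$-modular representations $\pi$ and $\pi'$ of Whittaker type of some $G_n$ and $G_m$, and Whittaker lifts $\tau$ and $\tau'$ of $\pi$ and $\pi'$ respectively, with $L(X,\pi,\pi')\neq r_\ell(L(X,\tau,\tau'))$. (2) $\gamma(X,\pi,\pi',r_\ell(\theta))=r_\ell(\gamma(X,\tau,\tau',\theta))$.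
   Context: **Notation.** $F$ is a non-archimedean local field of residual characteristic $p$, with ring of integers $\mathfrak{o}$, uniformizer $\varpi$, valuation $v$, absolute value $|\cdot|$, residue cardinality $q$; $\ell\neq p$ is a prime; $R$ is $\overline{\mathbb{Q}_\ell}$ (''$\ell$-adic'') or $\overline{\mathbb{F}_\ell}$ (''$\ell$-modular''). A square root $q^{1/2}\in R$ is fixed, the one in $\overline{\mathbb F_\ell}$ being the reduction of the one in $\overline{\mathbb{Z}_\ell}$. $G_n=\mathrm{GL}_n(F)$; all representations are smooth; $\nu=|\det|$; $G_n^k=\{g\in G_n: v(\det g)=k\}$. $\times$ denotes normalised parabolic induction from standard (block upper triangular) parabolics. $N_n\subset G_n$ is the group of upper triangular unipotent matrices. $\theta:F\to R^\times$ is a nontrivial smooth character, also viewed as the character $u\mapsto\theta(\sum_{i=1}^{n-1}u_{i,i+1})$ of $N_n$. $c_\pi$ is the central character. **Whittaker type.** An irreducible $\pi$ is generic if $\mathrm{Hom}_{N_n}(\pi,\theta)\neq0$; it is cuspidal if it is not a subrepresentation of a properly parabolically induced representation. For cuspidal $\rho$ let $o(\rho)=|\{\nu^r\rho: r\in\mathbb{Z}\}|$ (up to isomorphism), $e(\rho)=+\infty$ if $R=\overline{\mathbb{Q}_\ell}$, and for $R=\overline{\mathbb{F}_\ell}$: $e(\rho)=o(\rho)$ if $o(\rho)>1$, $e(\rho)=\ell$ if $o(\rho)=1$. For $a\le b$, $St(\rho,[a,b])$ is the unique generic subquotient of $\nu^a\rho\times\cdots\times\nu^b\rho$. A generic segment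 is $\Delta=[a,b]_\rho$ with $b-a+1<e(\rho)$, and then $\mathcal{L}(\Delta)=St(\rho,[a,b])$. A representation is of Whittaker type if it is $\mathcal{L}(\Delta_1)\times\cdots\times\mathcal{L}(\Delta_t)$ with $\Delta_i$ generic segments; then $\dim\mathrm{Hom}_{N_n}(\pi,\theta)=1$, and $W(\pi,\theta)\subset\mathrm{Ind}_{N_n}^{G_n}(\theta)$ denotes its Whittaker model (the image of $\pi$). **Integrals and $L$-factors.** Integrals are with respect to $R$-valued Haar measures (and right invariant quotient measures). Put $\eta=(0,\dots,0,1)\in F^n$. Let $\pi,\pi'$ be of Whittaker type of $G_n,G_m$, $m\le n$, $W\in W(\pi,\theta)$, $W'\in W(\pi',\theta^{-1})$. If $n=m$ and $\Phi\in\mathcal{C}_c^\infty(F^n,R)$, put $I(X,W,W',\Phi)=\sum_k\left(\int_{N_n\backslash G_n^k}W(g)W'(g)\Phi(\eta g)dg\right)X^k$. If $m<n$ and $0\le j\le n-m-1$, put $$I(X,W,W';j)=\sum_k\left(\int_{\mathrm{Mat}_{j,m}(F)}\int_{N_m\backslash G_m^k}W\begin{pmatrix} g & & \\ x & I_j & \\ & & I_{n-m-j}\end{pmatrix}W'(g)\,dg\,dx\right)q^{k(n-m)/2}X^k.$$ These lie in $R((X))$, and for fixed $(\pi,\pi')$ (and fixed $j$) they span a fractional ideal of $R[X^{\pm1}]$, independent of $j$, with a unique generator $L(X,\pi,\pi')$ of the form $1/P(X)$, $P\in R[X]$, $P(0)=1$. For $n<m$ one sets $L(X,\pi,\pi')=L(X,\pi',\pi)$,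 and similarly for the factors below. One says $1/P$ divides $1/Q$ if $P$ divides $Q$ in $R[X]$. **$\gamma$-factors.** $\widetilde\pi(g)=\pi({}^tg^{-1})$, which is of Whittaker type, and $\widetilde W(g)=W(w_n\,{}^tg^{-1})\in W(\widetilde\pi,\theta^{-1})$, with $w_n$ the antidiagonal matrix of ones; $w_{m,n-m}=\mathrm{diag}(I_m,w_{n-m})$; $\rho$ is right translation; $\widehat\Phi$ is the Fourier transform with respect to $\theta$ and the $\theta$-self-dual measure (self-dual measures are also used on matrix spaces). There is an invertible element $\varepsilon(X,\pi,\pi',\theta)$ of $R[X^{\pm1}]$ with $$\frac{I(q^{-1}X^{-1},\widetilde W,\widetilde{W'},\widehat\Phi)}{L(q^{-1}X^{-1},\widetilde\pi,\widetilde{\pi'})}=c_{\pi'}(-1)^{m-1}\varepsilon(X,\pi,\pi',\theta)\frac{I(X,W,W',\Phi)}{L(X,\pi,\pi')}\quad(m=n),$$ $$\frac{I(q^{-1}X^{-1},\rho(w_{m,n-m})\widetilde W,\widetilde{W'};n-m-1-j)}{L(q^{-1}X^{-1},\widetilde\pi,\widetilde{\pi'})}=c_{\pi'}(-1)^{m-1}\varepsilon(X,\pi,\pi',\theta)\frac{I(X,W,W';j)}{L(X,\pi,\pi')}\quad(m<n).$$ Set $\gamma(X,\pi,\pi',\theta)=\varepsilon(X,\pi,\pi',\theta)\,L(q^{-1}X^{-1},\widetilde\pi,\widetilde{\pi'})/L(X,\pi,\pi')$. **Reduction and Whittaker lifts.** An $\ell$-adic representation of finite length is integral if it has a $G_n$-stable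 $\overline{\mathbb{Z}_\ell}$-lattice. For $\tau$ integral of Whittaker type, $W_e(\tau,\theta)$ is the set of functions in $W(\tau,\theta)$ with values in $\overline{\mathbb{Z}_\ell}$. An integral $\ell$-adic representation $\tau$ of Whittaker type is a Whittaker lift of an $\ell$-modular representation $\pi$ of Whittaker type if $W_e(\tau,\theta)$ contains a $G_n$-stable lattice $\mathcal{W}$ of $W(\tau,\theta)$ whose reduction modulo $\ell$ (as a space of functions) is $W(\pi,r_\ell(\theta))$. $r_\ell$ denotes reduction modulo $\ell$ of values or coefficients; for integral $\tau,\tau'$ of Whittaker type, $L(X,\tau,\tau')=1/P$ with $P\in\overline{\mathbb{Z}_\ell}[X]$, $P(0)=1$, and $r_\ell(1/P)=1/r_\ell(P)$; also $\varepsilon(X,\tau,\tau',\theta)=cX^k$ with $c\in\overline{\mathbb{Z}_\ell}^\times$, so $r_\ell(\gamma(X,\tau,\tau',\theta))$ is defined factor by factor. *)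

(* Defs.v *)
From HB Require Import structures.
From mathcomp Require Import all_boot all_order all_algebra.
From mathcomp Require Import functions.

Set Implicit Arguments.
Unset Strict Implicit.
Unset Printing Implicit Defensive.

Import Order.TTheory GRing.Theory Num.Theory.
Local Open Scope ring_scope.

(** Complete discretely valued field with finite residue field.  The
    valuation is normalised, and [lf_val 0] carries no meaning. *)
Record local_field := LocalField {
  lf_sort :> fieldType;
  lf_val : lf_sort -> int;
  lf_q : nat;
  lf_valM : forall x y : lf_sort, x != 0 -> y != 0 ->
    lf_val (x * y) = lf_val x + lf_val y;
  lf_valD : forall x y : lf_sort, x != 0 -> y != 0 -> x + y != 0 ->
    Num.min (lf_val x) (lf_val y) <= lf_val (x + y);
  lf_unif : exists2 x : lf_sort, x != 0 & lf_val x = 1;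
  (* the residue field has exactly lf_q elements *)
  lf_residue : exists s : seq lf_sort,
    [/\ size s = lf_q, uniq s,
        forall x, x \in s -> (x == 0) || (0 <= lf_val x),
        forall x y, x \in s -> y \in s ->
          (x - y == 0) || (1 <= lf_val (x - y)) -> x = y
      & forall x, (x == 0) || (0 <= lf_val x) ->
          exists2 y, y \in s & (x - y == 0) || (1 <= lf_val (x - y))];
  lf_complete : forall u : nat -> lf_sort,
    (forall N : int, exists n0 : nat, forall i j : nat,
       (n0 <= i)%N -> (n0 <= j)%N ->
       (u i - u j == 0) || (N <= lf_val (u i - u j))) ->
    exists x : lf_sort, forall N : int, exists n0 : nat, forall i : nat,
       (n0 <= i)%N -> (u i - x == 0) || (N <= lf_val (u i - x))
}.

(** [x \in varpi^N o]. *)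
Definition in_pow (F : local_field) (N : int) (x : F) : bool :=
  (x == 0) || (N <= lf_val x).

Definition res_char (F : local_field) (p : nat) : Prop :=
  prime p /\ in_pow 1 (p%:R : F).

Definition mx_in_pow (F : local_field) (N : int) a b (x : 'M[F]_(a, b)) : Prop :=
  forall i j, in_pow N (x i j).

(** [ld_base] is Q_l: it has uniformiser l <> 0 and residue field F_l.
    [ld_K] is an algebraic closure of it, [ld_int] the integral closure of Z_l
    in it, and [ld_k], with the reduction [ld_red] (meaningful on [ld_int]
    only), the residue field of that ring, an algebraic closure of F_l. *)
Record ladic_data (l : nat) := LadicData {
  ld_base : local_field;
  ld_base_q : lf_q ld_base = l;
  ld_base_l : (l%:R : ld_base) != 0;
  ld_base_unif : lf_val (l%:R : ld_base) = 1;
  ld_K : closedFieldType;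
  ld_emb : {rmorphism ld_base -> ld_K};
  ld_alg : forall x : ld_K, algebraicOver ld_emb x;
  ld_int : ld_K -> Prop;
  ld_intP : forall x : ld_K, ld_int x <->
    exists P : {poly ld_base},
      [/\ P \is monic, forall i, in_pow 0 P`_i & root (map_poly ld_emb P) x];
  ld_k : closedFieldType;
  ld_red : ld_K -> ld_k;
  ld_redD : forall x y, ld_int x -> ld_int y ->
    ld_red (x + y) = ld_red x + ld_red y;
  ld_redM : forall x y, ld_int x -> ld_int y ->
    ld_red (x * y) = ld_red x * ld_red y;
  ld_red1 : ld_red 1 = 1;
  ld_red_surj : forall y : ld_k, exists2 x, ld_int x & ld_red x = y;
  ld_red_ker : forall x, ld_int x ->
    (ld_red x = 0 <-> ~ (x <> 0 /\ ld_int x^-1))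
}.

Definition int_poly l (D : ladic_data l) (P : {poly ld_K D}) : Prop :=
  forall i, ld_int P`_i.

(** Elements of GL_n(F) are the invertible matrices; what [act] does on other
    matrices is irrelevant.  A prerep carries no axiom: see [smooth_rep]. *)
Record prerep (F : local_field) (R : fieldType) (n : nat) := Prerep {
  rep_space :> lmodType R;
  act : 'M[F]_n -> rep_space -> rep_space
}.

(** The principal congruence subgroups (a basis of neighbourhoods of 1). *)
Definition cong (F : local_field) n (N : nat) (g : 'M[F]_n) : Prop :=
  g \in unitmx /\ mx_in_pow N%:Z (g - 1%:M).

Definition smooth_rep (F : local_field) (R : fieldType) n (pi : prerep F R n) : Prop :=
  [/\ forall g, g \in unitmx -> linear (@act _ _ _ pi g),
      forall v : pi, act 1%:M v = v,
      forall g h (v : pi), g \in unitmx -> h \in unitmx ->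
        act (g *m h) v = act g (act h v)
    & forall v : pi, exists N : nat, forall g, cong N g -> act g v = v].

Definition intertwines (F : local_field) (R : fieldType) n (pi sigma : prerep F R n)
    (f : pi -> sigma) : Prop :=
  linear f /\ forall g v, g \in unitmx -> f (act g v) = act g (f v).

Definition rep_iso (F : local_field) (R : fieldType) n (pi sigma : prerep F R n) : Prop :=
  exists2 f : pi -> sigma, intertwines f & bijective f.

Definition subrep (F : local_field) (R : fieldType) n (pi : prerep F R n)
    (S : pi -> Prop) : Prop :=
  [/\ S 0, forall a u v, S u -> S v -> S (a *: u + v)
    & forall g v, g \in unitmx -> S v -> S (act g v)].

Definition irreducible_rep (F : local_field) (R : fieldType) n (pi : prerep F R n) : Prop :=
  [/\ smooth_rep pi, exists v : pi, v <> 0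
    & forall S : pi -> Prop, subrep S ->
        (forall v, S v -> v = 0) \/ (forall v, S v)].

Definition finite_length (F : local_field) (R : fieldType) n (pi : prerep F R n) : Prop :=
  exists (r : nat) (S : nat -> pi -> Prop),
    [/\ forall i, subrep (S i),
        forall v, S 0 v -> v = 0,
        forall v, S r v,
        forall i v, S i v -> S i.+1 v
      & forall i (U : pi -> Prop), subrep U ->
          (forall v, S i v -> U v) -> (forall v, U v -> S i.+1 v) ->
          (forall v, U v <-> S i v) \/ (forall v, U v <-> S i.+1 v)].

Definition subquotient (F : local_field) (R : fieldType) n (sigma pi : prerep F R n) : Prop :=
  exists (S : pi -> Prop) (f : pi -> sigma),
    [/\ subrep S,
        forall a u v, S u -> S v -> f (a *: u + v) = a *: f u + f v,
        forall g v, g \in unitmx -> S v -> f (act g v) = act g (f v)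
      & forall w, exists2 v, S v & f v = w].

Definition rep_tilde (F : local_field) (R : fieldType) n (pi : prerep F R n) : prerep F R n :=
  Prerep (fun g (v : pi) => act (trmx (invmx g)) v).

(** nu^a pi, with nu = |det| = q^(- v(det)) *)
Definition twist (F : local_field) (R : fieldType) n (a : int) (pi : prerep F R n) :
    prerep F R n :=
  Prerep (fun g (v : pi) => ((lf_q F)%:R ^ (- (a * lf_val (\det g))) : R) *: act g v).

Definition is_central_char (F : local_field) (R : fieldType) n (pi : prerep F R n)
    (c : F -> R) : Prop :=
  forall z (v : pi), z != 0 -> act z%:M v = c z *: v.

Definition bilinear_map (R : fieldType) (U V T : lmodType R) (b : U -> V -> T) : Prop :=
  (forall u, linear (b u)) /\ (forall v, linear (b^~ v)).

Definition is_tensor (R : fieldType) (U V T : lmodType R) (b : U -> V -> T) : Prop :=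
  bilinear_map b /\
  forall (T' : lmodType R) (b' : U -> V -> T'), bilinear_map b' ->
    exists f : T -> T',
      [/\ linear f, forall u v, f (b u v) = b' u v
        & forall f' : T -> T', linear f' -> (forall u v, f' (b u v) = b' u v) ->
            f' =1 f].

(** The functions of the normalised induction, from the standard parabolic of
    type (n1, n2), of the Levi representation [aT] on [T].  The scalar is
    delta_P^(1/2)(g1, g2) = |det g1|^(n2/2) |det g2|^(-n1/2), and [sq] is the
    chosen square root of q. *)
Definition ind_fun (F : local_field) (R : fieldType) (sq : R) n1 n2 n (e : (n1 + n2)%N = n)
    (T : lmodType R) (aT : 'M[F]_n1 -> 'M[F]_n2 -> T -> T) (f : 'M[F]_n -> T) : Prop :=
  (forall g1 g2 y x, g1 \in unitmx -> g2 \in unitmx -> x \in unitmx ->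
     f (castmx (e, e) (block_mx g1 y 0 g2) *m x) =
     sq ^ (n1%:Z * lf_val (\det g2) - n2%:Z * lf_val (\det g1)) *: aT g1 g2 (f x)) /\
  exists N : nat, forall x k, x \in unitmx -> cong N k -> f (x *m k) = f x.

(** pi is isomorphic to s1 x s2. *)
Definition is_ind (F : local_field) (R : fieldType) (sq : R) n1 n2 n (e : (n1 + n2)%N = n)
    (s1 : prerep F R n1) (s2 : prerep F R n2) (pi : prerep F R n) : Prop :=
  exists (T : lmodType R) (b : s1 -> s2 -> T)
         (aT : 'M[F]_n1 -> 'M[F]_n2 -> T -> T) (E : pi -> 'M[F]_n -> T),
    [/\ is_tensor b,
        forall g1 g2, g1 \in unitmx -> g2 \in unitmx ->
          linear (aT g1 g2) /\
          forall u v, aT g1 g2 (b u v) = b (act g1 u) (act g2 v),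
        forall x, x \in unitmx -> linear (E^~ x),
        forall g x v, g \in unitmx -> x \in unitmx -> E (act g v) x = E v (x *m g)
      & [/\ forall v, (forall x, x \in unitmx -> E v x = 0) -> v = 0,
            forall v, ind_fun sq e aT (E v)
          & forall f, ind_fun sq e aT f ->
              exists v, forall x, x \in unitmx -> E v x = f x]].

Definition smooth_char (F : local_field) (R : fieldType) (theta : F -> R) : Prop :=
  [/\ theta 0 = 1, forall x y, theta (x + y) = theta x * theta y
    & exists N : int, forall x, in_pow N x -> theta x = 1].

Definition nontrivial_char (F : local_field) (R : fieldType) (theta : F -> R) : Prop :=
  exists x, theta x <> 1.

Definition char_inv (F : local_field) (R : fieldType) (theta : F -> R) (x : F) : R :=
  (theta x)^-1.

Definition unipotent (F : local_field) n (u : 'M[F]_n) : Prop :=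
  forall i j : 'I_n, (j <= i)%N -> u i j = (i == j)%:R.

Definition theta_N (F : local_field) (R : fieldType) (theta : F -> R) n (u : 'M[F]_n) : R :=
  theta (\sum_(i < n) \sum_(j < n | (j == i.+1 :> nat)) u i j).

Definition whit_functional (F : local_field) (R : fieldType) (theta : F -> R) n
    (pi : prerep F R n) (lam : pi -> R) : Prop :=
  scalar lam /\ forall u v, unipotent u -> lam (act u v) = theta_N theta u * lam v.

Definition generic (F : local_field) (R : fieldType) (theta : F -> R) n
    (pi : prerep F R n) : Prop :=
  irreducible_rep pi /\
  exists lam : pi -> R, whit_functional theta lam /\ exists v, lam v <> 0.

(** W(pi, theta).  Functions on GL_n(F) are extended by 0 to all matrices. *)
Definition whit (F : local_field) (R : fieldType) (theta : F -> R) n (pi : prerep F R n)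
    (W : 'M[F]_n -> R) : Prop :=
  exists lam : pi -> R,
    [/\ whit_functional theta lam, exists v, lam v <> 0
      & exists v, W = fun g => if g \in unitmx then lam (act g v) else 0].

Definition cuspidal (F : local_field) (R : fieldType) (sq : R) n (pi : prerep F R n) : Prop :=
  irreducible_rep pi /\
  forall n1 n2 (e : (n1 + n2)%N = n) (s1 : prerep F R n1) (s2 : prerep F R n2)
         (Pi : prerep F R n),
    (0 < n1)%N -> (0 < n2)%N -> smooth_rep s1 -> smooth_rep s2 ->
    is_ind sq e s1 s2 Pi ->
    ~ exists2 f : pi -> Pi, intertwines f & injective f.

(** o(rho) = o *)
Definition orbit_card (F : local_field) (R : fieldType) n (rho : prerep F R n) (o : nat) : Prop :=
  exists s : seq int,
    [/\ uniq s, size s = o,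
        forall i j, i \in s -> j \in s -> rep_iso (twist i rho) (twist j rho) -> i = j
      & forall r, exists2 i, i \in s & rep_iso (twist r rho) (twist i rho)].

(** len < e(rho); no condition in characteristic 0, where e(rho) = +oo *)
Definition lt_e (F : local_field) (R : fieldType) n (rho : prerep F R n) (len : int) : Prop :=
  forall l : nat, l \in [pchar R] ->
    exists2 o, orbit_card rho o & len < (if (1 < o)%N then o else l)%:Z.

(** Pi is isomorphic to nu^a rho x ... x nu^b rho (associated to the right). *)
Inductive seg_prod (F : local_field) (R : fieldType) (sq : R) r (rho : prerep F R r) (b : int) :
    int -> forall n, prerep F R n -> Prop :=
| seg_prod_last : seg_prod sq rho b b (twist b rho)
| seg_prod_cons a m n (e : (r + m)%N = n) (tau : prerep F R m) (Pi : prerep F R n) :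
    seg_prod sq rho b (a + 1) tau -> is_ind sq e (twist a rho) tau Pi ->
    seg_prod sq rho b a Pi.

(** sigma is isomorphic to St(rho, [a, b]). *)
Definition is_St (F : local_field) (R : fieldType) (sq : R) (theta : F -> R)
    r (rho : prerep F R r) (a b : int) n (sigma : prerep F R n) : Prop :=
  generic theta sigma /\
  exists2 Pi : prerep F R n, seg_prod sq rho b a Pi & subquotient sigma Pi.

(** sigma is isomorphic to L(Delta) for a generic segment Delta. *)
Definition is_Lseg (F : local_field) (R : fieldType) (sq : R) (theta : F -> R) n
    (sigma : prerep F R n) : Prop :=
  exists (r : nat) (rho : prerep F R r) (a b : int),
    [/\ (0 < r)%N, cuspidal sq rho, a <= b, lt_e rho (b - a + 1)
      & is_St sq theta rho a b sigma].

Inductive whittaker_type (F : local_field) (R : fieldType) (sq : R) (theta : F -> R) :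
    forall n, prerep F R n -> Prop :=
| whittaker_type_one n (sigma : prerep F R n) :
    is_Lseg sq theta sigma -> whittaker_type sq theta sigma
| whittaker_type_cons n1 n2 n (e : (n1 + n2)%N = n) (sigma : prerep F R n1)
    (tau : prerep F R n2) (pi : prerep F R n) :
    is_Lseg sq theta sigma -> whittaker_type sq theta tau ->
    is_ind sq e sigma tau pi -> whittaker_type sq theta pi.

(** C_c^oo(N_n \ GL_n(F), R).  An R-valued measure is given by the integral it
    defines on such functions. *)
Definition Cc_quot (F : local_field) (R : fieldType) n (phi : 'M[F]_n -> R) : Prop :=
  [/\ forall u g, unipotent u -> g \in unitmx -> phi (u *m g) = phi g,
      exists N : nat, forall g k, g \in unitmx -> cong N k -> phi (g *m k) = phi g
    & exists M : int, forall g, g \in unitmx -> phi g <> 0 ->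
        exists u, [/\ unipotent u, mx_in_pow M (u *m g)
                    & mx_in_pow M (invmx (u *m g))]].

Definition haar_quot (F : local_field) (R : fieldType) n (mu : ('M[F]_n -> R) -> R) : Prop :=
  [/\ forall phi psi, Cc_quot phi -> Cc_quot psi ->
        (forall g, g \in unitmx -> phi g = psi g) -> mu phi = mu psi,
      forall a phi psi, Cc_quot phi -> Cc_quot psi ->
        mu (fun g => a * phi g + psi g) = a * mu phi + mu psi,
      forall phi h, Cc_quot phi -> h \in unitmx -> mu (fun g => phi (g *m h)) = mu phi
    & exists2 phi, Cc_quot phi & mu phi <> 0].

Definition Cc_mx (F : local_field) (R : fieldType) a b (Phi : 'M[F]_(a, b) -> R) : Prop :=
  (exists N : int, forall x y, mx_in_pow N y -> Phi (x + y) = Phi x) /\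
  (exists M : int, forall x, Phi x <> 0 -> mx_in_pow M x).

Definition fourier (F : local_field) (R : fieldType) (theta : F -> R) a b
    (dx : ('M[F]_(a, b) -> R) -> R) (Phi : 'M[F]_(a, b) -> R) (y : 'M[F]_(a, b)) : R :=
  dx (fun x => Phi x * theta (\sum_i \sum_j x i j * y i j)).

Definition conductor (F : local_field) (R : fieldType) (theta : F -> R) (c : int) : Prop :=
  (forall x, in_pow c x -> theta x = 1) /\ (exists2 x, in_pow (c - 1) x & theta x <> 1).

(** The Haar measure on Mat_{a,b}(F) that is self-dual with respect to theta.
    Fourier inversion determines it up to sign; the sign is the one for which
    the volume of Mat_{a,b}(o) is the appropriate power of the chosen root
    [sq] of q. *)
Definition haar_selfdual (F : local_field) (R : fieldType) (sq : R) (theta : F -> R) a b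
    (dx : ('M[F]_(a, b) -> R) -> R) : Prop :=
  [/\ forall r Phi Psi, Cc_mx Phi -> Cc_mx Psi ->
        dx (fun x => r * Phi x + Psi x) = r * dx Phi + dx Psi,
      forall Phi y, Cc_mx Phi -> dx (fun x => Phi (x + y)) = dx Phi,
      forall Phi x, Cc_mx Phi -> fourier theta dx (fourier theta dx Phi) x = Phi (- x)
    & forall c, conductor theta c ->
        dx (fun x => ([forall i, forall j, in_pow 0 (x i j)])%:R) =
        sq ^ (c * (a * b)%N%:Z)].

Definition eta (F : local_field) n : 'rV[F]_n := \row_j (j == n.-1 :> nat)%:R.

(** diag(I_m, w_{n-m}); for m = 0 it is the antidiagonal w_n. *)
Definition w_mx (F : local_field) n m : 'M[F]_n :=
  \matrix_(i, j) (if (i < m)%N then i == j else (i + j == m + n.-1)%N)%:R.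

Definition W_tilde (F : local_field) (R : fieldType) n (W : 'M[F]_n -> R) (g : 'M[F]_n) : R :=
  W (w_mx F n 0 *m trmx (invmx g)).

Definition rho_w (F : local_field) (R : fieldType) n m (W : 'M[F]_n -> R) (g : 'M[F]_n) : R :=
  W (g *m w_mx F n m).

(** Coefficients of the series I(X, W, W', Phi), m = n. *)
Definition RS_eq (F : local_field) (R : fieldType) m n (e : m = n)
    (mu : ('M[F]_n -> R) -> R) (W : 'M[F]_n -> R) (W' : 'M[F]_m -> R)
    (Phi : 'rV[F]_n -> R) : int -> R :=
  fun k => mu (fun g => if lf_val (\det g) == k
                        then W g * W' (castmx (esym e, esym e) g) * Phi (eta F n *m g)
                        else 0).

Definition RS_block (F : local_field) m j i n (e : (m + j + i.+1)%N = n)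
    (g : 'M[F]_m) (x : 'M[F]_(j, m)) : 'M[F]_n :=
  castmx (e, e) (block_mx (block_mx g 0 x 1%:M) 0 0 1%:M).

(** I(X, W, W'; j), m < n; here i = n - m - 1 - j. *)
Definition RS_lt (F : local_field) (R : fieldType) (sq : R) m j i n
    (e : (m + j + i.+1)%N = n)
    (mu : ('M[F]_m -> R) -> R) (dx : ('M[F]_(j, m) -> R) -> R)
    (W : 'M[F]_n -> R) (W' : 'M[F]_m -> R) : int -> R :=
  fun k => dx (fun x => mu (fun g => if lf_val (\det g) == k
                                     then W (RS_block e g x) * W' g else 0))
           * sq ^ (k * (n - m)%N%:Z).

Definition poly_mul_series (R : fieldType) (P : {poly R}) (f : int -> R) : int -> R :=
  fun k => \sum_(i < size P) P`_i * f (k - (i : nat)%:Z).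

Definition laurent_series (R : fieldType) (f : int -> R) : Prop :=
  exists N : int, forall k, k < N -> f k = 0.

Definition laurent_poly (R : fieldType) (f : int -> R) : Prop :=
  exists N : int, forall k, N < `|k| -> f k = 0.

(** The R[X, X^-1]-submodule generated by A. *)
Definition laurent_span (R : fieldType) (A : (int -> R) -> Prop) (f : int -> R) : Prop :=
  exists (N : nat) (c : 'I_N -> R) (d : 'I_N -> int) (I : 'I_N -> int -> R),
    (forall i, A (I i)) /\ forall k, f k = \sum_i c i * I i (k - d i).

(** Series are represented by their coefficients [int -> R]: inside R((X)), the
    elements of A span the fractional ideal (1/P) R[X, X^-1]. *)
Definition spans_inv (R : fieldType) (A : (int -> R) -> Prop) (P : {poly R}) : Prop :=
  forall f, laurent_span A f <->
            laurent_series f /\ laurent_poly (poly_mul_series P f).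

Definition is_Lfactor_le (F : local_field) (R : fieldType) (sq : R) (theta : F -> R)
    n m (pi : prerep F R n) (pi' : prerep F R m) (P : {poly R}) : Prop :=
  [/\ P`_0 = 1,
      forall e : m = n, exists2 mu, haar_quot mu &
        spans_inv (fun I => exists W W' Phi,
          [/\ whit theta pi W, whit (char_inv theta) pi' W', Cc_mx Phi
            & I = RS_eq e mu W W' Phi]) P
    & forall j i (e : (m + j + i.+1)%N = n),
        exists mu, exists2 dx, haar_quot mu /\ haar_selfdual sq theta dx &
        spans_inv (fun I => exists W W',
          [/\ whit theta pi W, whit (char_inv theta) pi' W'
            & I = RS_lt sq e mu dx W W']) P].

(** L(X, pi, pi') = 1 / P *)
Definition is_Lfactor (F : local_field) (R : fieldType) (sq : R) (theta : F -> R)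
    n m (pi : prerep F R n) (pi' : prerep F R m) (P : {poly R}) : Prop :=
  if (m <= n)%N then is_Lfactor_le sq theta pi pi' P
  else is_Lfactor_le sq theta pi' pi P.

Definition subst_dual (R : fieldType) (q : nat) (f : int -> R) : int -> R :=
  fun k => f (- k) * q%:R ^ k.

Definition is_epsilon_le (F : local_field) (R : fieldType) (sq : R) (theta : F -> R)
    n m (pi : prerep F R n) (pi' : prerep F R m) (P Pd : {poly R}) (a : R) (d : int) : Prop :=
  exists c, [/\ a != 0, is_central_char pi' c,
    forall e : m = n, exists mu, exists2 dx, haar_quot mu /\ haar_selfdual sq theta dx &
      forall W W' Phi, whit theta pi W -> whit (char_inv theta) pi' W' -> Cc_mx Phi ->
      forall k,
        subst_dual (lf_q F) (poly_mul_series Pd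
          (RS_eq e mu (W_tilde W) (W_tilde W') (fourier theta dx Phi))) k =
        c (-1) ^+ m.-1 * (a * poly_mul_series P (RS_eq e mu W W' Phi) (k - d))
  & forall j i (e : (m + j + i.+1)%N = n) (e' : (m + i + j.+1)%N = n),
      exists mu dx, exists2 dx',
        [/\ haar_quot mu, haar_selfdual sq theta dx & haar_selfdual sq theta dx'] &
      forall W W', whit theta pi W -> whit (char_inv theta) pi' W' ->
      forall k,
        subst_dual (lf_q F) (poly_mul_series Pd
          (RS_lt sq e' mu dx' (rho_w m (W_tilde W)) (W_tilde W'))) k =
        c (-1) ^+ m.-1 * (a * poly_mul_series P (RS_lt sq e mu dx W W') (k - d))].

(** The factors attached to (pi, pi'): L(X, pi, pi') = 1 / [lfac],
    L(X, pi~, pi'~) = 1 / [lfac_dual], and the invertible element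
    epsilon(X, pi, pi', theta) = [eps_coef] X^[eps_deg] of R[X, X^-1]
    (R is a field, so every invertible element is of this form). *)
Record factors (R : fieldType) := Factors {
  lfac : {poly R};
  lfac_dual : {poly R};
  eps_coef : R;
  eps_deg : int
}.

Definition is_factors (F : local_field) (R : fieldType) (sq : R) (theta : F -> R)
    n m (pi : prerep F R n) (pi' : prerep F R m) (f : factors R) : Prop :=
  [/\ is_Lfactor sq theta pi pi' (lfac f),
      is_Lfactor sq theta (rep_tilde pi) (rep_tilde pi') (lfac_dual f)
    & if (m <= n)%N
      then is_epsilon_le sq theta pi pi' (lfac f) (lfac_dual f) (eps_coef f) (eps_deg f)
      else is_epsilon_le sq theta pi' pi (lfac f) (lfac_dual f) (eps_coef f) (eps_deg f)].

(** gamma = epsilon(X) L(q^-1 X^-1, pi~, pi'~) / L(X, pi, pi'), in R(X) *)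
Definition gamma (R : fieldType) (q : nat) (f : factors R) : {fraction {poly R}} :=
  tofrac (eps_coef f)%:P * tofrac 'X ^ eps_deg f *
  ((map_poly (fun c : R => tofrac c%:P) (lfac_dual f)).[(q%:R * tofrac 'X)^-1])^-1 /
  (tofrac (lfac f))^-1.

(** The factors have a reduction: the polynomials are integral and the constant
    of the epsilon factor is a unit of the ring of integers. *)
Definition integral_factors l (D : ladic_data l) (f : factors (ld_K D)) : Prop :=
  [/\ int_poly (lfac f), int_poly (lfac_dual f),
      ld_int (eps_coef f), eps_coef f <> 0 & ld_int (eps_coef f)^-1].

Definition red_factors l (D : ladic_data l) (f : factors (ld_K D)) : factors (ld_k D) :=
  Factors (map_poly (@ld_red l D) (lfac f)) (map_poly (@ld_red l D) (lfac_dual f))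
          (ld_red (eps_coef f)) (eps_deg f).

(** Lam is the free module over the integers spanned by a basis of the
    subspace S of V. *)
Definition is_lattice l (D : ladic_data l) (V : lmodType (ld_K D)) (S Lam : V -> Prop) : Prop :=
  exists (I : eqType) (b : I -> V),
    [/\ forall (s : seq I) (c : I -> ld_K D), uniq s ->
          \sum_(i <- s) c i *: b i = 0 -> forall i, i \in s -> c i = 0,
        forall v, S v <-> exists (s : seq I) (c : I -> ld_K D),
          v = \sum_(i <- s) c i *: b i
      & forall v, Lam v <-> exists (s : seq I) (c : I -> ld_K D),
          (forall i, ld_int (c i)) /\ v = \sum_(i <- s) c i *: b i].

Definition integral_rep l (D : ladic_data l) (F : local_field) n
    (tau : prerep F (ld_K D) n) : Prop :=
  finite_length tau /\
  exists2 Lam : tau -> Prop, is_lattice (fun=> True) Lam &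
    forall g v, g \in unitmx -> Lam v -> Lam (act g v).

Definition whittaker_lift l (D : ladic_data l) (F : local_field) (sq : ld_K D)
    (theta : F -> ld_K D) n (tau : prerep F (ld_K D) n) (pi : prerep F (ld_k D) n) : Prop :=
  [/\ integral_rep tau, whittaker_type sq theta tau,
      whittaker_type (ld_red sq) (@ld_red l D \o theta) pi
    & exists Lam : ('M[F]_n -> (ld_K D)^o) -> Prop,
      [/\ forall W, Lam W -> whit theta tau W /\ forall g, ld_int (W g),
          forall h W, h \in unitmx -> Lam W -> Lam (fun g => W (g *m h)),
          @is_lattice l D ('M[F]_n -> (ld_K D)^o) (whit theta tau) Lam
        & forall W', whit (@ld_red l D \o theta) pi W' <->
            exists2 W, Lam W & W' = @ld_red l D \o W]].

(* Main.v *)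
Require Import Defs.
From HB Require Import structures.
From mathcomp Require Import all_boot all_order all_algebra.
From mathcomp Require Import fingroup perm.
From mathcomp Require Import boolp functions.
From mathcomp Require Import zify ring.
Set Implicit Arguments.
Unset Strict Implicit.
Unset Printing Implicit Defensive.
Import Order.TTheory GRing.Theory Num.Theory.
Local Open Scope ring_scope.

(** Let [1 / P] be the l-modular L-factor and [1 / Q] the l-adic one.

    By definition of a Whittaker lift, every l-modular Whittaker function is the
    reduction of an integral l-adic one, and a Schwartz function lifts in the
    same way.  The theorem follows from the compatibility of the integrals with
    these lifts.  A coefficient of a Rankin-Selberg series is the integral of a
    function that is smooth and compactly supported modulo [N_n]: where a simple
    root of the torus is large, a Whittaker function vanishes, because there the
    character is nontrivial on unipotent matrices that the function does not see
    ([gauge], [blk_support]).  Such an integral is a finite sum, whose nodes and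
    weights do not depend on the coefficient field; the weights are powers of q,
    which is a unit since [l <> p] ([haar_formula], [add_haar_formula]).  So a
    fixed multiple of the l-adic series is integral and reduces to the l-modular
    series ([RS_eq_reduction], [RS_lt_reduction]).

    Integrality of [Q].  Whittaker functions of a lift have bounded denominators,
    hence so does every series of the l-adic ideal, and [1 / Q] in particular.
    The powers of an inverse root of [Q] then have bounded denominators, and the
    integers of the l-adic field are completely integrally closed ([almost_int],
    [int_poly_of_bounded]).

    Divisibility.  [1 / P] is a combination of l-modular series, and each of them
    lifts.  The product of [Q] with the lifted combination is an integral Laurent
    polynomial, and it reduces to the quotient of the reduction of [Q] by [P]
    ([dvdp_of_lifts]).

    Gamma factors.  For data that lift a nonzero l-modular integral, the reduction
    of the l-adic functional equation is a functional equation for the same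
    l-modular integrals; the dual side reduces because Fourier transforms and
    self-dual measures do.  A gamma factor is determined by a single functional
    equation between nonzero series ([gamma_unique], [gamma_reduction]).

    Strictness.  For [n = m = 1] and trivial characters the integrals are those
    of Tate.  Over the l-adic field they give [1 / (1 - X)], whose pole is
    proportional to the volume of the group of units of [F], which is [q - 1]
    times that of [1 + varpi o].  If [l] divides [q - 1], this volume vanishes
    modulo [l], all the l-modular integrals are Laurent polynomials, and the
    l-modular factor is 1.  The example is [F = F_3((t))] with [l = 2]; the field
    and the Haar integral on its multiplicative group are constructed
    ([laurent_field], [haar_dim1]). *)

(** * Valuations *)

Section LocalField.
Variable F : local_field.
Implicit Types (x y : F) (M N : int).
Notation v := (@lf_val F).

Lemma lf_val1 : v 1 = 0.
Proof. have h : v 1 = v 1 + v 1 by rewrite -{1}(mulr1 1) lf_valM ?oner_neq0.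
lia. Qed.

Lemma lf_valV x : x != 0 -> v x^-1 = - v x.
Proof.
move=> x0; have xV : x^-1 != 0 by rewrite invr_eq0.
by have := lf_valM x0 xV; rewrite mulfV // lf_val1; lia.
Qed.

Lemma lf_valN x : x != 0 -> v (- x) = v x.
Proof.
move=> x0; have n1 : (-1 : F) != 0 by rewrite oppr_eq0 oner_neq0.
have := lf_valM n1 n1; rewrite mulrNN mulr1 lf_val1 => h.
by rewrite -mulN1r lf_valM //; lia.
Qed.

Lemma lf_valX x n : x != 0 -> v (x ^+ n) = v x * n%:Z.
Proof.
move=> x0; elim: n => [|n IH]; first by rewrite expr0 lf_val1 mulr0.
by rewrite exprS lf_valM ?expf_neq0 // IH; lia.
Qed.

Lemma lf_valXz x (n : int) : x != 0 -> v (x ^ n) = v x * n.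
Proof.
move=> x0; case: n => n; first by rewrite -exprnP lf_valX.
by rewrite NegzE -exprnN lf_valV ?expf_neq0 // lf_valX //; lia.
Qed.

Lemma in_pow0 N : in_pow N (0 : F). Proof. by rewrite /in_pow eqxx. Qed.
Hint Resolve in_pow0 : core.

Lemma in_powE N x : x != 0 -> in_pow N x = (N <= v x).
Proof. by rewrite /in_pow => /negPf->. Qed.

Lemma in_pow1 : in_pow 0 (1 : F). Proof. by rewrite in_powE ?oner_neq0 // lf_val1. Qed.
Hint Resolve in_pow1 : core.

Lemma in_powN N x : in_pow N (- x) = in_pow N x.
Proof. by rewrite /in_pow oppr_eq0; case: eqVneq => //= x0; rewrite lf_valN. Qed.

Lemma in_powD N x y : in_pow N x -> in_pow N y -> in_pow N (x + y).
Proof.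
have [->|x0] := eqVneq x 0; first by rewrite add0r.
have [->|y0] := eqVneq y 0; first by rewrite addr0.
have [->|xy0] := eqVneq (x + y) 0; first by [].
rewrite !in_powE // => hx hy; apply: le_trans (lf_valD x0 y0 xy0).
by rewrite le_min hx.
Qed.

Lemma in_powB N x y : in_pow N x -> in_pow N y -> in_pow N (x - y).
Proof. by move=> hx hy; rewrite in_powD ?in_powN. Qed.

Lemma in_pow_le M N x : N <= M -> in_pow M x -> in_pow N x.
Proof.
by have [->|x0] := eqVneq x 0; rewrite // !in_powE //; apply: le_trans.
Qed.

Lemma in_powM M N x y : in_pow M x -> in_pow N y -> in_pow (M + N) (x * y).
Proof.
have [->|x0] := eqVneq x 0; first by rewrite mul0r.
have [->|y0] := eqVneq y 0; first by rewrite mulr0.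
by rewrite !in_powE ?mulf_neq0 // lf_valM //; lia.
Qed.

Lemma in_pow_sum N (I : Type) (r : seq I) (P : pred I) (f : I -> F) :
  (forall i, P i -> in_pow N (f i)) -> in_pow N (\sum_(i <- r | P i) f i).
Proof. by move=> h; elim/big_ind: _ => //; apply: in_powD. Qed.

Lemma in_pow_ex x : exists N : nat, in_pow (- N%:Z) x.
Proof.
have [->|x0] := eqVneq x 0; first by exists 0%N.
by exists `|v x|%N; rewrite in_powE //; lia.
Qed.

Lemma unifP : exists2 w : F, w != 0 & v w = 1.
Proof. exact: lf_unif. Qed.

Lemma unif_powP N : exists2 w : F, w != 0 & v w = N.
Proof.
have [w w0 vw] := unifP; exists (w ^ N); first by rewrite expfz_neq0.
by rewrite lf_valXz // vw mul1r.
Qed.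

(** The representatives are built one digit at a time from representatives of
    the residue field. *)
Lemma pow_reps M r : exists s : seq F,
  [/\ size s = (lf_q F ^ r)%N, uniq s, forall x, x \in s -> in_pow M x,
      forall x y, x \in s -> y \in s -> in_pow (M + r%:Z) (x - y) -> x = y
    & forall x, in_pow M x -> exists2 y, y \in s & in_pow (M + r%:Z) (x - y)].
Proof.
have [k [sk uk ik jk ek]] := lf_residue F.
elim: r => [|r [s [ss us is_ js es]]].
  exists [:: 0]; split => //; first by move=> x; rewrite inE => /eqP->.
    by move=> x y; rewrite !inE => /eqP-> /eqP->.
  move=> x ix; exists 0; rewrite ?inE // (subr0 x).
  by apply: in_pow_le ix; lia.
have [w w0 vw] := unif_powP (M + r%:Z).
have inj x y a b : x \in s -> y \in s -> a \in k -> b \in k ->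
    in_pow (M + r.+1%:Z) (x + w * a - (y + w * b)) -> x = y /\ a = b.
  move=> xs ys ak bk h.
  have iab : in_pow 0 (a - b) by apply: in_powB; [exact: ik | exact: ik].
  have iw : in_pow (M + r%:Z) w by rewrite in_powE // vw.
  have e : x + w * a - (y + w * b) = (x - y) + w * (a - b) by ring.
  have exy : x = y.
    apply: js => //; have -> : x - y = x + w * a - (y + w * b) - w * (a - b).
      by rewrite e addrK.
    apply: in_powB; first by apply: in_pow_le h; lia.
    by have := in_powM iw iab; rewrite addr0.
  split=> //; apply: jk => //; apply/orP.
  move: h; rewrite e exy subrr add0r /in_pow.
  have [ab|ab] := eqVneq (a - b) 0; first by left.
  rewrite mulf_eq0 (negPf w0) (negPf ab) /= lf_valM // vw; lia.
exists [seq x + w * a | x <- s, a <- k]; split.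
- by rewrite size_allpairs ss sk expnSr.
- apply: allpairs_uniq => // -[x a] [y b] /allpairsP[[x' a'] /= [? ? [-> ->]]].
  move=> /allpairsP[[y' b'] /= [? ? [-> ->]]] e.
  have h0 : in_pow (M + r.+1%:Z) (x' + w * a' - (y' + w * b')) by rewrite e subrr.
  by have [//|//|//|//|-> ->] := @inj x' y' a' b' _ _ _ _ h0.
- move=> z /allpairsP[[x a] /= [xs ak ->]]; apply: in_powD; first exact: is_.
  have h : in_pow (M + r%:Z + 0) (w * a) by apply: in_powM; [rewrite in_powE // vw | exact: ik].
  by apply: in_pow_le h; lia.
- move=> z t /allpairsP[[x a] /= [xs ak ->]] /allpairsP[[y b] /= [ys bk ->]] h.
  by have [-> ->] := @inj x y a b xs ys ak bk h.
- move=> x ix; have [y ys h] := es _ ix.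
  have h' : in_pow 0 ((x - y) / w).
    have -> : 0 = (M + r%:Z) - (M + r%:Z) by lia.
    by apply: in_powM => //; rewrite in_powE ?invr_eq0 // lf_valV // vw.
  have [a ak h2] := ek _ h'.
  exists (y + w * a); first by apply: allpairs_f.
  have -> : x - (y + w * a) = w * ((x - y) / w - a) by rewrite mulrBr mulrCA divff // mulr1; ring.
  have -> : M + r.+1%:Z = (M + r%:Z) + 1 by lia.
  by apply: in_powM => //; rewrite in_powE // vw.
Qed.

End LocalField.
#[global] Hint Resolve in_pow0 in_pow1 : core.

(** * Unipotent, integral and congruence matrices *)

Section Unipotent.
Variable F : local_field.
Implicit Types n : nat.

Lemma unipotent1 n : unipotent (1%:M : 'M[F]_n).
Proof. by move=> i j _; rewrite mxE. Qed.

Lemma unipotentM n (u w : 'M[F]_n) : unipotent u -> unipotent w -> unipotent (u *m w).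
Proof.
move=> hu hw i j ji; rewrite mxE (bigD1 i) //= hu // eqxx mul1r hw // big1 ?addr0 // => k ki.
have [lt_ki|le_ik] := ltnP k i; first by rewrite hu ?(ltnW lt_ki) // eq_sym (negPf ki) mul0r.
have lt_ik : (i < k)%N by rewrite ltn_neqAle eq_sym ki.
rewrite hw ?(leq_trans ji) //; case: eqVneq => [kj|]; last by rewrite mulr0.
by rewrite kj ltnNge ji in lt_ik.
Qed.

Lemma unipotent_unit n (u : 'M[F]_n) : unipotent u -> u \in unitmx.
Proof.
move=> hu; rewrite unitmxE -det_tr det_trig.
  by rewrite big1 ?unitr1 // => i _; rewrite mxE hu // eqxx.
by apply/is_trig_mxP => i j ij; rewrite mxE hu ?(ltnW ij) // -val_eqE /= gtn_eqF.
Qed.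

Lemma unipotent_det n (u : 'M[F]_n) : unipotent u -> \det u = 1.
Proof.
move=> hu; rewrite -det_tr det_trig.
  by rewrite big1 ?unitr1 // => i _; rewrite mxE hu // eqxx.
by apply/is_trig_mxP => i j ij; rewrite mxE hu ?(ltnW ij) // -val_eqE /= gtn_eqF.
Qed.

(** The rows of the inverse are determined from the last one upwards. *)
Lemma unipotentV n (u : 'M[F]_n) : unipotent u -> unipotent (invmx u).
Proof.
move=> hu; have uu := unipotent_unit hu.
suff h m (i j : 'I_n) : (n - i <= m)%N -> (j <= i)%N -> invmx u i j = (i == j)%:R.
  by move=> i j; apply: h (leqnn _).
elim: m i j => [|m IH] i j; first by have := ltn_ord i; lia.
move=> hm ji; have := congr1 (fun A : 'M_n => A i j) (mulmxV uu).
rewrite !mxE (bigD1 i) //= hu // eqxx mul1r big1 ?addr0 // => k ki.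
have [lt_ki|le_ik] := ltnP k i; first by rewrite hu ?(ltnW lt_ki) // eq_sym (negPf ki) mul0r.
have lt_ik : (i < k)%N by rewrite ltn_neqAle eq_sym ki.
rewrite IH; [|lia|lia]; case: eqVneq => [kj|]; last by rewrite mulr0.
by rewrite kj ltnNge ji in lt_ik.
Qed.

(** The additive coordinate through which [theta_N] factors. *)
Definition superdiag n (u : 'M[F]_n) : F := \sum_(i < n) \sum_(j < n | (j == i.+1 :> nat)) u i j.

Lemma superdiag1 n : superdiag (1%:M : 'M[F]_n) = 0.
Proof.
rewrite /superdiag big1 // => i _; rewrite big1 // => j /eqP ji; rewrite mxE.
by case: eqVneq => // ij; move: ji; rewrite ij; lia.
Qed.

Lemma superdiagM n (u w : 'M[F]_n) : unipotent u -> unipotent w ->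
  superdiag (u *m w) = superdiag u + superdiag w.
Proof.
move=> hu hw; rewrite /superdiag -big_split /=; apply: eq_bigr => i _.
rewrite -big_split /=; apply: eq_bigr => j /eqP ji.
have ij : i != j by rewrite -val_eqE /= ji; lia.
rewrite mxE (bigD1 i) //= (bigD1 j) /=; last by rewrite eq_sym.
rewrite (hu i i) // (hw j j) // !eqxx mul1r mulr1.
rewrite big1 ?addr0 1?addrC // => k /andP[ki kj].
have [lt_ki|le_ik] := ltnP k i; first by rewrite hu ?(ltnW lt_ki) // eq_sym (negPf ki) mul0r.
have lt_jk : (j <= k)%N by move: ki; rewrite -val_eqE /= ji; lia.
by rewrite (hw k j) // (negPf kj) mulr0.
Qed.

Lemma superdiagV n (u : 'M[F]_n) : unipotent u -> superdiag (invmx u) = - superdiag u.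
Proof.
move=> hu; apply/eqP; rewrite -subr_eq0 opprK -superdiagM //; last exact: unipotentV.
by rewrite mulVmx ?superdiag1 // unipotent_unit.
Qed.

Lemma unipotent_block n1 n2 (u1 : 'M[F]_n1) (u2 : 'M[F]_n2) b :
  unipotent u1 -> unipotent u2 -> unipotent (block_mx u1 b 0 u2).
Proof.
move=> h1 h2 i j; rewrite -[i]splitK -[j]splitK.
case: (fintype.split i) => i'; case: (fintype.split j) => j' /=.
- by rewrite block_mxEul => /h1 ->; rewrite (inj_eq (@lshift_inj _ _)).
- by move=> h; have := ltn_ord i'; move: h; rewrite /=; lia.
- by rewrite block_mxEdl mxE eq_rlshift.
- by rewrite block_mxEdr /= leq_add2l => /h2 ->; rewrite (inj_eq (@rshift_inj _ _)).
Qed.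

Lemma superdiag_block1 n1 n2 (u1 : 'M[F]_n1) :
  superdiag (block_mx u1 0 0 (1%:M : 'M_n2)) = superdiag u1.
Proof.
have h n (u : 'M[F]_n) : superdiag u = \sum_(i < n) \sum_(j < n) (if (j == i.+1 :> nat) then u i j else 0).
  by apply: eq_bigr => i _; rewrite big_mkcond.
rewrite !h big_split_ord /= [X in _ + X]big1 ?addr0 => [|i _].
  apply: eq_bigr => i _; rewrite big_split_ord /= [X in _ + X]big1 ?addr0 => [|j _].
    by apply: eq_bigr => j _; rewrite block_mxEul.
  by rewrite block_mxEur mxE if_same.
rewrite big_split_ord /= big1 ?add0r => [|j _].
  rewrite big1 // => j _; rewrite block_mxEdr mxE -addnS eqn_add2l.
  by case: eqP => // h1; case: eqVneq => // h2; move: h1; rewrite h2; lia.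
by rewrite block_mxEdl mxE if_same.
Qed.

Definition regular_diag n (d : 'rV[F]_n) := forall i, d 0 i != 0.

Lemma diag_unit n (d : 'rV[F]_n) : regular_diag d -> diag_mx d \in unitmx.
Proof. by move=> hd; rewrite unitmxE det_diag unitfE; apply/prodf_neq0 => i _; apply: hd. Qed.

Lemma diag_inv n (d : 'rV[F]_n) : regular_diag d ->
  invmx (diag_mx d) = diag_mx (\row_i (d 0 i)^-1).
Proof.
move=> hd; have ud := diag_unit hd; apply: (can_inj (mulKmx ud)).
rewrite mulmxV // mulmx_diag -[LHS]diag_const_mx; congr diag_mx; apply/rowP => i; rewrite !mxE divff //.
Qed.

Lemma diag_conjE n (d : 'rV[F]_n) (u : 'M_n) i j : regular_diag d ->
  (diag_mx d *m u *m invmx (diag_mx d)) i j = d 0 i * u i j / d 0 j.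
Proof. by move=> hd; rewrite diag_inv // mul_mx_diag mul_diag_mx !mxE. Qed.

Lemma unipotent_conj_diag n (d : 'rV[F]_n) (u : 'M_n) : regular_diag d ->
  unipotent u -> unipotent (diag_mx d *m u *m invmx (diag_mx d)).
Proof.
move=> hd hu i j ij; rewrite diag_conjE // hu //; case: eqVneq => [->|]; last by rewrite mulr0 mul0r.
by rewrite mulr1 divff.
Qed.
End Unipotent.

Section IntegralMatrices.
Variable F : local_field.

Lemma mx_in_pow0 N a b : mx_in_pow N (0 : 'M[F]_(a, b)).
Proof. by move=> i j; rewrite mxE. Qed.

Lemma mx_in_powD N a b (x y : 'M[F]_(a, b)) :
  mx_in_pow N x -> mx_in_pow N y -> mx_in_pow N (x + y).
Proof. by move=> hx hy i j; rewrite mxE in_powD. Qed.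

Lemma mx_in_powN N a b (x : 'M[F]_(a, b)) : mx_in_pow N x -> mx_in_pow N (- x).
Proof. by move=> hx i j; rewrite mxE in_powN. Qed.

Lemma mx_in_powB N a b (x y : 'M[F]_(a, b)) :
  mx_in_pow N x -> mx_in_pow N y -> mx_in_pow N (x - y).
Proof. by move=> hx hy; apply: mx_in_powD => //; apply: mx_in_powN. Qed.

Lemma mx_in_powM M N a b c (x : 'M[F]_(a, b)) (y : 'M[F]_(b, c)) :
  mx_in_pow M x -> mx_in_pow N y -> mx_in_pow (M + N) (x *m y).
Proof. by move=> hx hy i j; rewrite mxE in_pow_sum // => k _; apply: in_powM. Qed.

Lemma mx_in_pow_le M N a b (x : 'M[F]_(a, b)) :
  N <= M -> mx_in_pow M x -> mx_in_pow N x.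
Proof. by move=> h hx i j; apply: in_pow_le (hx i j). Qed.

Lemma mx_in_pow1 n : mx_in_pow 0 (1%:M : 'M[F]_n).
Proof. by move=> i j; rewrite mxE; case: eqP. Qed.

Lemma mx_in_pow_ex a b (x : 'M[F]_(a, b)) : exists N : nat, mx_in_pow (- N%:Z) x.
Proof.
have h i j : exists N : nat, in_pow (- N%:Z) (x i j) by apply: in_pow_ex.
exists (\sum_i \sum_j xchoose (h i j))%N => i j.
apply: in_pow_le (xchooseP (h i j)); rewrite lerN2 lez_nat.
by rewrite (bigD1 i) //= (bigD1 j) //= -addnA leq_addr.
Qed.

Lemma mx_in_pow_tr N a b (x : 'M[F]_(a, b)) : mx_in_pow N x -> mx_in_pow N x^T.
Proof. by move=> h i j; rewrite mxE. Qed.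

(** A row vector killed by such a matrix would be divisible by arbitrarily high
    powers of the uniformiser. *)
Lemma unit_addmx n (X : 'M[F]_n) : mx_in_pow 1 X -> 1%:M + X \in unitmx.
Proof.
move=> hX; rewrite unitmxE unitfE; apply/negP => /det0P[w w0].
rewrite mulmxDr mulmx1 => /eqP; rewrite addr_eq0 => /eqP e.
have step N : mx_in_pow N w -> mx_in_pow (N + 1) w.
  by move=> h; rewrite e; apply: mx_in_powN; apply: mx_in_powM.
have [N hN] := mx_in_pow_ex w.
have all k : mx_in_pow (- N%:Z + k%:Z) w.
  elim: k => [|k IH]; first by apply: mx_in_pow_le hN; lia.
  by apply: mx_in_pow_le (step _ IH); lia.
case/eqP: w0; apply/matrixP => i j; rewrite [RHS]mxE; apply/eqP/negPn/negP => wij.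
have := all (N + `|lf_val (w i j)|%N).+1 i j; rewrite in_powE //.
by move: (lf_val (w i j)) => a; lia.
Qed.

Lemma cong_add n N (X : 'M[F]_n) : (0 < N)%N -> mx_in_pow N%:Z X -> cong N (1%:M + X).
Proof.
move=> N0 hX; split; last by rewrite addrC addKr.
by apply: unit_addmx; apply: mx_in_pow_le hX; lia.
Qed.

Lemma cong_le n M N (g : 'M[F]_n) : (N <= M)%N -> cong M g -> cong N g.
Proof. by move=> h [ug hg]; split => //; apply: mx_in_pow_le hg; lia. Qed.

(** [GL_n(o)] *)
Definition GLo n (k : 'M[F]_n) :=
  [/\ k \in unitmx, mx_in_pow 0 k & mx_in_pow 0 (invmx k)].

Lemma GLo1 n : GLo (1%:M : 'M[F]_n).
Proof. by split; rewrite ?unitmx1 ?invmx1 //; apply: mx_in_pow1. Qed.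

Lemma GLoV n (k : 'M[F]_n) : GLo k -> GLo (invmx k).
Proof. by case=> *; split; rewrite ?unitmx_inv ?invmxK. Qed.

Lemma invmx_mul n (g h : 'M[F]_n) : g \in unitmx -> h \in unitmx ->
  invmx (g *m h) = invmx h *m invmx g.
Proof.
move=> ug uh; have ugh : g *m h \in unitmx by rewrite unitmx_mul ug.
apply: (can_inj (mulKmx ugh)); rewrite mulmxV // -mulmxA [h *m _]mulmxA mulmxV // mul1mx mulmxV //.
Qed.

Lemma GLoM n (k h : 'M[F]_n) : GLo k -> GLo h -> GLo (k *m h).
Proof.
move=> [uk ik jk] [uh ih jh]; split; first by rewrite unitmx_mul uk.
  by have := mx_in_powM ik ih.
by rewrite invmx_mul //; have := mx_in_powM jh jk.
Qed.

Lemma GLo_perm n (s : 'S_n) : GLo (perm_mx s : 'M[F]_n).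
Proof.
have h (t : 'S_n) : mx_in_pow 0 (perm_mx t : 'M[F]_n) by move=> i j; rewrite !mxE; case: eqP.
have u : (perm_mx s : 'M[F]_n) \in unitmx by apply: unitmx_perm.
split=> //; suff -> : invmx (perm_mx s) = perm_mx s^-1%g :> 'M[F]_n by [].
by apply: (can_inj (mulKmx u)); rewrite mulmxV // -perm_mxM mulgV perm_mx1.
Qed.

Lemma GLo_block n1 n2 (k1 : 'M[F]_n1) (k2 : 'M[F]_n2) :
  GLo k1 -> GLo k2 -> GLo (block_mx k1 0 0 k2).
Proof.
move=> [u1 i1 j1] [u2 i2 j2].
have hb (a : 'M[F]_n1) (b : 'M[F]_n2) : mx_in_pow 0 a -> mx_in_pow 0 b -> mx_in_pow 0 (block_mx a 0 0 b).
  move=> ha hb i j; rewrite -[i]splitK -[j]splitK.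
  by case: (fintype.split i) => i'; case: (fintype.split j) => j' /=;
    rewrite ?(block_mxEul, block_mxEur, block_mxEdl, block_mxEdr) ?mxE.
have ub : block_mx k1 0 0 k2 \in unitmx by rewrite unitmxE det_ublock unitrM -!unitmxE u1.
split=> //; first exact: hb.
suff -> : invmx (block_mx k1 0 0 k2) = block_mx (invmx k1) 0 0 (invmx k2) by apply: hb.
apply: (can_inj (mulKmx ub)); rewrite mulmxV // mulmx_block !mul0mx !mulmx0 !addr0 !add0r.
by rewrite !mulmxV // -scalar_mx_block.
Qed.

(** From [g^-1 = 1 - g^-1 (g - 1)], the denominators of [g^-1] can be lowered
    one step at a time. *)
Lemma cong_GLo n N (g : 'M[F]_n) : (0 < N)%N -> cong N g -> GLo g.
Proof.
move=> N0 [ug hg].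
have h1 : mx_in_pow 1 (g - 1%:M) by apply: mx_in_pow_le hg; lia.
split=> //.
  rewrite -[g](subrK 1%:M); apply: mx_in_powD; last exact: mx_in_pow1.
  by apply: mx_in_pow_le h1.
have e : invmx g = 1%:M - invmx g *m (g - 1%:M) by rewrite mulmxBr mulVmx // mulmx1 subKr.
have [M hM] := mx_in_pow_ex (invmx g).
elim: M hM => [|M IH] hM; first by apply: mx_in_pow_le hM; lia.
apply: IH; rewrite e; apply: mx_in_powB.
  by apply: mx_in_pow_le (@mx_in_pow1 n); lia.
by apply: mx_in_pow_le (mx_in_powM hM h1); lia.
Qed.

Lemma cong1 n N : cong N (1%:M : 'M[F]_n).
Proof. by split; rewrite ?unitmx1 // subrr; apply: mx_in_pow0. Qed.

Lemma congV n N (g : 'M[F]_n) : (0 < N)%N -> cong N g -> cong N (invmx g).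
Proof.
move=> N0 cg; have [ug ig jg] := cong_GLo N0 cg; have [_ hg] := cg.
split; first by rewrite unitmx_inv.
have -> : invmx g - 1%:M = - (invmx g *m (g - 1%:M)) by rewrite mulmxBr mulVmx // mulmx1 opprB.
by apply: mx_in_powN; have := mx_in_powM jg hg; rewrite add0r.
Qed.

Lemma congM n N (g h : 'M[F]_n) : (0 < N)%N -> cong N g -> cong N h -> cong N (g *m h).
Proof.
move=> N0 cg [uh ih]; have [ug ig jg] := cong_GLo N0 cg; have [_ hg] := cg.
split; first by rewrite unitmx_mul ug.
have -> : g *m h - 1%:M = g *m (h - 1%:M) + (g - 1%:M) by rewrite mulmxBr mulmx1 addrA subrK.
by apply: mx_in_powD => //; have := mx_in_powM ig ih; rewrite add0r.
Qed.

Lemma cong_tr n N (g : 'M[F]_n) : cong N g -> cong N g^T.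
Proof.
move=> [ug hg]; split; rewrite ?unitmx_tr //.
by have -> : g^T - 1%:M = (g - 1%:M)^T by [rewrite linearB /= trmx1]; apply: mx_in_pow_tr.
Qed.

(** Each of the two factors [k] and [k^-1] costs at most [B] levels: conjugate
    congruence subgroups are commensurable. *)
Lemma cong_conj n N (B : nat) (k g : 'M[F]_n) : k \in unitmx ->
  mx_in_pow (- B%:Z) k -> mx_in_pow (- B%:Z) (invmx k) ->
  cong (N + B + B) g -> cong N (invmx k *m g *m k).
Proof.
move=> uk ik jk [ug hg]; split; first by rewrite !unitmx_mul unitmx_inv uk ug.
have -> : invmx k *m g *m k - 1%:M = invmx k *m (g - 1%:M) *m k.
  by rewrite mulmxBr mulmxBl mulmx1 mulVmx.
by apply: mx_in_pow_le (mx_in_powM (mx_in_powM jk hg) ik); lia.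
Qed.

Lemma cong_conj_GLo n N (k g : 'M[F]_n) : GLo k -> cong N g -> cong N (invmx k *m g *m k).
Proof.
by move=> [uk ik jk] hg; apply: (@cong_conj _ _ 0%N) => //; rewrite ?addn0.
Qed.

Lemma in_pow_prod (I : Type) (r : seq I) (P : pred I) (f : I -> F) :
  (forall i, P i -> in_pow 0 (f i)) -> in_pow 0 (\prod_(i <- r | P i) f i).
Proof. by move=> h; elim/big_ind: _ => // x y hx hy; have := in_powM hx hy. Qed.

Lemma in_pow_det n (k : 'M[F]_n) : mx_in_pow 0 k -> in_pow 0 (\det k).
Proof.
move=> h; apply: in_pow_sum => s _.
have hs : in_pow 0 ((-1) ^+ s : F) by case: (odd_perm s); rewrite ?expr1 ?expr0 ?in_powN.
by have := in_powM hs (@in_pow_prod _ (index_enum 'I_n) xpredT _ (fun i _ => h i (s i))).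
Qed.

Lemma GLo_det n (k : 'M[F]_n) : GLo k -> lf_val (\det k) = 0.
Proof.
move=> [uk ik jk]; have dk : \det k != 0 by rewrite -unitfE -unitmxE.
have h1 : 0 <= lf_val (\det k) by rewrite -in_powE //; apply: in_pow_det.
have h2 : 0 <= - lf_val (\det k).
  by rewrite -lf_valV // -det_inv -in_powE ?det_inv ?invr_eq0 // -det_inv; apply: in_pow_det.
by apply/eqP; rewrite eq_le h1 -oppr_ge0 h2.
Qed.

Lemma detVal_mul n (g h : 'M[F]_n) : g \in unitmx -> h \in unitmx ->
  lf_val (\det (g *m h)) = lf_val (\det g) + lf_val (\det h).
Proof. by rewrite !unitmxE !unitfE => ug uh; rewrite det_mulmx lf_valM. Qed.

(** A pivot of minimal valuation in the last row clears that row by an element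
    of [GL_n(o)] on the right, and one proceeds by induction. *)
Lemma iwasawa n (g : 'M[F]_n) : g \in unitmx -> exists u d k,
  [/\ unipotent u, regular_diag d, GLo k & g = u *m diag_mx d *m k].
Proof.
elim: n g => [|n IH]; last rewrite -addn1; move=> g ug.
  exists 1%:M, 0, 1%:M; split; [exact: unipotent1 | by case | exact: GLo1| by apply/matrixP; case].
pose z : 'I_(n + 1) := rshift n 0.
have [j gj hj] : exists2 j, g z j != 0 & forall i, in_pow (lf_val (g z j)) (g z i).
  have [j0 g0] : exists j, g z j != 0.
    apply: contrapT => /forallNP h; have e : row z g = 0.
      by apply/rowP => j; rewrite !mxE; apply/eqP/negPn/negP; apply: h.
    have : row z (g *m invmx g) = 0 by rewrite row_mul e mul0mx.
    rewrite mulmxV // => /rowP /(_ z); rewrite !mxE eqxx => /eqP; rewrite oner_eq0 //.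
  case: (@Order.TotalTheory.arg_minP _ _ _ j0 (fun j => g z j != 0) (fun j => lf_val (g z j)) g0) => j gj hj.
  exists j => // i; have [->|gi] := eqVneq (g z i) 0; first exact: in_pow0.
  by rewrite in_powE //; apply: hj.
pose s := perm_mx (tperm j z) : 'M[F]_(n + 1).
have ks : GLo s by apply: GLo_perm.
have [us _ _] := ks.
have ss : s *m s = 1%:M by rewrite -perm_mxM tperm2 perm_mx1.
have [g' eg'] : exists g', g' = g *m s by exists (g *m s).
have ug' : g' \in unitmx by rewrite eg' unitmx_mul ug.
have g'E i0 : g' z i0 = g z (tperm j z i0).
  by rewrite eg' /s -{1}[tperm j z]tpermV -col_permE mxE.
pose A := ulsubmx g'; pose b := ursubmx g'; pose r := dlsubmx g'; pose t := g' z z.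
have tE : drsubmx g' = t%:M.
  by apply/matrixP => i j'; rewrite !ord1 !mxE /t /z eqxx mulr1n.
have t0 : t != 0 by rewrite /t g'E tpermR.
have hr : mx_in_pow 0 (t^-1 *: r).
  move=> i' i; rewrite ord1 !mxE -/z.
  have -> : 0 = - lf_val (g z j) + lf_val (g z j) by lia.
  apply: in_powM; first by rewrite in_powE ?invr_eq0 // lf_valV // /t g'E tpermR.
  by rewrite g'E; apply: hj.
pose k1 : 'M[F]_(n + 1) := block_mx 1%:M 0 (t^-1 *: r) 1%:M.
pose k1' : 'M[F]_(n + 1) := block_mx 1%:M 0 (- (t^-1 *: r)) 1%:M.
have k11 : k1 *m k1' = 1%:M.
  by rewrite mulmx_block !mul0mx !mulmx0 !mul1mx !mulmx1 !addr0 addrC addNr add0r -scalar_mx_block.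
have hb (c : 'M[F]_(1, n)) : mx_in_pow 0 c -> mx_in_pow 0 (block_mx 1%:M 0 c 1%:M : 'M[F]_(n + 1)).
  move=> hc i i'; rewrite -[i]splitK -[i']splitK.
  by case: (fintype.split i) => ?; case: (fintype.split i') => ? /=;
    rewrite ?(block_mxEul, block_mxEur, block_mxEdl, block_mxEdr) //; rewrite ?mxE //; case: eqP.
have uk1 : k1 \in unitmx by case: (mulmx1_unit k11).
have Gk1 : GLo k1.
  split=> //; first exact: hb.
  suff -> : invmx k1 = k1' by apply: hb; apply: mx_in_powN.
  by apply: (can_inj (mulKmx uk1)); rewrite mulmxV.
pose A' := A - t^-1 *: (b *m r).
have g'_eq : g' = block_mx A' b 0 t%:M *m k1.
  rewrite mulmx_block !mul0mx !mulmx0 !mulmx1 !add0r -scalemxAr subrK.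
  by rewrite mul_scalar_mx scalerA divff // scale1r -tE submxK.
have uA' : A' \in unitmx.
  have : block_mx A' b 0 t%:M \in unitmx by move: ug'; rewrite g'_eq unitmx_mul => /andP[].
  by rewrite !unitmxE det_ublock unitrM => /andP[].
have [u' [d' [k' [hu' hd' hk' eA']]]] := IH _ uA'.
exists (block_mx u' (t^-1 *: b) 0 1%:M), (row_mx d' t%:M), (block_mx k' 0 0 1%:M *m k1 *m s); split.
- by apply: unipotent_block => //; apply: unipotent1.
- move=> i; rewrite -[i]splitK; case: (fintype.split i) => i' /=; first by rewrite row_mxEl.
  by rewrite row_mxEr mxE ord1 eqxx mulr1n.
- by apply: GLoM => //; apply: GLoM => //; apply: GLo_block => //; apply: GLo1.
rewrite diag_mx_row !mulmxA.
have -> : g = g' *m s by rewrite eg' -mulmxA ss mulmx1.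
congr (_ *m s); rewrite g'_eq; congr (_ *m k1).
rewrite !mulmx_block !mul0mx !mulmx0 !addr0 !add0r !mul1mx !mulmx1 -eA'.
have -> : diag_mx (t%:M : 'rV[F]_1) = t%:M.
  by apply/matrixP => i i'; rewrite !ord1 !mxE eqxx !mulr1n.
by rewrite mul_mx_scalar scalerA divff // scale1r mul0mx.
Qed.
End IntegralMatrices.

(** * Representatives modulo powers of the uniformiser *)

Section MatrixRepresentatives.
Variable F : local_field.

(** The entries outside [S] are kept at 0, so that triangular systems of
    representatives are covered; the bounds depend on the entry because
    conjugation by the torus rescales the entries differently. *)
Lemma mx_reps a b (S : 'I_a -> 'I_b -> bool) (lo : 'I_a -> 'I_b -> int) (r : 'I_a -> 'I_b -> nat) :
  exists (I : finType) (L : I -> 'M[F]_(a, b)),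
  [/\ #|I| = (lf_q F ^ (\sum_i \sum_(j | S i j) r i j))%N,
      forall t i j, in_pow (lo i j) (L t i j),
      forall t i j, ~~ S i j -> L t i j = 0,
      forall t t', (forall i j, S i j -> in_pow (lo i j + (r i j)%:Z) (L t i j - L t' i j)) -> t = t'
    & forall X : 'M[F]_(a, b), (forall i j, in_pow (lo i j) (X i j)) ->
        exists t, forall i j, S i j -> in_pow (lo i j + (r i j)%:Z) (X i j - L t i j)].
Proof.
have ex (ij : 'I_a * 'I_b) := pow_reps F (lo ij.1 ij.2) (r ij.1 ij.2).
case: (boolp.choice ex) => s hs.
pose s' ij := if S ij.1 ij.2 then s ij else [:: 0].
have s'T i j : S i j -> s' (i, j) = s (i, j) by rewrite /s' /= => ->.
have s'F i j : ~~ S i j -> s' (i, j) = [:: 0] by rewrite /s' /= => /negPf->.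
have sz ij : (0 < size (s' ij))%N.
  rewrite /s'; case: ifP => // _; have [_ _ _ _ h] := hs ij.
  by have [y] := h 0 (in_pow0 _ _); case: (s ij).
have lt (ij : 'I_a * 'I_b) (k : 'I_(size (s' ij))) : (s' ij)`_k \in s' ij by apply: mem_nth.
pose I := {dffun forall ij : 'I_a * 'I_b, 'I_(size (s' ij))}.
exists I, (fun t : I => \matrix_(i, j) (s' (i, j))`_(t (i, j))); split.
- rewrite card_dep_ffun foldrE big_image /= expn_sum.
  under [RHS]eq_bigr do rewrite expn_sum big_mkcond /=.
  rewrite pair_big /=; apply: eq_bigr => -[i j] _ /=; rewrite card_ord /s' /=.
  by case: ifP => // _; have [-> _ _ _ _] := hs (i, j).
- move=> t i j; rewrite mxE; have := lt _ (t (i, j)).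
  case: (boolP (S i j)) => [/s'T|/s'F] e; rewrite [X in _ \in X]e; last by rewrite inE => /eqP->.
  by have [_ _ h _ _] := hs (i, j); apply: h.
- move=> t i j /s'F e; rewrite mxE; have := lt _ (t (i, j)).
  by rewrite [X in _ \in X]e inE => /eqP.
- move=> t t' h; apply/ffunP => -[i j]; apply: val_inj => /=.
  have e : (s' (i, j))`_(t (i, j)) = (s' (i, j))`_(t' (i, j)).
    have k1 := lt _ (t (i, j)); have k2 := lt _ (t' (i, j)); have := h i j; rewrite !mxE.
    case: (boolP (S i j)) => [Sij /(_ isT)|/s'F e _].
      by have [_ _ _ inj _] := hs (i, j); apply: inj; rewrite -[X in _ \in X](s'T i j Sij).
    by move: k1 k2; rewrite [X in _ \in X]e [X in _ -> _ \in X -> _]e !inE => /eqP-> /eqP->.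
  have u : uniq (s' (i, j)) by rewrite /s'; case: ifP => // _; have [_] := hs (i, j).
  by apply/eqP; rewrite -(nth_uniq 0 _ _ u) ?ltn_ord // e.
- move=> X hX.
  have ch (ij : 'I_a * 'I_b) : exists k : nat, (k < size (s' ij))%N /\ (S ij.1 ij.2 ->
      in_pow (lo ij.1 ij.2 + (r ij.1 ij.2)%:Z) (X ij.1 ij.2 - (s' ij)`_k)).
    case: ij => i j /=; case: (boolP (S i j)) => Sij; last by exists 0%N; split; first exact: sz.
    have [_ _ _ _ h] := hs (i, j); have [y ys hy] := h _ (hX i j).
    exists (index y (s' (i, j))); rewrite index_mem (s'T i j Sij); split=> // _.
    by rewrite nth_index.
  case: (boolp.choice ch) => f hf.
  exists [ffun ij => Ordinal (proj1 (hf ij))] => i j Sij; rewrite mxE ffunE.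
  exact: (proj2 (hf (i, j)) Sij).
Qed.

End MatrixRepresentatives.

(** * Invariant integrals on N_n \ GL_n(F) *)

Section QuotientHaar.
Variables (F : local_field) (n : nat).
Notation G := 'M[F]_n.

Definition ind (R : fieldType) (A : G -> Prop) : G -> R := fun g => (`[< A g >])%:R.

(** The double coset [N t K_N], [K_N] the principal congruence subgroup. *)
Definition dcoset (t : G) (N : nat) (g : G) :=
  exists u k, [/\ unipotent u, cong N k & g = u *m t *m k].

Definition N_invariant (R : fieldType) (phi : G -> R) :=
  forall u g, unipotent u -> g \in unitmx -> phi (u *m g) = phi g.
Definition of_level (R : fieldType) (N : nat) (phi : G -> R) :=
  forall g k, g \in unitmx -> cong N k -> phi (g *m k) = phi g.
Definition supported (R : fieldType) (M : int) (phi : G -> R) :=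
  forall g, g \in unitmx -> phi g <> 0 ->
    exists u, [/\ unipotent u, mx_in_pow M (u *m g) & mx_in_pow M (invmx (u *m g))].

Section Functions.
Variable R : fieldType.
Implicit Types (phi psi : G -> R).

Lemma of_level_le phi N M : (N <= M)%N -> of_level N phi -> of_level M phi.
Proof. by move=> h hp g k ug /(cong_le h); apply: hp. Qed.

Lemma supported_le phi (M N : int) : N <= M -> supported M phi -> supported N phi.
Proof.
by move=> h hp g ug /(hp _ ug) [u [? ? ?]]; exists u; split=> //; apply: mx_in_pow_le h _.
Qed.

Lemma Cc_quotP phi : Cc_quot phi <->
  exists N M, [/\ (0 < N)%N, N_invariant phi, of_level N phi & supported M phi].
Proof.
split=> [[h1 [N h2] [M h3]]|[N [M [_ h1 h2 h3]]]]; last by split; [|exists N|exists M].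
by exists N.+1, M; split=> //; apply: of_level_le h2.
Qed.

Lemma Cc_ext phi psi : (forall g, g \in unitmx -> phi g = psi g) -> Cc_quot phi -> Cc_quot psi.
Proof.
move=> e [h1 [N h2] [M h3]]; split.
- by move=> u g hu ug; rewrite -!e ?h1 // unitmx_mul unipotent_unit.
- by exists N => g k ug ck; rewrite -!e ?h2 // unitmx_mul ug; case: ck.
- by exists M => g ug; rewrite -e //; apply: h3.
Qed.

Lemma Cc_lin a phi psi : Cc_quot phi -> Cc_quot psi -> Cc_quot (fun g => a * phi g + psi g).
Proof.
move=> /Cc_quotP[N [M [_ h1 h2 h3]]] /Cc_quotP[N' [M' [_ h1' h2' h3']]]; split.
- by move=> u g hu ug; rewrite h1 // h1'.
- exists (maxn N N') => g k ug ck.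
  by rewrite h2 ?h2' //; apply: cong_le ck; rewrite ?leq_maxl ?leq_maxr.
- exists (Num.min M M') => g ug ne.
  have [e|ne1] := eqVneq (phi g) 0.
    have [|u [? ? ?]] := h3' g ug; first by move=> e'; apply: ne; rewrite e e' mulr0 addr0.
    by exists u; split=> //; apply: (@mx_in_pow_le _ M') => //; rewrite ge_min lexx orbT.
  have [|u [? ? ?]] := h3 g ug; first exact/eqP.
  by exists u; split=> //; apply: (@mx_in_pow_le _ M) => //; rewrite ge_min lexx.
Qed.

Lemma Cc_0 : Cc_quot (fun _ : G => 0 : R).
Proof. by split => //; [exists 0%N | exists 0]. Qed.

Lemma Cc_sum (I : Type) (r : seq I) (P : pred I) (a : I -> R) (phi : I -> G -> R) :
  (forall i, Cc_quot (phi i)) -> Cc_quot (fun g => \sum_(i <- r | P i) a i * phi i g).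
Proof.
move=> h; elim: r => [|i r IH].
  by apply: Cc_ext Cc_0 => g _; rewrite big_nil.
case Pi: (P i); last by apply: Cc_ext IH => g _; rewrite big_cons Pi.
by apply: Cc_ext (Cc_lin (a i) (h i) IH) => g _; rewrite big_cons Pi.
Qed.

Lemma Cc_translate phi h : h \in unitmx -> Cc_quot phi -> Cc_quot (fun g => phi (g *m h)).
Proof.
move=> uh /Cc_quotP[N [M [N0 h1 h2 h3]]].
have [B1 hB1] := mx_in_pow_ex h; have [B2 hB2] := mx_in_pow_ex (invmx h).
pose B := maxn B1 B2.
have hB : mx_in_pow (- B%:Z) h by apply: mx_in_pow_le hB1; rewrite /B; lia.
have hB' : mx_in_pow (- B%:Z) (invmx h) by apply: mx_in_pow_le hB2; rewrite /B; lia.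
split.
- by move=> u g hu ug; rewrite -mulmxA h1 // unitmx_mul ug.
- exists (N + B + B)%N => g k ug ck.
  have -> : g *m k *m h = g *m h *m (invmx h *m k *m h).
    by rewrite !mulmxA mulmxK.
  by rewrite h2 ?unitmx_mul ?ug //; apply: cong_conj ck.
- exists (M - B%:Z) => g ug ne; have [|u [hu i1 i2]] := h3 _ _ ne; first by rewrite unitmx_mul ug.
  have uu := unipotent_unit hu.
  exists u; split=> //.
    have -> : u *m g = u *m (g *m h) *m invmx h by rewrite !mulmxA mulmxK.
    by apply: mx_in_pow_le (mx_in_powM i1 hB'); lia.
  have -> : invmx (u *m g) = h *m invmx (u *m (g *m h)).
    by rewrite !invmx_mul ?unitmx_mul ?uu ?ug // !mulmxA mulmxV // mul1mx.
  by apply: mx_in_pow_le (mx_in_powM hB i2); lia.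
Qed.

Lemma ind_iff A B g h : (A g <-> B h) -> ind R A g = ind R B h.
Proof. by move=> e; rewrite /ind; congr (nat_of_bool _)%:R; apply: asbool_equiv_eq. Qed.

Lemma indT (A : G -> Prop) g : A g -> ind R A g = 1.
Proof. by move=> h; rewrite /ind; case: asboolP. Qed.

Lemma indF (A : G -> Prop) g : ~ A g -> ind R A g = 0.
Proof. by move=> h; rewrite /ind; case: asboolP. Qed.

Lemma Cc_dcoset t N : (0 < N)%N -> t \in unitmx -> Cc_quot (ind R (dcoset t N)).
Proof.
move=> N0 ut; split.
- move=> u g hu ug; apply: ind_iff; split=> [[u' [k [hu' ck e]]]|[u' [k [hu' ck e]]]].
    exists (invmx u *m u'), k; split=> //; first by apply: unipotentM => //; apply: unipotentV.
    by rewrite -!mulmxA [u' *m _]mulmxA -e mulKmx // unipotent_unit.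
  by exists (u *m u'), k; split=> //; [exact: unipotentM | rewrite e !mulmxA].
- exists N => g k ug ck; apply: ind_iff; split=> [[u' [k' [hu' ck' e]]]|[u' [k' [hu' ck' e]]]].
    exists u', (k' *m invmx k); split=> //; first by apply: congM => //; apply: congV.
    by rewrite mulmxA -e mulmxK //; case: ck.
  by exists u', (k' *m k); split=> //; [exact: congM | rewrite e !mulmxA].
have [B1 hB1] := mx_in_pow_ex t; have [B2 hB2] := mx_in_pow_ex (invmx t).
exists (- (maxn B1 B2)%:Z) => g ug.
case: (EM (dcoset t N g)) => [[u [k [hu ck e]]] _|h]; last by rewrite indF.
have [uk ik jk] := cong_GLo N0 ck; have uu := unipotent_unit hu.
exists (invmx u); split; first exact: unipotentV.
  rewrite e -!mulmxA mulKmx //.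
  by apply: mx_in_pow_le (mx_in_powM hB1 ik); lia.
rewrite e -!mulmxA mulKmx // invmx_mul //.
by apply: mx_in_pow_le (mx_in_powM jk hB2); lia.
Qed.
End Functions.

Section Measure.
Variables (R : fieldType) (mu : (G -> R) -> R) (hmu : haar_quot mu).
Implicit Types (phi psi : G -> R).

Lemma haar_ext phi psi : Cc_quot phi -> (forall g, g \in unitmx -> phi g = psi g) -> mu phi = mu psi.
Proof. by move=> h e; case: hmu => + _ _ _; apply => //; apply: Cc_ext e h. Qed.

Lemma haar_lin a phi psi : Cc_quot phi -> Cc_quot psi ->
  mu (fun g => a * phi g + psi g) = a * mu phi + mu psi.
Proof. by case: hmu => _ + _ _; apply. Qed.

Lemma haar_0 : mu (fun=> 0) = 0.
Proof.
have h := Cc_0 R; have e : mu (fun=> -1 * 0 + 0) = 0 by rewrite haar_lin // mulN1r addNr.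
by rewrite -[RHS]e; apply: haar_ext => // g _; rewrite mulr0 addr0.
Qed.

Lemma haar_sum (I : Type) (r : seq I) (P : pred I) (a : I -> R) (phi : I -> G -> R) :
  (forall i, Cc_quot (phi i)) ->
  mu (fun g => \sum_(i <- r | P i) a i * phi i g) = \sum_(i <- r | P i) a i * mu (phi i).
Proof.
move=> h; elim: r => [|i r IH].
  by rewrite big_nil -[RHS]haar_0; apply: haar_ext; [apply: Cc_sum | move=> g _; rewrite big_nil].
rewrite big_cons; have c := Cc_sum r P a h.
have e : (fun g => \sum_(j <- i :: r | P j) a j * phi j g) =
    if P i then (fun g => a i * phi i g + \sum_(j <- r | P j) a j * phi j g)
    else (fun g => \sum_(j <- r | P j) a j * phi j g).
  by apply/funext => g; rewrite big_cons; case: ifP.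
by rewrite e; case: ifP => _ //; rewrite haar_lin // IH.
Qed.

Lemma haar_scale a phi : Cc_quot phi -> mu (fun g => a * phi g) = a * mu phi.
Proof.
move=> h; rewrite -[RHS]addr0 -haar_0 -haar_lin //; last exact: Cc_0.
by congr mu; apply/funext => g; rewrite addr0.
Qed.

Lemma haar_translate phi h : Cc_quot phi -> h \in unitmx -> mu (fun g => phi (g *m h)) = mu phi.
Proof. by case: hmu => _ _ + _; apply. Qed.

(** Right translates have the same volume, and here they tile [A]. *)
Lemma haar_tile (I : finType) (y : I -> G) (A B : G -> Prop) :
  Cc_quot (ind R B) -> (forall i, y i \in unitmx) ->
  (forall g, g \in unitmx -> A g <-> exists i, B (g *m y i)) ->
  (forall g i j, g \in unitmx -> B (g *m y i) -> B (g *m y j) -> i = j) ->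
  mu (ind R A) = #|I|%:R * mu (ind R B).
Proof.
move=> cB uy hA hB.
have c i : Cc_quot (fun g => ind R B (g *m y i)) by apply: Cc_translate.
have -> : mu (ind R A) = mu (fun g => \sum_i 1 * ind R B (g *m y i)).
  apply/esym; apply: haar_ext; first by apply: Cc_sum.
  move=> g ug; under eq_bigr do rewrite mul1r.
  case: (EM (A g)) => [Ag|nA].
    have [i hi] := (hA g ug).1 Ag.
    rewrite (indT R Ag) (bigD1 i) //= (indT R hi) big1 ?addr0 // => j ji; apply: indF => hj.
    by move: ji; rewrite (hB _ _ _ ug hi hj) eqxx.
  rewrite (indF R nA) big1 // => i _; apply: indF => hi; apply: nA; apply/hA => //.
  by exists i.
rewrite haar_sum //; under eq_bigr do rewrite mul1r haar_translate //.
by rewrite sumr_const mulr_natl.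
Qed.
End Measure.

Lemma dcoset_translate (R : fieldType) (mu : (G -> R) -> R) t h N :
  haar_quot mu -> (0 < N)%N -> t \in unitmx -> h \in unitmx ->
  mu (ind R (fun g => dcoset (t *m h) N (g *m h))) = mu (ind R (dcoset (t *m h) N)).
Proof.
move=> hmu N0 ut uh; apply: (haar_translate hmu (phi := ind R (dcoset (t *m h) N))) => //.
by apply: Cc_dcoset; rewrite // unitmx_mul ut.
Qed.

(** [N t d K_M d^-1] is tiled by right translates of [N t K_M'], the
    translating elements being lower triangular since [N] absorbs the upper
    triangular part.  The last hypothesis makes the terms that are quadratic in
    [K_M] negligible modulo [K_M'].  Every volume computation on the quotient
    is deduced from this one, with [d = 1] or [t = 1]. *)
Lemma dcoset_tile (e d : 'rV[F]_n) (M M' : nat) : (0 < M)%N -> (0 < M')%N ->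
  regular_diag e -> regular_diag d ->
  (forall i j, 1 <= M%:Z + (lf_val (d 0 i) - lf_val (d 0 j)) <= M'%:Z) ->
  (forall i j, M'%:Z <= M%:Z + M%:Z + (lf_val (d 0 i) - lf_val (d 0 j))) ->
  exists r : nat, ((0 < n)%N -> (M < M')%N -> (0 < r)%N) /\
  forall (R : fieldType) (mu : (G -> R) -> R), haar_quot mu ->
    mu (ind R (dcoset (diag_mx e *m diag_mx d) M)) =
    (lf_q F)%:R ^+ r * mu (ind R (dcoset (diag_mx e) M')).
Proof.
move=> M0 M'0 re rd bd bd2.
pose a (i j : 'I_n) : int := lf_val (d 0 i) - lf_val (d 0 j).
pose S (i j : 'I_n) := (j <= i)%N.
pose lo i j : int := M%:Z + a i j; pose r i j := `|M'%:Z - lo i j|%N.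
have lor i j : lo i j + (r i j)%:Z = M'%:Z by have := bd i j; rewrite /r /lo /a; lia.
have [I [L [cI iL zL injL exL]]] := mx_reps F S lo r.
set t := diag_mx e; set D := diag_mx d.
have ut : t \in unitmx by apply: diag_unit.
have uD : D \in unitmx by apply: diag_unit.
have DE X i j : (D *m X *m invmx D) i j = d 0 i * X i j / d 0 j by apply: diag_conjE.
have DE' X i j : (invmx D *m X *m D) i j = (d 0 i)^-1 * X i j * d 0 j.
  by rewrite diag_inv // mul_mx_diag mul_diag_mx !mxE.
have toD (m : int) X : mx_in_pow m X -> forall i j, in_pow (m + a i j) ((D *m X *m invmx D) i j).
  move=> hX i j; rewrite DE; have -> : m + a i j = lf_val (d 0 i) + m + (- lf_val (d 0 j)) by rewrite /a; lia.
  by rewrite !in_powM ?hX // in_powE ?invr_eq0 ?rd // ?lf_valV ?rd.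
have ofD (m : int) (X : G) : (forall i j, in_pow (m + a i j) (X i j)) -> mx_in_pow m (invmx D *m X *m D).
  move=> hX i j; rewrite DE'; have -> : m = - lf_val (d 0 i) + (m + a i j) + lf_val (d 0 j) by rewrite /a; lia.
  by rewrite !in_powM ?hX // in_powE ?invr_eq0 ?rd // ?lf_valV ?rd.
have iL1 x : mx_in_pow 1 (L x).
  by move=> i j; apply: in_pow_le (iL x i j); have := bd i j; rewrite /lo /a; lia.
pose y x := 1%:M + L x.
have uy x : y x \in unitmx by apply: unit_addmx.
have cy x : cong 1 (y x) by apply: cong_add.
have Dcong k : cong M' k -> cong M (invmx D *m k *m D).
  move=> [uk hk]; split; first by rewrite !unitmx_mul unitmx_inv uD uk.
  have -> : invmx D *m k *m D - 1%:M = invmx D *m (k - 1%:M) *m D.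
    by rewrite mulmxBr mulmxBl mulmx1 mulVmx.
  by apply: ofD => i j; apply: in_pow_le (hk i j); have := bd i j; rewrite /a; lia.
have Dy x : cong M (invmx D *m y x *m D).
  split; first by rewrite !unitmx_mul unitmx_inv uD uy.
  have -> : invmx D *m y x *m D - 1%:M = invmx D *m L x *m D.
    by rewrite /y mulmxDr mulmxDl mulmx1 mulVmx // addrC addKr.
  by apply: ofD => i j; apply: iL.
(* [k = 1 + U + X] with [U] strictly upper and [X] lower triangular: [1 - U]
   removes [U] up to a quadratic term, and [X] is matched by a representative *)
have cover g : g \in unitmx ->
    dcoset (t *m D) M (g *m D) <-> exists x, dcoset t M' (g *m invmx (y x)).
  move=> ug; split=> [[u [k [hu ck eg]]]|[x [u [k [hu ck eg]]]]]; last first.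
    have -> : g = u *m t *m k *m y x by rewrite -eg mulmxKV.
    exists u, (invmx D *m (k *m y x) *m D); split=> //; last by rewrite !mulmxA mulmxK.
    have -> : invmx D *m (k *m y x) *m D = (invmx D *m k *m D) *m (invmx D *m y x *m D).
      by rewrite !mulmxA mulmxK.
    by apply: congM => //; apply: Dcong.
  have [uk hk] := ck.
  pose U : G := \matrix_(i, j) (if (i < j)%N then (k - 1%:M) i j else 0).
  pose X : G := \matrix_(i, j) (if (j <= i)%N then (k - 1%:M) i j else 0).
  have kUX : k = 1%:M + (U + X).
    apply/matrixP => i j; rewrite !mxE; case: ltnP => _; last by rewrite add0r addrC subrK.
    by rewrite addr0 addrC subrK.
  have hU : mx_in_pow M%:Z U by move=> i j; rewrite mxE; case: ifP.
  have hX : mx_in_pow M%:Z X by move=> i j; rewrite mxE; case: ifP.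
  have uU : unipotent (1%:M - U).
    by move=> i j ji; rewrite !mxE ltnNge ji subr0.
  have ek : (1%:M - U) *m k = 1%:M + X - U *m (U + X).
    rewrite kUX mulmxDr mulmx1 mulmxBl mul1mx.
    by move: (U *m _) => Z; rewrite -!addrA; congr (_ + _); rewrite !addrA addNr add0r.
  have hUX : mx_in_pow (M%:Z + M%:Z) (U *m (U + X)).
    by apply: mx_in_powM => //; apply: mx_in_powD.
  have [x hx] := exL (D *m X *m invmx D) (toD _ _ hX).
  exists x.
  pose E := D *m X *m invmx D - D *m (U *m (U + X)) *m invmx D - L x.
  have hE : mx_in_pow M'%:Z E.
    have -> : E = (D *m X *m invmx D - L x) - D *m (U *m (U + X)) *m invmx D by rewrite /E addrAC.
    apply: mx_in_powB; last first.
      by move=> i j; apply: in_pow_le (toD _ _ hUX i j); have := bd2 i j; rewrite /a; lia.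
    move=> i j; case: (boolP (S i j)) => Sij.
      by have := hx i j Sij; rewrite lor !mxE.
    have nji : (j <= i)%N = false by apply: negPf Sij.
    rewrite mxE [(- L x) i j]mxE (zL _ _ _ Sij) DE mxE nji.
    by rewrite mulr0 mul0r subr0.
  have uU' : 1%:M - U \in unitmx by apply: unipotent_unit.
  have eDk : D *m ((1%:M - U) *m k) *m invmx D = E + y x.
    rewrite ek /E /y mulmxBr mulmxBl mulmxDr mulmxDl mulmx1 mulmxV //.
    by move: (D *m X *m invmx D) (D *m _ *m _) (L x) => P Q T;
      rewrite [RHS]addrA [_ + 1%:M]addrC -!addrA; congr (_ + _); rewrite addNr addr0.
  exists (u *m (t *m (D *m invmx (1%:M - U) *m invmx D) *m invmx t)), (E *m invmx (y x) + 1%:M).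
  split.
  - apply: unipotentM => //; apply: unipotent_conj_diag => //; apply: unipotent_conj_diag => //.
    exact: unipotentV.
  - rewrite addrC; apply: cong_add => //.
    have [_ _ jy] := cong_GLo (isT : (0 < 1)%N) (cy x).
    by have := mx_in_powM hE jy; rewrite addr0.
  - rewrite -[g](mulmxK uD) eg.
    have -> : E *m invmx (y x) + 1%:M = (E + y x) *m invmx (y x) by rewrite mulmxDl mulmxV.
    rewrite -eDk !mulmxA; congr (_ *m _ *m _); rewrite !mulmxKV //.
(* Two meeting translates differ by a unipotent [V]; on and below the diagonal
   [V] is the identity, which forces the two representatives to agree. *)
have disj g x x' : g \in unitmx -> dcoset t M' (g *m invmx (y x)) ->
    dcoset t M' (g *m invmx (y x')) -> x = x'.
  move=> ug [u [k [hu ck eg]]] [u' [k' [hu' ck' eg']]].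
  have uu := unipotent_unit hu; have uu' := unipotent_unit hu'.
  have [uk hk] := ck; have [uk' hk'] := ck'.
  pose V := invmx t *m (invmx u' *m u) *m t.
  have hV : unipotent V.
    rewrite /V -{2}[t]invmxK; have eV : invmx t = diag_mx (\row_i (e 0 i)^-1) by apply: diag_inv.
    rewrite eV; apply: unipotent_conj_diag; first by move=> i; rewrite mxE invr_eq0.
    by apply: unipotentM => //; apply: unipotentV.
  have eq1 : V *m (k *m y x) = k' *m y x'.
    have : g = u *m t *m k *m y x by rewrite -eg mulmxKV.
    have -> : g = u' *m t *m k' *m y x' by rewrite -eg' mulmxKV.
    rewrite /V => h; apply: (can_inj (mulKmx ut)); apply: (can_inj (mulKmx uu')).
    by rewrite !mulmxA (mulmxK ut) (mulmxV uu') mul1mx h.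
  pose c X := invmx D *m X *m D.
  have cM X Y : c (X *m Y) = c X *m c Y by rewrite /c !mulmxA mulmxK.
  have ckv : cong M (c V).
    have h z (h : G) : cong M' h -> cong M (c (h *m y z)) by move=> ch; rewrite cM; apply: congM => //; [exact: Dcong | exact: Dy].
    have : c V *m c (k *m y x) = c (k' *m y x') by rewrite -cM eq1.
    have [ux _] := h x _ ck.
    move=> /(congr1 (mulmx^~ (invmx (c (k *m y x))))); rewrite mulmxK // => ->.
    by apply: congM => //; [exact: h | apply: congV => //; exact: h].
  have cV1 : c (V - 1%:M) = c V - 1%:M by rewrite /c mulmxBr mulmxBl mulmx1 mulVmx.
  have cVL : mx_in_pow M'%:Z ((V - 1%:M) *m L x).
    have -> : (V - 1%:M) *m L x = D *m (c ((V - 1%:M) *m L x)) *m invmx D.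
      by rewrite /c !mulmxA mulmxV // mul1mx mulmxK.
    have h1 : mx_in_pow M%:Z (c (V - 1%:M)) by rewrite cV1; case: ckv.
    have h2 : mx_in_pow M%:Z (c (L x)) by apply: ofD => i j; apply: iL.
    move=> i j; rewrite cM; apply: in_pow_le (toD _ _ (mx_in_powM h1 h2) i j).
    by have := bd2 i j; rewrite /a; lia.
  have iV : mx_in_pow 0 V.
    have -> : V = k' *m y x' *m invmx (k *m y x) by rewrite -eq1 mulmxK // unitmx_mul uk uy.
    have [||_ h _ //] := @GLoM _ _ (k' *m y x') (invmx (k *m y x)).
      by apply: GLoM; [apply: cong_GLo ck' | apply: cong_GLo (cy x')].
    by apply: GLoV; apply: GLoM; [apply: cong_GLo ck | apply: cong_GLo (cy x)].
  have iy z : mx_in_pow 0 (y z) by have [_ h _] := cong_GLo (isT : (0 < 1)%N) (cy z).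
  have main : mx_in_pow M'%:Z (V - 1%:M + (L x - L x')).
    have -> : V - 1%:M + (L x - L x') =
        (k' - 1%:M) *m y x' - V *m (k - 1%:M) *m y x - (V - 1%:M) *m L x.
      have e3 : V *m (k - 1%:M) *m y x = k' *m y x' - (V + V *m L x).
        by rewrite mulmxBr mulmx1 mulmxBl -mulmxA eq1 [V *m y x]mulmxDr mulmx1.
      rewrite e3 !mulmxBl !mul1mx; move: (k' *m y x') (V *m L x) => P1 P2.
      by apply/matrixP => i j; rewrite !mxE; ring.
    apply: mx_in_powB => //; apply: mx_in_powB.
      by have := mx_in_powM hk' (iy x'); rewrite addr0.
    by have := mx_in_powM (mx_in_powM iV hk) (iy x); rewrite addr0 add0r.
  apply: injL => i j Sij; rewrite lor; clearbody V.
  have := main i j; rewrite !mxE hV // subrr add0r.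
  by [].
exists (\sum_i \sum_(j | S i j) r i j)%N; split.
  move=> n0 MM'; pose i0 := Ordinal n0; rewrite (bigD1 i0) //= (bigD1 i0) /S //= /r /lo /a subrr addr0.
  have : (0 < `|M'%:Z - M%:Z|)%N by lia.
  by rewrite -addnA addn_gt0 => ->.
move=> R mu hmu.
rewrite -dcoset_translate // (@haar_tile _ _ hmu I (fun x => invmx (y x)) _ (dcoset t M')) //.
- by rewrite cI natrX.
- exact: Cc_dcoset.
- by move=> x; rewrite unitmx_inv.
Qed.
End QuotientHaar.

(** * Volumes of double cosets *)

Section HaarFormula.
Variables (F : local_field) (n : nat).
Notation G := 'M[F]_n.
Notation q := (lf_q F).

Lemma diag1 : diag_mx (const_mx 1) = 1%:M :> G.
Proof. by rewrite diag_const_mx. Qed.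

Lemma regular1 : regular_diag (const_mx 1 : 'rV[F]_n).
Proof. by move=> i; rewrite mxE oner_neq0. Qed.

Lemma dcoset_level (e : 'rV[F]_n) N k : (0 < N)%N -> regular_diag e ->
  exists r : nat, ((0 < n)%N -> (0 < k)%N -> (0 < r)%N) /\
    forall (R : fieldType) (mu : (G -> R) -> R), haar_quot mu ->
    mu (ind R (dcoset (diag_mx e) N)) = q%:R ^+ r * mu (ind R (dcoset (diag_mx e) (N + k))).
Proof.
move=> N0 re; elim: k => [|k [r [r0 hr]]].
  by exists 0%N; split=> // R mu _; rewrite addn0 expr0 mul1r.
have [||||||r' [r'0 hr']] := @dcoset_tile F n e (const_mx 1) (N + k) (N + k.+1).
- by rewrite addn_gt0 N0.
- by rewrite addn_gt0 N0.
- by [].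
- exact: regular1.
- by move=> i j; rewrite !mxE subrr; lia.
- by move=> i j; rewrite !mxE subrr; lia.
exists (r + r')%N; split.
  by move=> n0 _; rewrite addn_gt0 (r'0 n0) ?orbT //; lia.
move=> R mu hmu; rewrite hr // exprD -mulrA; congr (_ * _).
by rewrite -(hr' R mu hmu) diag1 mulmx1.
Qed.

(** Both [N d K_N] and [N K_1] are tiled by translates of one double coset of
    deep level: at such a level [d] can be moved across the congruence
    subgroup. *)
Lemma dcoset_volume (d : 'rV[F]_n) N : (0 < N)%N -> regular_diag d ->
  exists z : int, forall (R : fieldType) (mu : (G -> R) -> R), haar_quot mu ->
    q%:R != 0 :> R ->
    mu (ind R (dcoset (diag_mx d) N)) = q%:R ^ z * mu (ind R (dcoset 1%:M 1)).
Proof.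
move=> N0 rd.
have [B hB] : exists B : nat, forall i j, - B%:Z <= lf_val (d 0 i) - lf_val (d 0 j) <= B%:Z.
  exists (\sum_i \sum_j `|lf_val (d 0%R i) - lf_val (d 0%R j)|)%N => i j.
  have : (`|lf_val (d 0%R i) - lf_val (d 0%R j)| <=
      \sum_i \sum_j `|lf_val (d 0%R i) - lf_val (d 0%R j)|)%N.
    by rewrite (bigD1 i) //= (bigD1 j) //= -addnA leq_addr.
  by move: (lf_val _ - lf_val _) => x; lia.
have [r1 [_ h1]] := dcoset_level (B + B + 1) N0 rd.
have [||||||r2 [_ h2]] := @dcoset_tile F n (const_mx 1) d (N + (B + B + 1)) (N + (B + B + 1) + B).
- by rewrite addn_gt0 N0.
- by rewrite !addn_gt0 N0.
- exact: regular1.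
- by [].
- by move=> i j; have := hB i j; lia.
- by move=> i j; have := hB i j; lia.
have [r3 [_ h3]] := @dcoset_level (const_mx 1) 1 (N + (B + B + 1) + B).-1 isT regular1.
exists ((r1 + r2)%N%:Z - r3%:Z) => R mu hmu q0.
have e3 : (1 + (N + (B + B + 1) + B).-1 = N + (B + B + 1) + B)%N by lia.
rewrite e3 diag1 in h3; rewrite diag1 mul1mx in h2.
by rewrite h1 // h2 // h3 // !mulrA -exprD (exprnP _ (r1 + r2)) (exprnP _ r3) -expfzDr // subrK.
Qed.

Lemma dcoset_refl N (g : G) : dcoset g N g.
Proof. by exists 1%:M, 1%:M; split; [exact: unipotent1 | exact: cong1 | rewrite mul1mx mulmx1]. Qed.

Lemma dcoset_sym N (g h : G) : (0 < N)%N -> g \in unitmx -> dcoset g N h -> dcoset h N g.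
Proof.
move=> N0 ug [u [k [hu ck ->]]]; have uu := unipotent_unit hu; have [uk _] := ck.
exists (invmx u), (invmx k); split; [exact: unipotentV | exact: congV |].
by rewrite !mulmxA mulVmx // mul1mx mulmxK.
Qed.

Lemma dcoset_trans N (g h x : G) : (0 < N)%N -> dcoset g N h -> dcoset h N x -> dcoset g N x.
Proof.
move=> N0 [u [k [hu ck ->]]] [u' [k' [hu' ck' ->]]].
by exists (u' *m u), (k *m k'); split; [exact: unipotentM | exact: congM | rewrite !mulmxA].
Qed.

(** A compact set modulo [N_n] meets finitely many double cosets [N_n h K_N],
    and a function of level [N] is constant on each of them. *)
Lemma Cc_decomposition N (M : int) : (0 < N)%N -> exists H : seq G, (forall h, h \in H -> h \in unitmx) /\
  forall (R : fieldType) (phi : G -> R), N_invariant phi -> of_level N phi -> supported M phi ->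
  forall g, g \in unitmx -> phi g = \sum_(h <- H) phi h * ind R (dcoset h N) g.
Proof.
move=> N0; pose m := `|M|%N.
have [I [L [_ _ _ _ exL]]] := @mx_reps F n n (fun _ _ => true) (fun _ _ => - m%:Z) (fun _ _ => (m + m + N)%N).
pose near (x : I) g := [/\ g \in unitmx, mx_in_pow (- m%:Z) g, mx_in_pow (- m%:Z) (invmx g) &
   mx_in_pow (m + N)%N%:Z (g - L x)].
have /boolp.choice[c hc] (x : I) : exists g, g \in unitmx /\ ((exists g', near x g') -> near x g).
  case: (EM (exists g', near x g')) => [[g h]|h]; first by exists g; case: (h).
  by exists 1%:M; rewrite unitmx1.
pose H0 := [seq c x | x <- enum I].
have uH0 h : h \in H0 -> h \in unitmx by move=> /mapP[x _ ->]; case: (hc x).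
have cover g u : g \in unitmx -> unipotent u -> mx_in_pow M (u *m g) ->
    mx_in_pow M (invmx (u *m g)) -> exists2 h, h \in H0 & dcoset h N g.
  move=> ug hu i1 i2; have uu := unipotent_unit hu.
  have i1' : mx_in_pow (- m%:Z) (u *m g) by apply: mx_in_pow_le i1; rewrite /m; lia.
  have i2' : mx_in_pow (- m%:Z) (invmx (u *m g)) by apply: mx_in_pow_le i2; rewrite /m; lia.
  have [x hx] := exL _ i1'.
  have nx : near x (u *m g).
    split; rewrite ?unitmx_mul ?uu // => i j; rewrite mxE [(- L x) i j]mxE.
    by apply: in_pow_le (hx i j isT); lia.
  have [uc /(_ (ex_intro _ _ nx)) [_ ic1 ic2 icx]] := hc x.
  exists (c x); first by apply: map_f; rewrite mem_enum.
  exists (invmx u), (invmx (c x) *m (u *m g)); split.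
  - exact: unipotentV.
  - split; first by rewrite !unitmx_mul unitmx_inv uc uu.
    have -> : invmx (c x) *m (u *m g) - 1%:M = invmx (c x) *m ((u *m g - L x) - (c x - L x)).
      by rewrite opprB addrA subrK mulmxBr mulVmx.
    have [_ _ _ inx] := nx.
    by apply: mx_in_pow_le (mx_in_powM ic2 (mx_in_powB inx icx)); lia.
  - by rewrite -mulmxA mulKVmx // mulKmx.
pose idx g := find (fun h => `[< dcoset h N g >]) H0.
have idx_eq g h : g \in unitmx -> h \in unitmx -> dcoset h N g -> idx h = idx g.
  move=> ug uh e; apply: eq_in_find => x /uH0 ux; apply: asbool_equiv_eq; split=> d.
    exact: dcoset_trans e.
  by apply: dcoset_trans d _ => //; apply: dcoset_sym e.
exists [seq h <- undup H0 | nth 1%:M H0 (idx h) == h].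
split=> [h|R phi h1 h2 h3 g ug]; first by rewrite mem_filter mem_undup => /andP[_ /uH0].
have same h : h \in H0 -> phi h * ind R (dcoset h N) g = phi g * ind R (dcoset h N) g.
  move=> /uH0 uh; case: (EM (dcoset h N g)) => [[u [k [hu ck e]]]|nd]; last by rewrite (indF _ nd) !mulr0.
  by rewrite e -mulmxA h1 ?h2 ?unitmx_mul ?uh //; case: ck.
rewrite big_seq; under eq_bigr => h.
  rewrite mem_filter mem_undup => /andP[_ /same] ->; over.
rewrite -big_seq -mulr_sumr.
have [->|ne] := eqVneq (phi g) 0; first by rewrite mul0r.
have [|u [hu i1 i2]] := h3 g ug; first exact/eqP.
have hex : has (fun h => `[< dcoset h N g >]) H0.
  have [h hH d] := cover g u ug hu i1 i2.
  by apply/hasP; exists h => //; apply/asboolP.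
pose h0 := nth 1%:M H0 (idx g).
have h0H : h0 \in H0 by apply: mem_nth; rewrite -has_find.
have d0 : dcoset h0 N g by have := nth_find 1%:M hex => /asboolP.
have e0 : idx h0 = idx g by apply: idx_eq => //; apply: uH0.
rewrite (bigD1_seq h0) /=; first last.
- by rewrite filter_uniq // undup_uniq.
- by rewrite mem_filter mem_undup h0H e0 -/h0 eqxx.
rewrite (indT _ d0) big_seq_cond big1 ?addr0 ?mulr1 // => h /andP[].
rewrite mem_filter mem_undup => /andP[/eqP eh hH] nh; apply: indF => d.
case/eqP: nh; rewrite -eh (@idx_eq g h ug (uH0 _ hH) d) //.
Qed.

Lemma haar_decomposition N (M : int) : (0 < N)%N -> exists H : seq G, (forall h, h \in H -> h \in unitmx) /\
  forall (R : fieldType) (mu : (G -> R) -> R) phi, haar_quot mu ->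
  N_invariant phi -> of_level N phi -> supported M phi ->
  mu phi = \sum_(h <- H) phi h * mu (ind R (dcoset h N)).
Proof.
move=> N0; have [H [uH hH]] := Cc_decomposition M N0; exists H; split=> // R mu phi hmu h1 h2 h3.
pose F' (h : G) : G -> R := if h \in unitmx then ind R (dcoset h N) else fun=> 0.
have cF h : Cc_quot (F' h) by rewrite /F'; case: ifP => uh; [apply: Cc_dcoset | apply: Cc_0].
have cphi : Cc_quot phi by apply/Cc_quotP; exists N, M.
transitivity (mu (fun g => \sum_(h <- H) phi h * F' h g)).
  apply: haar_ext => // g ug; rewrite (hH _ phi h1 h2 h3 g ug) big_seq [RHS]big_seq.
  by apply: eq_bigr => h /uH uh; rewrite /F' uh.
by rewrite haar_sum // big_seq [RHS]big_seq; apply: eq_bigr => h /uH uh; rewrite /F' uh.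
Qed.

(** [GL_n(o)] normalises the congruence subgroups, so the factor of [h] that
    lies in it can be translated away. *)
Lemma dcoset_iwasawa h N : (0 < N)%N -> h \in unitmx -> exists2 d : 'rV[F]_n, regular_diag d &
  forall (R : fieldType) (mu : (G -> R) -> R), haar_quot mu ->
  mu (ind R (dcoset h N)) = mu (ind R (dcoset (diag_mx d) N)).
Proof.
move=> N0 uh; have [u [d [k [hu rd Gk eh]]]] := iwasawa uh.
have [uk _ _] := Gk; have ud := diag_unit rd; exists d => // R mu hmu.
rewrite -(haar_translate hmu (Cc_dcoset R N0 ud) (h := invmx k)) ?unitmx_inv //.
apply: haar_ext => //; first exact: Cc_dcoset.
move=> g ug; apply: ind_iff; split=> [[u' [k' [hu' ck' ->]]]|[u' [k' [hu' ck' e]]]].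
  exists (u' *m u), (k *m k' *m invmx k); split; first exact: unipotentM.
    by have := cong_conj_GLo (GLoV Gk) ck'; rewrite invmxK.
  by rewrite eh !mulmxA.
have uu := unipotent_unit hu.
exists (u' *m invmx u), (invmx k *m k' *m k); split; [|exact: cong_conj_GLo|].
  by apply: unipotentM => //; apply: unipotentV.
by rewrite -[g](mulmxKV uk) e eh !mulmxA mulmxKV // mulmxK.
Qed.

(** One finite sum, with weights that are powers of q, serves all coefficient
    fields: this is why integrals are compatible with reduction. *)
Lemma haar_formula N (M : int) : (0 < N)%N -> exists s : seq (G * int),
  (forall x, x \in s -> x.1 \in unitmx) /\
  forall (R : fieldType) (mu : (G -> R) -> R) phi, haar_quot mu -> q%:R != 0 :> R ->
    N_invariant phi -> of_level N phi -> supported M phi ->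
    mu phi = mu (ind R (dcoset 1%:M 1)) * \sum_(x <- s) q%:R ^ x.2 * phi x.1.
Proof.
move=> N0; have [H [uH hH]] := haar_decomposition M N0.
have /boolp.choice[z hz] (h : G) : exists z : int, h \in unitmx ->
    forall (R : fieldType) (mu : (G -> R) -> R), haar_quot mu -> q%:R != 0 :> R ->
    mu (ind R (dcoset h N)) = q%:R ^ z * mu (ind R (dcoset 1%:M 1)).
  case: (boolP (h \in unitmx)) => uh; last by exists 0.
  have [d rd hd] := dcoset_iwasawa N0 uh.
  have [z hz] := dcoset_volume N0 rd; exists z => _ R mu hmu q0.
  by rewrite (hd R mu hmu) -hz.
exists [seq (h, z h) | h <- H]; split=> [x /mapP[h /uH uh ->] //|R mu phi hmu q0 h1 h2 h3].
rewrite (hH R mu phi hmu h1 h2 h3) big_map mulr_sumr big_seq [RHS]big_seq.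
by apply: eq_bigr => h /uH uh /=; rewrite (hz h uh R mu hmu q0); ring.
Qed.

(** The number of translates of [N_n K_(N+1)] that tile [N_n K_N] is a positive
    power of q, so every volume would vanish together with q. *)
Lemma haar_q_neq0 (R : fieldType) (mu : (G -> R) -> R) : (0 < n)%N -> haar_quot mu -> q%:R != 0 :> R.
Proof.
move=> n0 hmu; apply/eqP => q0; case: (hmu) => _ _ _ [phi cphi]; apply.
have /Cc_quotP[N [M [N0 h1 h2 h3]]] := cphi.
have [H [uH hH]] := haar_decomposition M N0.
rewrite (hH R mu phi hmu h1 h2 h3) big_seq big1 // => h /uH uh.
have [d rd hd] := dcoset_iwasawa N0 uh.
have [r [r0 hr]] := @dcoset_level d N 1 N0 rd.
by rewrite (hd R mu hmu) hr // q0 expr0n gtn_eqF ?r0 // mul0r mulr0.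
Qed.

Lemma haar_unit_volume (R : fieldType) (mu : (G -> R) -> R) : haar_quot mu -> q%:R != 0 :> R ->
  mu (ind R (dcoset 1%:M 1)) != 0.
Proof.
move=> hmu q0; apply/eqP => e; case: (hmu) => _ _ _ [phi cphi]; apply.
have /Cc_quotP[N [M [N0 h1 h2 h3]]] := cphi.
have [s [_ hs]] := haar_formula M N0.
by rewrite (hs R mu phi hmu q0 h1 h2 h3) e mul0r.
Qed.

Lemma haar_unique (R : fieldType) (mu mu' : (G -> R) -> R) : haar_quot mu -> haar_quot mu' ->
  q%:R != 0 :> R -> exists2 c, c != 0 & forall phi, Cc_quot phi -> mu' phi = c * mu phi.
Proof.
move=> hmu hmu' q0; have v0 := haar_unit_volume hmu q0; have v0' := haar_unit_volume hmu' q0.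
exists (mu' (ind R (dcoset 1%:M 1)) / mu (ind R (dcoset 1%:M 1))).
  by rewrite mulf_neq0 ?invr_eq0.
move=> phi /Cc_quotP[N [M [N0 h1 h2 h3]]].
have [s [_ hs]] := haar_formula M N0.
by rewrite !(hs R _ phi) // mulrA divfK.
Qed.
End HaarFormula.

(** * Invariant integrals on matrix spaces *)

Section AdditiveHaar.
Variables (F : local_field) (a b : nat).
Notation V := 'M[F]_(a, b).
Notation q := (lf_q F).

Definition box (R : fieldType) (N : int) : V -> R :=
  fun x => ([forall i, forall j, in_pow N (x i j)])%:R.

Definition additive_haar (R : fieldType) (dx : (V -> R) -> R) :=
  (forall r Phi Psi, Cc_mx Phi -> Cc_mx Psi ->
     dx (fun x => r * Phi x + Psi x) = r * dx Phi + dx Psi) /\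
  (forall Phi y, Cc_mx Phi -> dx (fun x => Phi (x + y)) = dx Phi).

Lemma selfdual_additive (R : fieldType) (sq : R) theta (dx : (V -> R) -> R) :
  haar_selfdual sq theta dx -> additive_haar dx.
Proof. by case. Qed.

Definition mx_level (R : fieldType) (N : int) (Phi : V -> R) :=
  forall x y, mx_in_pow N y -> Phi (x + y) = Phi x.
Definition mx_support (R : fieldType) (M : int) (Phi : V -> R) :=
  forall x, Phi x <> 0 -> mx_in_pow M x.

Section Functions.
Variable R : fieldType.
Implicit Types Phi Psi : V -> R.

Lemma boxP N (x : V) : reflect (mx_in_pow N x) [forall i, forall j, in_pow N (x i j)].
Proof. by apply: (iffP forallP) => h i; [move=> j; apply: (forallP (h i)) | apply/forallP]. Qed.

Lemma box1 N (x : V) : mx_in_pow N x -> box R N x = 1.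
Proof. by rewrite /box => /boxP->. Qed.

Lemma box0 N (x : V) : ~ mx_in_pow N x -> box R N x = 0.
Proof. by rewrite /box => /boxP/negPf->. Qed.

Lemma Cc_mx_lin r Phi Psi : Cc_mx Phi -> Cc_mx Psi -> Cc_mx (fun x => r * Phi x + Psi x).
Proof.
move=> [[N h1] [M h2]] [[N' h1'] [M' h2']]; split.
  exists (Num.max N N') => x y hy; rewrite h1 ?h1' //; apply: mx_in_pow_le hy; rewrite le_max lexx ?orbT //.
exists (Num.min M M') => x ne.
have [e|ne1] := eqVneq (Phi x) 0.
  apply: (@mx_in_pow_le _ M'); first by rewrite ge_min lexx orbT.
  by apply: h2' => e'; apply: ne; rewrite e e' mulr0 addr0.
by apply: (@mx_in_pow_le _ M); [rewrite ge_min lexx | apply: h2; apply/eqP].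
Qed.

Lemma Cc_mx_0 : Cc_mx (fun _ : V => 0 : R).
Proof. by split; exists 0. Qed.

Lemma Cc_mx_sum (I : Type) (s : seq I) (c : I -> R) (Phi : I -> V -> R) :
  (forall i, Cc_mx (Phi i)) -> Cc_mx (fun x => \sum_(i <- s) c i * Phi i x).
Proof.
move=> h; elim: s => [|i s IH].
  have -> : (fun x : V => \sum_(i <- [::]) c i * Phi i x) = (fun=> 0).
    by apply/funext => x; rewrite big_nil.
  exact: Cc_mx_0.
have -> : (fun x : V => \sum_(j <- i :: s) c j * Phi j x) =
  (fun x => c i * Phi i x + \sum_(j <- s) c j * Phi j x) by apply/funext => x; rewrite big_cons.
exact: Cc_mx_lin.
Qed.

Lemma Cc_mx_translate Phi y : Cc_mx Phi -> Cc_mx (fun x => Phi (x + y)).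
Proof.
move=> [[N h1] [M h2]]; split; first by exists N => x z hz; rewrite addrAC (h1 (x + y) z).
have [B hB] := mx_in_pow_ex y; exists (Num.min M (- B%:Z)) => x /h2 h.
rewrite -[x](addrK y); apply: mx_in_powB.
  by apply: mx_in_pow_le h; rewrite ge_min lexx.
by apply: mx_in_pow_le hB; rewrite ge_min lexx orbT.
Qed.

Lemma Cc_box N : Cc_mx (box R N).
Proof.
split; last by exists N => x; rewrite /box; case: boxP.
exists N => x y hy; rewrite /box; congr (nat_of_bool _)%:R.
apply/boxP/boxP => h; last exact: mx_in_powD.
by rewrite -[x](addrK y); apply: mx_in_powB.
Qed.

Variables (dx : (V -> R) -> R) (hdx : additive_haar dx).

Lemma add_haar_0 : dx (fun=> 0) = 0.
Proof.
have e : dx (fun=> -1 * 0 + 0) = 0 by rewrite hdx.1 ?mulN1r ?addNr //; exact: Cc_mx_0.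
by rewrite mulr0 addr0 in e.
Qed.

Lemma add_haar_sum (I : Type) (s : seq I) (c : I -> R) (Phi : I -> V -> R) :
  (forall i, Cc_mx (Phi i)) ->
  dx (fun x => \sum_(i <- s) c i * Phi i x) = \sum_(i <- s) c i * dx (Phi i).
Proof.
move=> h; elim: s => [|i s IH].
  by rewrite big_nil -[RHS]add_haar_0; congr dx; apply/funext => x; rewrite big_nil.
have -> : (fun x : V => \sum_(j <- i :: s) c j * Phi j x) =
  (fun x => c i * Phi i x + \sum_(j <- s) c j * Phi j x) by apply/funext => x; rewrite big_cons.
by rewrite hdx.1 ?IH ?big_cons //; apply: Cc_mx_sum.
Qed.

Lemma box_tile N (r : nat) : dx (box R N) = q%:R ^+ (r * (a * b)) * dx (box R (N + r%:Z)).
Proof.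
have [I [L [cI iL _ injL exL]]] := @mx_reps F a b (fun _ _ => true) (fun _ _ => N) (fun _ _ => r).
have -> : box R N = (fun x => \sum_(t <- index_enum I) 1 * box R (N + r%:Z) (x - L t)).
  apply/funext => x; case: (EM (mx_in_pow N x)) => hx; last first.
    rewrite (box0 hx) big1 // => t _; rewrite box0 ?mulr0 // => h; apply: hx.
    rewrite -[x](subrK (L t)); apply: mx_in_powD => //.
    by apply: mx_in_pow_le h; lia.
  have [t ht] := exL _ hx.
  have ht' : mx_in_pow (N + r%:Z) (x - L t) by move=> i j; have := ht i j isT; rewrite !mxE.
  rewrite (box1 hx) (bigD1 t) //= (box1 ht') mulr1 big1 ?addr0 // => t' ne.
  rewrite box0 ?mulr0 // => h; case/eqP: ne; apply: injL => i j _.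
  have := mx_in_powB ht' h i j; rewrite !mxE.
  by have -> : x i j - L t i j - (x i j - L t' i j) = L t' i j - L t i j by ring.
rewrite add_haar_sum; last by move=> t; apply: Cc_mx_translate; apply: Cc_box.
have tr t : dx (fun x => box R (N + r%:Z) (x - L t)) = dx (box R (N + r%:Z)).
  by apply: hdx.2; apply: Cc_box.
under eq_bigr => t _ do rewrite mul1r tr.
rewrite sumr_const cI -[LHS]mulr_natl natrX; congr (_ ^+ _ * _).
under eq_bigr do rewrite big_const_ord iter_addn_0.
by rewrite big_const_ord iter_addn_0 -mulnA [(b * a)%N]mulnC.
Qed.

Lemma box_volume N : q%:R != 0 :> R -> dx (box R N) = q%:R ^ (- N * (a * b)%N%:Z) * dx (box R 0).
Proof.
move=> q0; case: N => k.
  rewrite (box_tile 0 k) mulrA (exprnP _ (k * (a * b))) -expfzDr // add0r.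
  have -> : - Posz k * (a * b)%N%:Z + (k * (a * b))%N%:Z = 0 by rewrite PoszM; ring.
  by rewrite expr0z mul1r.
rewrite NegzE (box_tile _ k.+1) addNr opprK; congr (_ * _).
Qed.
End Functions.

(** As for the group, one finite sum serves all coefficient fields.  Its nodes
    see every nonzero value of the integrand, which also bounds the
    denominators of a Schwartz function. *)
Lemma add_haar_formula (N M : int) : exists s : seq V,
  forall (R : fieldType) (Phi : V -> R), mx_level N Phi -> mx_support M Phi ->
  (forall y, Phi y <> 0 -> exists2 x, x \in s & Phi y = Phi x) /\
  forall dx : (V -> R) -> R, additive_haar dx ->
    dx Phi = dx (box R N) * \sum_(x <- s) Phi x.
Proof.
pose M' := Num.min M N; pose r := `|N - M'|%N.
have rE : M' + r%:Z = N by have : M' <= N by [rewrite ge_min lexx orbT]; rewrite /r; lia.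
have [I [L [cI iL _ injL exL]]] := @mx_reps F a b (fun _ _ => true) (fun _ _ => M') (fun _ _ => r).
exists [seq L t | t <- index_enum I] => R Phi h1 h2.
have near y : Phi y <> 0 -> exists2 t, mx_in_pow N (y - L t) & forall t', mx_in_pow N (y - L t') -> t' = t.
  move=> /h2 hy; have [|t ht] := exL y; first by apply: mx_in_pow_le hy; rewrite ge_min lexx.
  have ht' : mx_in_pow N (y - L t) by move=> i j; have := ht i j isT; rewrite !mxE rE.
  exists t => // t' h; apply: injL => i j _; rewrite rE.
  have := mx_in_powB ht' h i j; rewrite !mxE.
  by have -> : y i j - L t i j - (y i j - L t' i j) = L t' i j - L t i j by ring.
have eqP_ y t : mx_in_pow N (y - L t) -> Phi y = Phi (L t).
  by move=> h; rewrite -(h1 (L t) _ h) addrC subrK.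
split=> [y /near[t ht _]|dx hdx].
  by exists (L t); [apply: map_f; rewrite mem_index_enum | apply: eqP_].
have -> : Phi = (fun x => \sum_(t <- index_enum I) Phi (L t) * box R N (x - L t)).
  apply/funext => x.
  transitivity (\sum_t Phi x * box R N (x - L t)); last first.
    apply: eq_bigr => t _; case: (EM (mx_in_pow N (x - L t))) => h; last by rewrite (box0 _ h) !mulr0.
    by rewrite (eqP_ _ _ h).
  have [->|/eqP ne] := eqVneq (Phi x) 0; first by rewrite big1 // => t _; rewrite mul0r.
  have [t ht ut] := near x ne.
  rewrite (bigD1 t) //= (box1 _ ht) mulr1 big1 ?addr0 // => t' ne'.
  by rewrite box0 ?mulr0 // => h; case/eqP: ne'; apply: ut.
rewrite add_haar_sum //; last by move=> t; apply: Cc_mx_translate; apply: Cc_box.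
have tr t : dx (fun x => box R N (x - L t)) = dx (box R N).
  by apply: hdx.2; apply: Cc_box.
under eq_bigr => t _ do rewrite tr.
rewrite -mulr_suml mulrC; congr (_ * _); rewrite big_map; apply: eq_bigr => t _.
rewrite (bigD1 t) //= subrr box1 ?mulr1; last by apply: mx_in_pow0.
rewrite big1 ?addr0 // => t' ne; rewrite box0 ?mulr0 // => h.
case/eqP: ne; apply: injL => i j _; rewrite rE; have := h i j; rewrite !mxE -in_powN.
by rewrite opprB.
Qed.
End AdditiveHaar.

(** * The ring of l-adic integers *)

Lemma drop_poly_step (R : nzRingType) (p : {poly R}) j :
  drop_poly j p = (p`_j)%:P + drop_poly j.+1 p * 'X.
Proof.
apply/polyP => i; rewrite coefD coefC coefMX !coef_drop_poly.
by case: i => [|i] /=; rewrite ?addr0 ?add0r // addSn addnS.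
Qed.

Section LocalRing.
Variable F : local_field.

Definition lf_integer : {pred F} := fun x => in_pow 0 x.

Lemma lf_integer_subring : subring_closed lf_integer.
Proof.
split=> [|x y hx hy|x y hx hy]; rewrite /lf_integer ?unfold_in.
- exact: in_pow1.
- exact: in_powB.
- by have := in_powM hx hy.
Qed.
HB.instance Definition _ := GRing.isSubringClosed.Build F lf_integer lf_integer_subring.

(** The ring of integers [o] as a ring in its own right, over which [ld_int] is
    integrality in the sense of ring extensions. *)
Record lf_int_ring := LfIntRing { lf_int_val : F; lf_int_valP : lf_int_val \in lf_integer }.
HB.instance Definition _ := [isSub for lf_int_val].
HB.instance Definition _ := [Choice of lf_int_ring by <:].
HB.instance Definition _ := [SubChoice_isSubComNzRing of lf_int_ring by <:].
End LocalRing.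

Section IntegerRing.
Variables (l : nat) (D : ladic_data l).
Hypothesis prl : prime l.
Notation K := (ld_K D).
Notation B := (ld_base D).
Notation emb := (@ld_emb l D).
Notation int := (@ld_int l D).
Notation red := (@ld_red l D).
Implicit Types (x y : K).

Notation o_to_K := (emb \o (val : lf_int_ring B -> B)).

Lemma ld_int_integralOver x : int x <-> integralOver o_to_K x.
Proof.
rewrite ld_intP; split=> [[P [mP iP rP]]|[p mp rp]].
  pose p : {poly lf_int_ring B} := \poly_(i < size P) insubd 0 P`_i.
  have pE : map_poly val p = P.
    apply/polyP => i; rewrite coef_map coef_poly; case: ltnP => h /=.
      by rewrite insubdK //; exact: iP.
    by rewrite nth_default.
  exists p; last by rewrite map_poly_comp pE.
  have sz : size p = size P by rewrite -pE size_map_inj_poly //; exact: val_inj.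
  apply/eqP/val_inj; rewrite lead_coefE sz -(coef_map val) pE -lead_coefE.
  by rewrite (monicP mP).
exists (map_poly val p); split.
- exact: monic_map.
- by move=> i; rewrite coef_map; exact: (valP (p`_i)).
- by rewrite -map_poly_comp.
Qed.

Lemma int1 : int 1. Proof. exact/ld_int_integralOver/integral1. Qed.
Lemma int0 : int 0. Proof. exact/ld_int_integralOver/integral0. Qed.
Lemma intN x : int x -> int (- x).
Proof. by rewrite !ld_int_integralOver; apply: integral_opp. Qed.
Lemma intD x y : int x -> int y -> int (x + y).
Proof. by rewrite !ld_int_integralOver; apply: integral_add. Qed.
Lemma intB x y : int x -> int y -> int (x - y).
Proof. by rewrite !ld_int_integralOver; apply: integral_sub. Qed.
Lemma intM x y : int x -> int y -> int (x * y).
Proof. by rewrite !ld_int_integralOver; apply: integral_mul. Qed.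
Lemma intX x n : int x -> int (x ^+ n).
Proof. by move=> h; elim: n => [|n IH]; rewrite ?expr0 ?exprS; [exact: int1 | exact: intM]. Qed.
Lemma int_nat n : int n%:R. Proof. exact/ld_int_integralOver/integral_nat. Qed.
Lemma int_sum (I : Type) (s : seq I) (P : pred I) (f : I -> K) :
  (forall i, P i -> int (f i)) -> int (\sum_(i <- s | P i) f i).
Proof. by move=> h; elim/big_ind: _ => //; [exact: int0 | exact: intD]. Qed.

Lemma int_root x (p : {poly K}) : p \is monic -> root p x -> (forall i, int p`_i) -> int x.
Proof.
move=> mp rp h; apply/ld_int_integralOver; apply: integral_root_monic rp _ => //.
by apply/integral_poly => i; apply/ld_int_integralOver.
Qed.

Lemma red0 : red 0 = 0.
Proof. by apply/eqP; rewrite -(inj_eq (addrI (red 0))) -ld_redD ?addr0 //; exact: int0. Qed.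
Lemma redN x : int x -> red (- x) = - red x.
Proof.
move=> ix; apply/eqP; rewrite -addr_eq0 -ld_redD ?addNr ?red0 //; exact: intN.
Qed.
Lemma redB x y : int x -> int y -> red (x - y) = red x - red y.
Proof. by move=> ix iy; rewrite ld_redD ?redN //; exact: intN. Qed.
Lemma red_sum (I : Type) (s : seq I) (P : pred I) (f : I -> K) : (forall i, P i -> int (f i)) ->
  red (\sum_(i <- s | P i) f i) = \sum_(i <- s | P i) red (f i).
Proof.
move=> h; elim: s => [|i s IH]; first by rewrite !big_nil red0.
rewrite !big_cons; case: ifP => Pi //; rewrite ld_redD ?IH //; first exact: h.
exact: int_sum.
Qed.
Lemma redX x n : int x -> red (x ^+ n) = red x ^+ n.
Proof.
move=> ix; elim: n => [|n IH]; first by rewrite !expr0 ld_red1.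
by rewrite !exprS ld_redM ?IH //; exact: intX.
Qed.
Lemma red_nat n : red n%:R = n%:R.
Proof. by elim: n => [|n IH]; rewrite ?red0 // -!natr1 ld_redD ?IH ?ld_red1 //; [exact: int_nat | exact: int1]. Qed.

(** The kernel of the reduction consists of the non-units. *)
Lemma red_unit x : int x -> red x != 0 -> int x^-1.
Proof.
move=> ix /eqP h; apply: contrapT => h'; apply: h; apply/(ld_red_ker ix) => -[].
by [].
Qed.

Lemma unit_red x : int x -> int x^-1 -> x != 0 -> red x != 0.
Proof. by move=> ix ix' x0; apply/eqP => /(ld_red_ker ix); apply; split=> //; apply/eqP. Qed.

Lemma redV x : int x -> int x^-1 -> red x^-1 = (red x)^-1.
Proof.
move=> ix ix'; have [->|x0] := eqVneq x 0; first by rewrite invr0 red0 invr0.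
have h := unit_red ix ix' x0; apply: (mulfI h).
by rewrite -ld_redM // !divff // ld_red1.
Qed.

Lemma redXz x (n : ssrint.int) : int x -> int x^-1 -> red (x ^ n) = red x ^ n.
Proof.
move=> ix ix'; case: n => n; first by rewrite -!exprnP redX.
by rewrite NegzE -!exprnN -exprVn redX // redV // exprVn.
Qed.

Lemma intXz x (n : ssrint.int) : int x -> int x^-1 -> int (x ^ n).
Proof.
move=> ix ix'; case: n => n; first by rewrite -exprnP; exact: intX.
by rewrite NegzE -exprnN -exprVn; exact: intX.
Qed.

(** [Z_l] is integrally closed. *)
Lemma int_emb (b : B) : int (emb b) <-> in_pow 0 b.
Proof.
split=> [|h]; last first.
  apply/ld_int_integralOver; have -> : emb b = o_to_K (LfIntRing h) by [].
  exact: integral_id.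
move=> /ld_intP[P [mP iP]]; rewrite fmorph_root => /rootP rP.
have [->|b0] := eqVneq b 0; first exact: in_pow0.
rewrite in_powE // leNgt; apply/negP => vb.
have nP : size P = (size P).-1.+1 by rewrite prednK // size_poly_gt0 monic_neq0.
move: rP; rewrite horner_coef nP big_ord_recr /=.
have -> : P`_(size P).-1 = 1 by apply/eqP; rewrite -lead_coefE -monicE.
rewrite mul1r => /eqP; rewrite addr_eq0 => /eqP e.
have : in_pow (lf_val b * (size P).-1%:Z + 1) (- b ^+ (size P).-1).
  rewrite -e; apply: in_pow_sum => i _.
  have [|bi] := eqVneq (b ^+ i) 0; first by move=> ->; rewrite mulr0; exact: in_pow0.
  have h2 : in_pow (lf_val b * i%:Z) (b ^+ i) by rewrite in_powE // lf_valX.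
  apply: in_pow_le (in_powM (iP i) h2).
  have aux (w : ssrint.int) (x y : nat) : w < 0 -> (x < y)%N -> w * y%:Z + 1 <= 0 + w * x%:Z by nia.
  exact: aux.
by rewrite in_powN in_powE ?expf_neq0 // lf_valX //; lia.
Qed.

Lemma red_l : red l%:R = 0.
Proof.
apply/(ld_red_ker (int_nat l)) => -[_].
rewrite -(rmorph_nat emb) -fmorphV => /int_emb; rewrite in_powE ?invr_eq0 ?ld_base_l //.
by rewrite lf_valV ?ld_base_l // ld_base_unif.
Qed.

Lemma red_emb (b : B) : in_pow 0 b -> red (emb b) = 0 <-> in_pow 1 b.
Proof.
move=> ib; have ie : int (emb b) by apply/int_emb.
have l0 := ld_base_l D; have vl := ld_base_unif D.
split=> h; last first.
  have e : emb b = l%:R * emb (b / l%:R) by rewrite -(rmorph_nat emb) -rmorphM mulrCA divff // mulr1.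
  rewrite e ld_redM ?red_l ?mul0r //; first exact: int_nat.
  apply/int_emb; have -> : 0 = 1 - 1 :> ssrint.int by lia.
  by apply: in_powM => //; rewrite in_powE ?invr_eq0 // lf_valV // vl.
have [->|b0] := eqVneq b 0; first exact: in_pow0.
rewrite in_powE // leNgt; apply/negP => hb.
have : ~ (emb b <> 0 /\ int (emb b)^-1) by apply/(ld_red_ker ie).
apply; split; first by apply/eqP; rewrite fmorph_eq0.
rewrite -fmorphV; apply/int_emb; rewrite in_powE ?invr_eq0 // lf_valV //.
by move: ib; rewrite in_powE //; lia.
Qed.

Lemma pchar_k : l \in [pchar ld_k D].
Proof. by rewrite inE prl -red_nat red_l eqxx. Qed.

Lemma nat_k_neq0 m : coprime l m -> m%:R != 0 :> ld_k D.
Proof. by move=> h; rewrite -(dvdn_pcharf pchar_k) -prime_coprime. Qed.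

(** Kaplansky's argument.  The Horner tails of [p] at [x] and their products
    with [x] are integral, because the ring is integrally closed; the unit
    coefficient is the difference of two of them, one of which is therefore a
    unit. *)
Lemma int_or_inv_of_root x (p : {poly K}) k : (forall i, int p`_i) -> root p x ->
  red p`_k != 0 -> int x \/ int x^-1.
Proof.
move=> ip rp uk.
pose b j := (drop_poly j p).[x].
have bS j : b j = p`_j + b j.+1 * x.
  by rewrite /b [drop_poly j p]drop_poly_step hornerD hornerC hornerMX.
have b_root j : b j * x ^+ j + \sum_(i < j) p`_i * x ^+ i = 0.
  elim: j => [|j IH].
    by rewrite big_ord0 addr0 expr0 mulr1 /b drop_poly0l; apply/rootP.
  by rewrite big_ord_recr /= -[RHS]IH (bS j) exprS; ring.
have step j : int (b j.+1 * x) -> int (b j) /\ int (b j * x).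
  move=> h; have ibj : int (b j) by rewrite bS; apply: intD.
  split=> //; case: j ibj h => [|j] ibj h; first by have := b_root 0; rewrite big_ord0 expr0 mulr1 addr0 => ->; rewrite mul0r; exact: int0.
  pose r := \poly_(i < j.+1) (p`_i * b j.+1 ^+ (j - i)); pose q := 'X^(j.+1) + r.
  have sq : (size r < size ('X^(j.+1) : {poly K}))%N.
    by rewrite size_polyXn ltnS size_poly.
  apply: (@int_root _ q).
  - by rewrite monicE lead_coefDl // lead_coefXn.
  - rewrite /root hornerD hornerXn horner_poly; apply/eqP.
    transitivity (b j.+1 ^+ j * (b j.+1 * x ^+ j.+1 + \sum_(i < j.+1) p`_i * x ^+ i)); last by rewrite b_root mulr0.
    rewrite mulrDr mulr_sumr exprMn; congr (_ + _).
      by rewrite exprSr; ring.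
    apply: eq_bigr => i _; rewrite exprMn.
    have -> : b j.+1 ^+ j = b j.+1 ^+ (j - i) * b j.+1 ^+ i by rewrite -exprD subnK // -ltnS.
    ring.
  - move=> i; rewrite coefD coefXn coef_poly; apply: intD; first by case: eqP => _; [exact: int1 | exact: int0].
    by case: ifP => _; [apply: intM => //; exact: intX | exact: int0].
have all m j : (size p <= j + m)%N -> int (b j) /\ int (b j * x).
  elim: m j => [|m IH] j h.
    have -> : b j = 0 by rewrite /b drop_poly_eq0 ?horner0 // -[j]addn0.
    by rewrite mul0r; split; exact: int0.
  by apply: step; apply: (IH j.+1 _).2; rewrite addSn -addnS.
have ib j := (all (size p) j (leq_addl _ _)).1; have ibx j := (all (size p) j (leq_addl _ _)).2.
have e : p`_k = b k - b k.+1 * x by rewrite bS addrK.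
have [h|h] := eqVneq (red (b k)) 0.
  have u : red (b k.+1 * x) != 0 by move: uk; rewrite e redB // h sub0r oppr_eq0.
  right; have := intM (ib k.+1) (red_unit (ibx k.+1) u).
  have n0 : b k.+1 * x != 0 by apply/eqP => z; move: u; rewrite z red0 eqxx.
  have /andP[n1 n2] : (b k.+1 != 0) && (x != 0) by move: n0; rewrite mulf_eq0 negb_or.
  by rewrite invfM mulrA divff // mul1r.
left; have := intM (ibx k) (red_unit (ib k) h).
have n0 : b k != 0 by apply/eqP => z; move: h; rewrite z red0 eqxx.
by rewrite mulrAC divff // mul1r.
Qed.

(** Divide a polynomial over [Q_l] that kills [x] by a coefficient of minimal
    valuation. *)
Lemma primitive_root x : exists p : {poly B}, [/\ forall i, in_pow 0 p`_i, exists k, ~~ in_pow 1 p`_k & root (map_poly emb p) x].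
Proof.
have [p p0 rp] := ld_alg x.
have i0 : ((size p).-1 < size p)%N by rewrite prednK ?size_poly_gt0.
pose P (i : 'I_(size p)) := p`_i != 0.
have Pi0 : P (Ordinal i0) by rewrite /P /= -lead_coefE lead_coef_eq0.
case: (@Order.TotalTheory.arg_minP _ _ _ (Ordinal i0) P (fun i => lf_val p`_i) Pi0) => j Pj hj.
exists ((p`_j)^-1 *: p); split.
- move=> i; rewrite coefZ; have [->|pi] := eqVneq p`_i 0; first by rewrite mulr0 in_pow0.
  have lti : (i < size p)%N by rewrite ltnNge; apply/negP => h; move: pi; rewrite nth_default ?eqxx.
  rewrite in_powE ?mulf_neq0 ?invr_eq0 // lf_valM ?invr_eq0 // lf_valV //.
  by have := hj (Ordinal lti) pi => /=; lia.
- by exists j; rewrite coefZ mulVf // in_powE ?oner_neq0 // lf_val1.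
- by rewrite map_polyZ rootZ // fmorph_eq0 invr_eq0.
Qed.

(** The integers form a valuation ring: the previous argument applies to a
    primitive polynomial that kills [x]. *)
Lemma int_or_inv x : int x \/ int x^-1.
Proof.
have [p [ip [k nk] rp]] := primitive_root x.
apply: (@int_or_inv_of_root x (map_poly emb p) k) => //.
  by move=> i; rewrite coef_map; apply/int_emb.
by rewrite coef_map; apply/eqP => /(red_emb (ip k)); apply/negP.
Qed.

Lemma common_denominator (s : seq K) : exists2 b, b != 0 & forall x, x \in s -> int (b * x).
Proof.
elim: s => [|x s [b b0 hb]]; first by exists 1; rewrite ?oner_neq0.
have [c c0 [ic icx]] : exists2 c, c != 0 & int c /\ int (c * x).
  have [ix|ix] := int_or_inv x; first by exists 1; rewrite ?oner_neq0 // mul1r; split=> //; exact: int1.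
  have [->|x0] := eqVneq x 0; first by exists 1; rewrite ?oner_neq0 // mulr0; split; [exact: int1 | exact: int0].
  by exists x^-1; rewrite ?invr_eq0 // mulVf //; split=> //; exact: int1.
have [ib|ib] := int_or_inv b.
  exists (b * c); first by rewrite mulf_neq0.
  move=> y; rewrite inE => /orP[/eqP->|/hb h]; first by rewrite -mulrA; apply: intM.
  by rewrite mulrAC mulrC; apply: intM.
exists c => // y; rewrite inE => /orP[/eqP-> //|/hb h].
by have := intM ic (intM ib h); rewrite mulKf.
Qed.

(** In a primitive equation for [y], let [j] be the first index whose
    coefficient is a unit.  The terms of index at least [j] add up to a unit
    times [y^j], the others are divisible by [l].  This and the next lemma say
    that the valuation has rank one. *)
Lemma l_divides_power y : int y -> red y = 0 -> exists2 j, (0 < j)%N & int (y ^+ j / l%:R).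
Proof.
move=> iy ry; have [p [ip exk rp]] := primitive_root y.
pose j := ex_minn exk.
have nj : ~~ in_pow 1 p`_j by rewrite /j; case: ex_minnP.
have hj i : (i < j)%N -> in_pow 1 p`_i.
  by rewrite /j; case: ex_minnP => m _ h lt; apply/negPn/negP => /h; rewrite leqNgt lt.
have l0 := ld_base_l D.
have il (b : B) : in_pow 1 b -> int (emb b / l%:R).
  move=> hb; rewrite -(rmorph_nat emb) -fmorphV -rmorphM; apply/int_emb.
  have -> : 0 = 1 - 1 :> ssrint.int by lia.
  by apply: in_powM => //; rewrite in_powE ?invr_eq0 // lf_valV // ld_base_unif.
pose P := map_poly emb p; pose U := (drop_poly j P).[y].
have eP : U * y ^+ j = - (take_poly j P).[y].
  have := rp; rewrite /root -/P -[X in X.[y]](poly_take_drop j P) hornerD hornerM hornerXn.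
  by rewrite addrC addr_eq0 => /eqP.
have iP i : int P`_i by rewrite coef_map; apply/int_emb.
have horner_int (q : {poly K}) : (forall i, int q`_i) -> int q.[y].
  by move=> h; rewrite horner_coef; apply: int_sum => i _; apply: intM => //; exact: intX.
have iU : int U by apply: horner_int => i; rewrite coef_drop_poly.
have rU : red U != 0.
  have -> : U = P`_j + y * (drop_poly j.+1 P).[y].
    by rewrite /U [drop_poly j P]drop_poly_step hornerD hornerC hornerMX mulrC.
  have i2 : int (drop_poly j.+1 P).[y] by apply: horner_int => i; rewrite coef_drop_poly.
  rewrite ld_redD ?ld_redM ?ry ?mul0r ?addr0 //; last exact: intM.
  by rewrite coef_map; apply/eqP => /(red_emb (ip j)); apply/negP.
have U0 : U != 0 by apply/eqP => z; move: rU; rewrite z red0 eqxx.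
have iyl : int (y ^+ j / l%:R).
  have -> : y ^+ j = U^-1 * - (take_poly j P).[y] by rewrite -eP mulKf.
  rewrite -mulrA mulNr.
  apply: intM; first exact: red_unit.
  apply: intN; rewrite horner_coef mulr_suml; apply: int_sum => i _.
  rewrite mulrAC; apply: intM; last exact: intX.
  rewrite coef_take_poly; case: ifP => h; last by rewrite mul0r; exact: int0.
  by rewrite coef_map; apply: il; apply: hj.
exists j => //; rewrite lt0n; apply/eqP => j0.
move: iyl; rewrite j0 expr0 mul1r => h.
have := red_l; apply/eqP; apply: unit_red => //; first exact: int_nat.
by rewrite -(rmorph_nat emb) fmorph_eq0.
Qed.

(** Divide by [c] an equation for [c] with nonzero constant term. *)
Lemma divides_l_power c : c != 0 -> int c -> exists v, int (l%:R ^+ v / c).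
Proof.
move=> c0 ic; have l0 := ld_base_l D.
have [p p0 rp] := ld_alg c.
have [j [r [pE r0]]] : exists j (r : {poly B}), p = r * 'X^j /\ r`_0 != 0.
  have [m [r nr ->]] := multiplicity_XsubC p 0.
  exists m, r; rewrite subr0; split=> //.
  by move: nr; rewrite p0 /= /root horner_coef0.
have rr : root (map_poly emb r) c.
  move: rp; rewrite pE rmorphM /= map_polyXn rootM => /orP[//|].
  by rewrite /root hornerXn expf_eq0 (negPf c0) andbF.
have [N hN] : exists N : nat, forall i, in_pow (- N%:Z) r`_i.
  have h i : exists N : nat, in_pow (- N%:Z) r`_i by apply: in_pow_ex.
  exists (\sum_(i < size r) xchoose (h i))%N => i.
  case: (ltnP i (size r)) => hi; last by rewrite nth_default // in_pow0.
  apply: in_pow_le (xchooseP (h i)); rewrite lerN2 lez_nat.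
  by rewrite (bigD1 (Ordinal hi)) //= leq_addr.
pose z : ssrint.int := N%:Z + lf_val r`_0; pose v := `|z|%N.
exists v.
have ilN i : int (l%:R ^+ N * emb r`_i).
  rewrite -(rmorph_nat emb) -rmorphXn -rmorphM; apply/int_emb.
  have -> : 0 = N%:Z - N%:Z by lia.
  by apply: in_powM => //; rewrite in_powE ?expf_neq0 // lf_valX // ld_base_unif mul1r.
have e : l%:R ^+ N * emb r`_0 / c = - \sum_(i < (size r).-1) l%:R ^+ N * emb r`_i.+1 * c ^+ i.
  have := rr; rewrite /root horner_coef size_map_poly.
  have sr : size r = (size r).-1.+1.
    by rewrite prednK // size_poly_gt0; apply/eqP => z0; move: r0; rewrite z0 coef0 eqxx.
  rewrite sr big_ord_recl /= coef_map expr0 mulr1 addr_eq0 => /eqP ->.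
  rewrite mulrN mulNr mulr_sumr mulr_suml; congr (- _); apply: eq_bigr => i _.
  by rewrite coef_map /= exprSr; field.
have i1 : int (l%:R ^+ N * emb r`_0 / c).
  rewrite e; apply: intN; apply: int_sum => i _; apply: intM => //; exact: intX.
have vr : - N%:Z <= lf_val r`_0 by rewrite -in_powE.
have -> : l%:R ^+ v / c = (l%:R ^+ v / (l%:R ^+ N * emb r`_0)) * (l%:R ^+ N * emb r`_0 / c).
  by rewrite mulrA divfK // -(rmorph_nat emb) -rmorphXn -rmorphM fmorph_eq0 mulf_neq0 // expf_neq0.
apply: intM => //; rewrite -(rmorph_nat emb) -!(rmorphXn emb) -rmorphM -fmorphV -rmorphM; apply/int_emb.
have n1 : (l%:R : B) ^+ v != 0 by rewrite expf_neq0.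
have n2 : (l%:R : B) ^+ N * r`_0 != 0 by rewrite mulf_neq0 ?expf_neq0.
rewrite in_powE ?mulf_neq0 ?invr_eq0 // lf_valM ?invr_eq0 // lf_valV // lf_valM ?expf_neq0 //.
by rewrite !lf_valX // ld_base_unif /v /z; lia.
Qed.

(** Complete integral closedness.  If [x] were not integral, [l] would divide a
    power of [x^-1], so that arbitrarily high powers of [l] would divide [c],
    whereas [c] divides some power of [l]. *)
Lemma almost_int c x : c != 0 -> (forall k, int (c * x ^+ k)) -> int x.
Proof.
move=> c0 h; apply: contrapT => nx.
have ic : int c by have := h 0%N; rewrite expr0 mulr1.
have iy : int x^-1 by have [] := int_or_inv x.
have x0 : x != 0 by apply/eqP => z; apply: nx; rewrite z; exact: int0.
have ry : red x^-1 = 0.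
  apply/eqP/negPn/negP => u; apply: nx; rewrite -[x]invrK; exact: red_unit.
have [j j0 hj] := l_divides_power iy ry.
have [v hv] := divides_l_power c0 ic.
have l0 : (l%:R : K) != 0 by rewrite -(rmorph_nat emb) fmorph_eq0 ld_base_l.
have : int (l%:R^-1).
  have := intM (intM (h (j * v.+1)%N) (intX v.+1 hj)) hv.
  have -> // : c * x ^+ (j * v.+1) * (x^-1 ^+ j / l%:R) ^+ v.+1 * (l%:R ^+ v / c) = l%:R^-1.
  rewrite exprMn -exprM !exprVn.
  by rewrite !exprS; field; rewrite c0 l0 expf_neq0 // !expf_neq0.
move=> h'; have := red_l; apply/eqP; apply: unit_red => //; exact: int_nat.
Qed.
End IntegerRing.

(** * Reduction of characters and measures *)

Section Characters.
Variables (F : local_field) (R : fieldType) (theta : F -> R).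
Hypothesis sth : smooth_char theta.

Lemma charD x y : theta (x + y) = theta x * theta y.
Proof. by case: sth. Qed.

Lemma char0 : theta 0 = 1.
Proof. by case: sth. Qed.

Lemma char_neq0 x : theta x != 0.
Proof.
apply/eqP => h; have := charD x (- x); rewrite subrr char0 h mul0r.
by apply/eqP; rewrite oner_eq0.
Qed.

Lemma charN x : theta (- x) = (theta x)^-1.
Proof. by apply: (mulfI (char_neq0 x)); rewrite -charD subrr char0 divff // char_neq0. Qed.

Lemma charX x n : theta (x *+ n) = theta x ^+ n.
Proof. by elim: n => [|n IH]; rewrite ?mulr0n ?char0 // mulrS charD IH exprS. Qed.

Lemma smooth_char_inv : smooth_char (char_inv theta).
Proof.
rewrite /char_inv; split; first by rewrite char0 invr1.
  by move=> x y; rewrite charD invfM.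
by case: sth => _ _ [N h]; exists N => x /h ->; rewrite invr1.
Qed.

Lemma char_invK : char_inv (char_inv theta) = theta.
Proof. by apply/funext => x; rewrite /char_inv invrK. Qed.

Lemma nontrivial_char_inv : nontrivial_char theta -> nontrivial_char (char_inv theta).
Proof.
move=> [x hx]; exists x => h; apply: hx.
by apply: (can_inj invrK); rewrite invr1.
Qed.

(** The level is bounded below by the valuation of a point where [theta] is not
    trivial. *)
Lemma conductor_exists : nontrivial_char theta -> exists c, conductor theta c.
Proof.
move=> [x0 hx0]; case: sth => _ _ [N0 h0].
have x00 : x0 != 0 by apply/eqP => e; apply: hx0; rewrite e char0.
pose lo := lf_val x0; pose P (k : nat) := `[< forall x, in_pow (lo + k%:Z) x -> theta x = 1 >].
have exP : exists k, P k.
  pose z : int := N0 - lo; exists `|z|%N; apply/asboolP => x hx; apply: h0; apply: in_pow_le hx.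
  by rewrite /z; lia.
have [m /asboolP Pm mm] := ex_minnP exP.
exists (lo + m%:Z); split=> //.
apply: contrapT => h.
have h' x : in_pow (lo + m%:Z - 1) x -> theta x = 1.
  by move=> hx; apply: contrapT => ne; apply: h; exists x.
case: m Pm mm h h' => [|m] Pm mm h h'.
  by apply: hx0; apply: Pm; rewrite in_powE // /lo addr0.
have : (m < m)%N; last by rewrite ltnn.
apply: mm; apply/asboolP => x hx; apply: h'; apply: in_pow_le hx; lia.
Qed.
End Characters.

Section Reduction.
Variables (p l : nat) (F : local_field) (D : ladic_data l).
Hypotheses (prl : prime l) (resp : res_char F p) (lp : l <> p).
Notation int := (@ld_int l D).
Notation red := (@ld_red l D).

Lemma p_k_neq0 : p%:R != 0 :> ld_k D.
Proof.
have [prp _] := resp; apply: nat_k_neq0 => //.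
by rewrite prime_coprime // dvdn_prime2 //; apply/eqP.
Qed.

Section Char.
Variable theta : F -> ld_K D.
Hypothesis sth : smooth_char theta.

(** [p^r x] tends to 0, and [theta] is trivial near 0. *)
Lemma char_p_torsion x : exists r, theta x ^+ (p ^ r) = 1.
Proof.
have [prp hp] := resp; case: (sth) => _ _ [N hN].
have [B hB] := in_pow_ex x; pose z : ssrint.int := N + B%:Z; exists `|z|%N.
rewrite -charX // hN // -mulr_natr natrX.
have h k : in_pow k%:Z ((p%:R : F) ^+ k).
  elim: k => [|k IH]; first by rewrite expr0.
  by rewrite exprS; apply: in_pow_le (in_powM hp IH); lia.
by apply: in_pow_le (in_powM hB (h _)); rewrite /z; lia.
Qed.

Lemma int_char x : int (theta x).
Proof.
have [prp _] := resp; have [r hr] := char_p_torsion x.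
have n0 : (0 < p ^ r)%N by rewrite expn_gt0 prime_gt0.
apply: (@int_root _ _ _ ('X^(p ^ r) - 1)).
- by rewrite -(@polyC1 (ld_K D)); apply: monicXnsubC.
- by rewrite /root hornerD hornerN hornerXn hornerC hr subrr.
move=> i; rewrite coefB coefXn coefC; apply: intB => //.
  by case: eqP => _; [exact: int1 | exact: int0].
by case: eqP => _; [exact: int1 | exact: int0].
Qed.

Lemma int_charV x : int (theta x)^-1.
Proof. by rewrite -charN //; exact: int_char. Qed.

(** Roots of unity of p-power order stay distinct modulo [l], as [p] is a unit. *)
Lemma red_char_eq1 x : red (theta x) = 1 -> theta x = 1.
Proof.
have [prp _] := resp; have [r hr] := char_p_torsion x; have := int_char x.
elim: r (theta x) hr => [|r IH] z; first by rewrite expn0 expr1.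
move=> hz iz rz; apply: IH => //.
set y := z ^+ (p ^ r); have yp : y ^+ p = 1 by rewrite /y -exprM -expnSr.
have ry : red y = 1 by rewrite /y redX // rz expr1n.
have iy : int y by apply: intX.
apply/eqP/negPn/negP => y1.
have s0 : \sum_(i < p) y ^+ i = 0.
  by apply: (mulfI (x := y - 1)); rewrite ?subr_eq0 // -subrX1 yp subrr mulr0.
have := congr1 red s0; rewrite red0 // red_sum //; last by move=> i _; exact: intX.
under eq_bigr do rewrite redX // ry expr1n.
by rewrite sumr_const card_ord; apply/eqP/p_k_neq0.
Qed.

Lemma smooth_char_red : smooth_char (red \o theta).
Proof.
split=> /=; first by rewrite char0 // ld_red1.
  by move=> x y; rewrite charD // ld_redM //; exact: int_char.
by case: sth => _ _ [N h]; exists N => x /h ->; rewrite ld_red1.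
Qed.

Lemma char_inv_red : char_inv (red \o theta) = red \o char_inv theta.
Proof. by apply/funext => x /=; rewrite /char_inv redV //; [exact: int_char | exact: int_charV]. Qed.

Lemma conductor_red c : conductor theta c -> conductor (red \o theta) c.
Proof.
move=> [h1 [x hx h2]]; split=> [y /h1 /= ->|]; first exact: ld_red1.
by exists x => // /red_char_eq1.
Qed.
End Char.

Notation q := (lf_q F).

Lemma int_qz (z : ssrint.int) : q%:R != 0 :> ld_k D -> int (q%:R ^ z).
Proof.
move=> q0; apply: intXz => //; first exact: int_nat.
by apply: red_unit; [exact: int_nat | rewrite red_nat].
Qed.

Lemma red_qz (z : ssrint.int) : q%:R != 0 :> ld_k D -> red (q%:R ^ z) = q%:R ^ z.
Proof.
move=> q0; rewrite redXz ?red_nat //; first exact: int_nat.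
by apply: red_unit; [exact: int_nat | rewrite red_nat].
Qed.

(** By [haar_formula] both integrals are the same finite sum up to the volume
    of one double coset, which can be adjusted by a constant. *)
Lemma haar_reduction n (muK : ('M[F]_n -> ld_K D) -> ld_K D) (muk : ('M[F]_n -> ld_k D) -> ld_k D) :
  q%:R != 0 :> ld_k D -> q%:R != 0 :> ld_K D -> haar_quot muK -> haar_quot muk ->
  exists2 c, c != 0 & forall phi, Cc_quot phi -> (forall g, g \in unitmx -> int (phi g)) ->
    int (c * muK phi) /\ red (c * muK phi) = muk (red \o phi).
Proof.
move=> qk qK hK hk; have vK := haar_unit_volume hK qK; have vk := haar_unit_volume hk qk.
have [a ia ra] := ld_red_surj (muk (ind (ld_k D) (dcoset 1%:M 1))).
have a0 : a != 0 by apply/eqP => e; move: vk; rewrite -ra e red0 ?eqxx.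
exists (a / muK (ind (ld_K D) (dcoset 1%:M 1))); first by rewrite mulf_neq0 ?invr_eq0.
move=> phi /Cc_quotP[N [M [N0 h1 h2 h3]]] iphi.
have [s [us hs]] := haar_formula F n M N0.
rewrite (hs _ _ _ hK qK h1 h2 h3) mulrA divfK // big_seq.
have it x : x \in s -> int (q%:R ^ x.2 * phi x.1) by move=> /us ux; apply: intM => //; [exact: int_qz | exact: iphi].
split; first by apply: intM => //; exact: int_sum.
rewrite ld_redM ?red_sum //; last exact: int_sum.
rewrite (hs _ _ (red \o phi) hk qk).
- rewrite ra [in RHS]big_seq; congr (_ * _); apply: eq_bigr => x /us ux /=.
  by rewrite ld_redM ?red_qz //; [exact: int_qz | exact: iphi].
- by move=> u g hu ug /=; rewrite h1.
- by move=> g k ug ck /=; rewrite h2.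
- by move=> g ug /= ne; apply: h3 => // e; apply: ne; rewrite e red0.
Qed.

(** q is a unit of the integers, being invertible in the residue field. *)
Lemma int_sqrt_q (sq : ld_K D) : sq ^+ 2 = q%:R -> q%:R != 0 :> ld_k D -> int sq /\ int sq^-1.
Proof.
move=> sqE qk.
have isq : int sq.
  apply: (@int_root _ _ _ ('X^2 - q%:R%:P)).
  - exact: monicXnsubC.
  - by rewrite /root hornerD hornerN hornerXn hornerC sqE subrr.
  move=> i; rewrite coefB coefXn coefC; apply: intB => //; first by case: eqP => _; [exact: int1 | exact: int0].
  by case: eqP => _; [exact: int_nat | exact: int0].
split=> //; apply: red_unit => //.
by apply/eqP => e; move: qk; rewrite -(red_nat D) -sqE redX // e expr0n eqxx.
Qed.

(** No constant is left free here: the volume of [Mat(o)] is the same power of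
    the chosen square root of q for both measures. *)
Lemma add_haar_reduction a b theta (sq : ld_K D) (dK : ('M[F]_(a, b) -> ld_K D) -> ld_K D)
    (dk : ('M[F]_(a, b) -> ld_k D) -> ld_k D) :
  smooth_char theta -> nontrivial_char theta -> sq ^+ 2 = q%:R ->
  q%:R != 0 :> ld_k D -> haar_selfdual sq theta dK -> haar_selfdual (red sq) (red \o theta) dk ->
  forall Phi, Cc_mx Phi -> (forall x, int (Phi x)) -> int (dK Phi) /\ red (dK Phi) = dk (red \o Phi).
Proof.
move=> sth nth sqE qk hK hk Phi [[N h1] [M h2]] iPhi.
have qK : q%:R != 0 :> ld_K D.
  by apply/eqP => e; move: qk; rewrite -(red_nat D) e red0 ?eqxx.
have [c cc] := conductor_exists sth nth.
have aK := selfdual_additive hK; have ak := selfdual_additive hk.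
have [isq isqV] := int_sqrt_q sqE qk.
have [s hs] := add_haar_formula F a b N M.
have [_ sK] := hs _ Phi h1 h2.
have [||_ sk] := hs _ (red \o Phi).
- by move=> x y hy /=; rewrite h1.
- by move=> x /= ne; apply: h2 => e; apply: ne; rewrite e red0.
- rewrite sK // sk // (box_volume aK N qK) (box_volume ak N qk).
  have [_ _ _ /(_ _ cc) vK] := hK; have [_ _ _ /(_ _ (conductor_red sth cc)) vk] := hk.
  have -> : dK (box _ 0) = sq ^ (c * (a * b)%N%:Z) by exact: vK.
  have -> : dk (box _ 0) = red sq ^ (c * (a * b)%N%:Z) by exact: vk.
  have i1 : int (q%:R ^ (- N * (a * b)%N%:Z) * sq ^ (c * (a * b)%N%:Z)).
    by apply: intM => //; [exact: int_qz | exact: intXz].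
  split; first by apply: intM => //; exact: int_sum.
  rewrite ld_redM // ?red_sum //; last exact: int_sum.
  rewrite ld_redM ?red_qz ?redXz //; [exact: int_qz | exact: intXz].
Qed.
End Reduction.

(** * Convergence for m = n *)

Section CharacterBound.
Variables (F : local_field) (R : fieldType) (theta : F -> R).
Hypotheses (sth : smooth_char theta) (nth : nontrivial_char theta).

(** A multiple of [theta] that is trivial on [varpi^N o] comes from a bounded
    scalar; this turns invariance properties into support bounds. *)
Lemma char_bound (N : int) : exists C : int, forall a : F,
  (forall z, in_pow N z -> theta (a * z) = 1) -> in_pow C a.
Proof.
case: nth => x0 hx0; have x00 : x0 != 0 by apply/eqP => e; apply: hx0; rewrite e char0.
exists (lf_val x0 + 1 - N) => a h; have [->|a0] := eqVneq a 0; first exact: in_pow0.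
rewrite in_powE // leNgt; apply/negP => va; apply: hx0.
rewrite -[x0](mulVKf a0); apply: h; rewrite in_powE ?mulf_neq0 ?invr_eq0 //.
by rewrite lf_valM ?invr_eq0 // lf_valV //; lia.
Qed.

Lemma Cc_fourier_integrand a b (Phi : 'M[F]_(a, b) -> R) (y : 'M[F]_(a, b)) : Cc_mx Phi ->
  Cc_mx (fun x => Phi x * theta (\sum_i \sum_j x i j * y i j)).
Proof.
move=> [[N h1] [M h2]].
pose dot (x y : 'M[F]_(a, b)) := \sum_i \sum_j x i j * y i j.
case: (sth) => _ _ [c hc]; have [B hB] := mx_in_pow_ex y; split.
  exists (Num.max N (c + B%:Z)) => x z hz; rewrite -/(dot (x + z) y).
  have -> : dot (x + z) y = dot x y + dot z y.
    rewrite -big_split; apply: eq_bigr => i _; rewrite -big_split; apply: eq_bigr => j _.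
    by rewrite mxE mulrDl.
  rewrite charD // h1; last by apply: mx_in_pow_le hz; rewrite le_max lexx.
  have hz' : mx_in_pow (c + B%:Z) z by apply: mx_in_pow_le hz; rewrite le_max lexx orbT.
  rewrite (hc (dot z y)) ?mulr1 //; apply: in_pow_sum => i _; apply: in_pow_sum => j _.
  by apply: in_pow_le (in_powM (hz' i j) (hB i j)); lia.
by exists M => x ne; apply: h2 => e; apply: ne; rewrite e mul0r.
Qed.

(** A support bound for [Phi] gives a level for its transform, and the level of
    [Phi] bounds the support of the transform by [char_bound]. *)
Lemma Cc_fourier a b (dx : ('M[F]_(a, b) -> R) -> R) (Phi : 'M[F]_(a, b) -> R) :
  additive_haar dx -> Cc_mx Phi -> Cc_mx (fourier theta dx Phi).
Proof.
move=> hdx [[N h1] [M h2]].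
pose dot (x y : 'M[F]_(a, b)) := \sum_i \sum_j x i j * y i j.
have dotDr x y z : dot x (y + z) = dot x y + dot x z.
  rewrite -big_split; apply: eq_bigr => i _; rewrite -big_split; apply: eq_bigr => j _.
  by rewrite mxE mulrDr.
have dotDl x y z : dot (x + z) y = dot x y + dot z y.
  rewrite -big_split; apply: eq_bigr => i _; rewrite -big_split; apply: eq_bigr => j _.
  by rewrite mxE mulrDl.
have in_dot M1 M2 x y : mx_in_pow M1 x -> mx_in_pow M2 y -> in_pow (M1 + M2) (dot x y).
  by move=> hx hy; apply: in_pow_sum => i _; apply: in_pow_sum => j _; apply: in_powM.
case: (sth) => _ _ [c hc].
have cPhi y : Cc_mx (fun x => Phi x * theta (dot x y)).
  by apply: Cc_fourier_integrand; split; [exists N | exists M].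
split.
  exists (c - M) => y z hz; rewrite /fourier; congr dx; apply/funext => x.
  have [->|/eqP ne] := eqVneq (Phi x) 0; first by rewrite !mul0r.
  congr (_ * _); rewrite -/(dot x (y + z)) -/(dot x y) dotDr charD // (hc (dot x z)) ?mulr1 //.
  by apply: in_pow_le (in_dot _ _ _ _ (h2 _ ne) hz); lia.
have [C hC] := char_bound N; exists C => y ne i j; apply: hC => z hz.
pose t : 'M[F]_(a, b) := z *: delta_mx i j.
have ht : mx_in_pow N t.
  by move=> i' j'; rewrite !mxE; case: (_ && _); rewrite ?mulr1 // mulr0.
have dt : dot t y = y i j * z.
  rewrite /dot (bigD1 i) //= (bigD1 j) //= !mxE !eqxx mulr1 big1 ?addr0; last first.
    by move=> j' nj; rewrite !mxE (negPf nj) andbF mulr0 mul0r.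
  rewrite big1 ?addr0 1?mulrC // => i' ni; rewrite big1 // => j' _.
  by rewrite !mxE (negPf ni) mulr0 mul0r.
have e : fourier theta dx Phi y = theta (dot t y) * fourier theta dx Phi y.
  rewrite /fourier -[LHS](hdx.2 _ t) //; last exact: cPhi.
  transitivity (dx (fun x => theta (dot t y) * (Phi x * theta (dot x y)) + 0)).
    congr dx; apply/funext => x; rewrite -/(dot (x + t) y) dotDl charD // h1 // addr0; ring.
  by rewrite hdx.1 ?add_haar_0 ?addr0 //; exact: Cc_mx_0.
apply: (mulIf (x := fourier theta dx Phi y)); first exact/eqP.
by rewrite mul1r -dt -e.
Qed.
End CharacterBound.

Section WhittakerFunctions.
Variables (F : local_field) (R : fieldType).
Implicit Types (theta : F -> R) (n : nat).

Definition equivariant theta n (W : 'M[F]_n -> R) :=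
  forall u g, unipotent u -> g \in unitmx -> W (u *m g) = theta (superdiag u) * W g.

(** The only properties of Whittaker functions used for convergence. *)
Definition whit_fun theta n (W : 'M[F]_n -> R) :=
  equivariant theta W /\ exists2 N, (0 < N)%N & of_level N W.

Lemma superdiag_delta n (V : 'cV[F]_n) (a c : 'I_n) : c = a.+1 :> nat ->
  superdiag (1%:M + V *m delta_mx 0 c) = V a 0.
Proof.
move=> ca; have E i j : (V *m delta_mx 0 c) i j = V i 0 * (j == c)%:R.
  by rewrite mxE big_ord1 !mxE eqxx.
have -> : superdiag (1%:M + V *m delta_mx 0 c) = superdiag (1%:M : 'M[F]_n) + superdiag (V *m delta_mx 0 c).
  rewrite /superdiag -big_split; apply: eq_bigr => i _ /=.
  by rewrite -big_split; apply: eq_bigr => j _; rewrite mxE.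
rewrite superdiag1 add0r /superdiag.
under eq_bigr => i _ do under eq_bigr => j _ do rewrite E.
rewrite (bigD1 a) //= (bigD1 c) ?ca //= eqxx mulr1 big1 ?addr0; last first.
  by move=> j /andP[_ nj]; rewrite (negPf nj) mulr0.
rewrite big1 ?addr0 // => i ni; rewrite big1 // => j /eqP ji.
case: eqVneq => [jc|]; last by rewrite mulr0.
by case/eqP: ni; apply: val_inj; apply: succn_inj; rewrite -ji jc ca.
Qed.

Lemma unipotent_delta n (V : 'cV[F]_n) (c : 'I_n) : (forall a : 'I_n, (c <= a)%N -> V a 0 = 0) ->
  unipotent (1%:M + V *m delta_mx 0 c).
Proof.
move=> h i j ji; rewrite !mxE big_ord1 !mxE eqxx /=.
case: (eqVneq j c) => [jc|]; last by rewrite mulr0 addr0.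
by rewrite h ?mul0r ?addr0 // -jc.
Qed.

Section Gauge.
Variable theta : F -> R.
Hypotheses (sth : smooth_char theta) (nth : nontrivial_char theta).

(** Where a simple root is large, conjugation by the torus carries small
    unipotent matrices, which the function does not see, to matrices on which
    the character is nontrivial. *)
Lemma gauge N : (0 < N)%N -> exists C : int, forall n (W : 'M[F]_n -> R) (d : 'rV[F]_n) k,
  equivariant theta W -> of_level N W ->
  regular_diag d -> GLo k -> W (diag_mx d *m k) <> 0 ->
  forall i j : 'I_n, j = i.+1 :> nat -> C <= lf_val (d 0 i) - lf_val (d 0 j).
Proof.
move=> N0; have [C hC] := char_bound sth nth N%:Z; exists C => n W d k eW lW rd Gk ne i j ji.
have [uk _ _] := Gk; have ud := diag_unit rd.
rewrite -lf_valV // -lf_valM ?invr_eq0 // -in_powE ?mulf_neq0 ?invr_eq0 //.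
apply: hC => z hz; pose y := z.
pose u0 : 'M[F]_n := 1%:M + (y *: delta_mx i 0 : 'cV_n) *m delta_mx 0 j.
pose u1 : 'M[F]_n := 1%:M + ((d 0 i / d 0 j * z) *: delta_mx i 0 : 'cV_n) *m delta_mx 0 j.
have cu0 : cong N u0.
  apply: cong_add => // a b; rewrite mxE big_ord1 !mxE /=.
  by case: (a == i); case: (b == j); rewrite ?mulr1 ?mulr0 ?mul0r.
have e : diag_mx d *m u0 = u1 *m diag_mx d.
  apply/matrixP => a b; rewrite mul_diag_mx mul_mx_diag !mxE !big_ord1 !mxE !eqxx !andbT /=.
  case: (eqVneq a i) => [->|_]; last by rewrite !mulr0 !mul0r !addr0; case: eqVneq => [->|_]; rewrite ?mulr1 ?mul1r ?mulr0 ?mul0r.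
  case: (eqVneq b j) => [->|_]; last by rewrite !mulr0 !addr0; case: eqVneq => [->|_]; rewrite ?mulr1 ?mul1r ?mulr0 ?mul0r.
  have ij : (i == j) = false by apply/eqP => h; move: ji; rewrite h; lia.
  by rewrite ij !add0r !mulr1 /y; field; exact: rd.
have hu1 : unipotent u1.
  apply: unipotent_delta => a; rewrite ji !mxE => h.
  by case: eqVneq => [ai|_]; rewrite ?mulr0 // ?andbF ?mulr0 //; move: h; rewrite ai ltnn.
have sd : superdiag u1 = d 0 i / d 0 j * z by rewrite (superdiag_delta _ ji) !mxE !eqxx mulr1.
have hW : W (diag_mx d *m k) = theta (d 0 i / d 0 j * z) * W (diag_mx d *m k).
  rewrite -sd -eW ?unitmx_mul ?ud // mulmxA -e.
  rewrite -[LHS](lW _ (invmx k *m u0 *m k)) ?unitmx_mul ?ud //; last exact: cong_conj_GLo.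
  by rewrite !mulmxA mulmxK.
by apply: (mulIf (x := W (diag_mx d *m k))); [exact/eqP | rewrite mul1r -hW].
Qed.
End Gauge.

(** Lower bounds for the last entry and for all the successive differences. *)
Lemma chain_bound n (v : 'I_n -> int) (C M : int) :
  (forall i j : 'I_n, j = i.+1 :> nat -> C <= v i - v j) ->
  (forall i : 'I_n, i.+1 = n -> M <= v i) ->
  forall i, - (`|M|%N + n * `|C|%N)%N%:Z <= v i.
Proof.
move=> h1 h2 i.
suff h k (j : 'I_n) : (n - j <= k)%N -> - (`|M|%N + k * `|C|%N)%N%:Z <= v j.
  by apply: h; rewrite leq_subr.
elim: k j => [|k IH] j hj; first by have := ltn_ord j; lia.
have [e|ne] := eqVneq j.+1 n.
  by have := h2 _ e; move: (v j) => a; lia.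
have lt : (j.+1 < n)%N by rewrite ltn_neqAle ne ltn_ord.
have := h1 j (Ordinal lt) erefl; have := IH (Ordinal lt).
by move: (v _) (v _) => a b /= h3 h4; have := h3 ltac:(lia); lia.
Qed.

(** By the Iwasawa decomposition the support is read on the torus, where a fixed
    determinant turns lower bounds for the entries into upper bounds. *)
Lemma torus_support m (phi : 'M[F]_m -> R) (B : nat) (k0 : int) : N_invariant phi ->
  (forall g, phi g <> 0 -> lf_val (\det g) = k0) ->
  (forall d k, regular_diag d -> GLo k -> phi (diag_mx d *m k) <> 0 -> forall i, - B%:Z <= lf_val (d 0 i)) ->
  exists M, supported M phi.
Proof.
move=> iphi hk hd; exists (- (`|k0|%N + m.+1 * B)%N%:Z) => g ug.
have [u [d [k [hu rd Gk ->]]]] := iwasawa ug.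
have [uk ik jk] := Gk; have ud := diag_unit rd; have uu := unipotent_unit hu.
rewrite -mulmxA iphi ?unitmx_mul ?ud // => ne.
have lb := hd d k rd Gk ne.
have sum : \sum_i lf_val (d 0 i) = k0.
  rewrite -(hk _ ne) detVal_mul // (GLo_det Gk) addr0 det_diag.
  have h (r : seq 'I_m) : \sum_(i <- r) lf_val (d 0 i) = lf_val (\prod_(i <- r) d 0 i).
    elim: r => [|i r IH]; first by rewrite !big_nil lf_val1.
    rewrite !big_cons IH lf_valM ?rd //.
    by rewrite prodf_seq_neq0; apply/allP => j _; rewrite rd.
  exact: h.
have ub i : lf_val (d 0 i) <= (`|k0|%N + m * B)%N%:Z.
  have : - (m * B)%N%:Z <= \sum_(j | j != i) lf_val (d 0 j).
    have h : \sum_(j < m | j != i) (- B%:Z) <= \sum_(j < m | j != i) lf_val (d 0 j).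
      by apply: ler_sum => j _; apply: lb.
    apply: le_trans h; rewrite sumr_const mulNrn lerN2 -mulr_natr natz -PoszM lez_nat mulnC leq_mul2r.
    by rewrite -[X in (_ <= X)%N]card_ord max_card orbT.
  have := sum; rewrite (bigD1 i) //=; move: (lf_val (d 0 i)) => a.
  by move: (\sum_(_ < _ | _) _) => b; lia.
have eu : invmx u *m (u *m (diag_mx d *m k)) = diag_mx d *m k by rewrite mulKmx.
exists (invmx u); split; first exact: unipotentV.
  rewrite eu => i j; rewrite mul_diag_mx mxE; apply: (@in_pow_le _ (- B%:Z + 0)); first by lia.
  by apply: in_powM => //; rewrite in_powE.
rewrite eu invmx_mul // diag_inv // => i j; rewrite mul_mx_diag !mxE.
apply: (@in_pow_le _ (0 + - (`|k0|%N + m * B)%N%:Z)); first by lia.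
by apply: in_powM => //; rewrite in_powE ?invr_eq0 // lf_valV // lerN2.
Qed.

(** The gauge bounds the valuations of the simple roots of the torus from below,
    and [Phi] that of the last entry. *)
Lemma Cc_RS_eq theta n (W W' : 'M[F]_n -> R) (Phi : 'rV[F]_n -> R) (k0 : int) :
  smooth_char theta -> nontrivial_char theta -> (0 < n)%N ->
  whit_fun theta W -> whit_fun (char_inv theta) W' -> Cc_mx Phi ->
  Cc_quot (fun g => if lf_val (\det g) == k0 then W g * W' g * Phi (Defs.eta F n *m g) else 0).
Proof.
move=> sth nth n0 [eW [N N0 lW]] [eW' [N' N'0 lW']] [[NP h1] [MP h2]].
set phi := fun g => _.
have ltz : (n.-1 < n)%N by rewrite ltn_predL.
pose z : 'I_n := Ordinal ltz.
have etaE : Defs.eta F n = delta_mx 0 z.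
  by apply/rowP => j; rewrite !mxE eqxx /=.
have iphi : N_invariant phi.
  move=> u g hu ug; have uu := unipotent_unit hu.
  rewrite /phi detVal_mul // unipotent_det // lf_val1 add0r; case: eqP => // _.
  rewrite eW // eW' // /char_inv mulrACA mulfV ?char_neq0 // mul1r; congr (_ * Phi _).
  rewrite mulmxA; congr (_ *m _); apply/rowP => j; rewrite etaE -rowE !mxE eqxx /=.
  have jz : (j <= z)%N by have := ltn_ord j; rewrite /=; lia.
  by rewrite hu // eq_sym.
apply/Cc_quotP; pose z0 : int := NP - MP; exists (maxn (maxn N N') `|z0|%N).
have [C hC] := gauge sth nth N0.
have row_k (g : 'M[F]_n) k : GLo k -> mx_in_pow MP (Defs.eta F n *m g) -> mx_in_pow MP (Defs.eta F n *m (g *m k)).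
  by move=> [_ ik _] h; have := mx_in_powM h ik; rewrite addr0 mulmxA.
have [|||M hM] := @torus_support n phi (`|MP|%N + n * `|C|%N) k0.
- exact: iphi.
- by move=> g; rewrite /phi; case: eqP.
- move=> d k rd Gk ne i.
  have [neW neP] : W (diag_mx d *m k) <> 0 /\ Phi (Defs.eta F n *m (diag_mx d *m k)) <> 0.
    move: ne; rewrite /phi; case: ifP => // _ /eqP; rewrite !mulf_eq0 !negb_or.
    by move=> /andP[/andP[/eqP ? _] /eqP ?].
  apply: (@chain_bound n (fun i => lf_val (d 0 i)) C MP).
    exact: hC eW lW rd Gk neW.
  move=> i0 hi0; have i0z : i0 = z by apply: val_inj; rewrite /=; move: (nat_of_ord i0) hi0 => a; lia.
  have := row_k _ _ (GLoV Gk) (h2 _ neP).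
  rewrite mulmxK; last by case: Gk.
  move=> /(_ 0 z); rewrite etaE -rowE !mxE eqxx mulr1n i0z in_powE //.
exists M; split=> //.
  by rewrite !leq_max N0.
move=> g k ug ck.
have ckN : cong N k by apply: cong_le ck; rewrite !leq_max leqnn.
have ckN' : cong N' k by apply: cong_le ck; rewrite !leq_max leqnn orbT.
have Gk := cong_GLo N0 ckN; have [uk _ _] := Gk.
rewrite /phi detVal_mul // (GLo_det Gk) addr0; case: eqP => // _.
rewrite lW // lW' //; congr (_ * _).
case: (EM (mx_in_pow MP (Defs.eta F n *m g))) => h.
  have -> : Defs.eta F n *m (g *m k) = Defs.eta F n *m g + Defs.eta F n *m g *m (k - 1%:M).
    by rewrite mulmxBr mulmx1 addrC subrK mulmxA.
  apply: h1; have [_ hk] := ck; apply: mx_in_pow_le (mx_in_powM h hk).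
  by rewrite /z0; lia.
have -> : Phi (Defs.eta F n *m g) = 0 by apply: contrapT => e; apply: h; apply: h2.
apply: contrapT => e; apply: h.
by have := row_k _ _ (GLoV Gk) (h2 _ e); rewrite mulmxK.
Qed.
End WhittakerFunctions.

(** * Convergence for m < n *)

Section UnequalRank.
Variables (F : local_field) (R : fieldType) (m j i : nat).
Notation n := (m + j + i.+1)%N.

Definition blk (g : 'M[F]_m) (x : 'M[F]_(j, m)) : 'M[F]_n :=
  block_mx (block_mx g 0 x 1%:M) 0 0 1%:M.

Lemma blkM g x h y : blk g x *m blk h y = blk (g *m h) (x *m h + y).
Proof. by rewrite /blk !mulmx_block !mul0mx !mulmx0 !mul1mx ?mulmx1 !addr0 ?add0r. Qed.

Lemma blk1 : blk 1%:M 0 = 1%:M.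
Proof. by rewrite /blk -!scalar_mx_block. Qed.

Lemma blk_unit g x : g \in unitmx -> blk g x \in unitmx.
Proof.
move=> ug; suff : blk g x *m blk (invmx g) (- x *m invmx g) = 1%:M by case/mulmx1_unit.
by rewrite blkM mulmxV // mulNmx subrr blk1.
Qed.

Lemma blk_unipotent u : unipotent u -> unipotent (blk u 0).
Proof.
move=> hu; apply: unipotent_block; last exact: unipotent1.
by apply: unipotent_block => //; apply: unipotent1.
Qed.

Lemma blk_superdiag u : superdiag (blk u 0) = superdiag u.
Proof. by rewrite /blk !superdiag_block1. Qed.

Lemma blk_in_pow (M : int) g x : M <= 0 -> mx_in_pow M g -> mx_in_pow M x -> mx_in_pow M (blk g x).
Proof.
move=> M0 hg hx.
have one k : mx_in_pow M (1%:M : 'M[F]_k) by apply: mx_in_pow_le M0 _; exact: mx_in_pow1.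
have hb a b c d (A : 'M[F]_(a, c)) (B : 'M[F]_(a, d)) (C : 'M[F]_(b, c)) (E : 'M[F]_(b, d)) :
    mx_in_pow M A -> mx_in_pow M B -> mx_in_pow M C -> mx_in_pow M E -> mx_in_pow M (block_mx A B C E).
  move=> hA hB hC hE r s; rewrite -[r]splitK -[s]splitK.
  by case: (fintype.split r) => r'; case: (fintype.split s) => s' /=;
    rewrite ?(block_mxEul, block_mxEur, block_mxEdl, block_mxEdr).
by apply: (hb) => //; try exact: mx_in_pow0; apply: (hb) => //; exact: mx_in_pow0.
Qed.

Lemma blk_cong N g x : (0 < N)%N -> cong N g -> mx_in_pow N%:Z x -> cong N (blk g x).
Proof.
move=> N0 [ug hg] hx; split; first exact: blk_unit.
have -> : blk g x - 1%:M = block_mx (block_mx (g - 1%:M) 0 x 0) 0 0 0.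
  by rewrite /blk -blk1 /blk !opp_block_mx !add_block_mx !oppr0 !addr0 !subrr.
move=> r s; rewrite -[r]splitK -[s]splitK.
case: (fintype.split r) => r'; case: (fintype.split s) => s' /=;
  rewrite ?(block_mxEul, block_mxEur, block_mxEdl, block_mxEdr); try by rewrite mxE in_pow0.
rewrite -[r']splitK -[s']splitK.
case: (fintype.split r') => r2; case: (fintype.split s') => s2 /=;
  rewrite ?(block_mxEul, block_mxEur, block_mxEdl, block_mxEdr);
  first [exact: hg | exact: hx | by rewrite mxE in_pow0].
Qed.

Variable theta : F -> R.
Hypotheses (sth : smooth_char theta) (nth : nontrivial_char theta).

(** The rows of [x] are bounded one by one, starting from the bottom: right
    translation by a small unipotent matrix that has its entries in the column
    following that row amounts to left translation by a unipotent matrix on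
    which the character reads off the row. *)
Lemma blk_support N : (0 < N)%N -> exists M : int, forall (W : 'M[F]_n -> R) g x,
  equivariant theta W -> of_level N W -> g \in unitmx -> W (blk g x) <> 0 -> mx_in_pow M x.
Proof.
move=> N0.
suff h r : exists B : nat, forall (W : 'M[F]_n -> R) g x,
    equivariant theta W -> of_level N W -> g \in unitmx -> W (blk g x) <> 0 ->
    forall (a : 'I_j) b, (j - r <= a)%N -> in_pow (- B%:Z) (x a b).
  have [B hB] := h j; exists (- B%:Z) => W g x eW lW ug ne a b.
  by apply: (hB W g) => //; rewrite subnn.
elim: r => [|r [B hB]].
  by exists 0%N => W g x _ _ _ _ a b; have := ltn_ord a; rewrite subn0; lia.
have [C hC] := char_bound sth nth (N + B + B)%N%:Z.
exists (maxn B `|C|%N) => W g x eW lW ug ne a b ja.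
have oldbound (a' : 'I_j) b' : (a < a')%N -> in_pow (- B%:Z) (x a' b').
  by move=> aa'; apply: (hB W g) => //; lia.
have [ja'|ja'] := leqP (j - r) a.
  by apply: in_pow_le (hB W g x eW lW ug ne a b ja'); lia.
apply: (@in_pow_le _ C); first lia.
apply: hC => z hz.
pose x1 : 'M[F]_(j, m) := \matrix_(s, t) if (s <= a)%N then x s t else 0.
pose x2 : 'M[F]_(j, m) := \matrix_(s, t) if (s <= a)%N then 0 else x s t.
have x12 : x1 + x2 = x.
  by apply/matrixP => s t; rewrite !mxE; case: ifP; rewrite ?addr0 ?add0r.
pose h := blk 1%:M x2; pose A := blk g x1.
have hA : blk g x = A *m h by rewrite /A /h blkM !mulmx1 x12.
have hi : h *m blk 1%:M (- x2) = 1%:M by rewrite blkM !mulmx1 subrr blk1.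
have uh : h \in unitmx by apply: blk_unit; rewrite unitmx1.
have iA : A \in unitmx by apply: blk_unit.
have hinv : invmx h = blk 1%:M (- x2) by apply: (can_inj (mulKmx uh)); rewrite mulmxV.
have bx2 : mx_in_pow (- B%:Z) x2.
  move=> s t; rewrite mxE; case: leqP => // st; exact: oldbound.
have b1 : mx_in_pow (- B%:Z) (1%:M : 'M[F]_m) by apply: mx_in_pow_le (@mx_in_pow1 F m); lia.
have ltc : ((m + a).+1 < n)%N by have := ltn_ord a; lia.
pose c : 'I_n := Ordinal ltc.
pose y : 'cV[F]_m := z *: delta_mx b 0.
pose Y : 'cV[F]_n := col_mx (col_mx y 0) 0.
pose u := 1%:M + Y *m delta_mx 0 c.
have hy : mx_in_pow (N + B + B)%N%:Z y.
  by move=> s t; rewrite !mxE; case: (_ && _); rewrite ?mulr1 ?mulr0.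
have cu : cong (N + B + B) u.
  apply: cong_add; first by rewrite !addn_gt0 N0.
  move=> s t; rewrite mxE big_ord1 [delta_mx _ _ _ _]mxE eqxx /=.
  have : in_pow (N + B + B)%N%:Z (Y s 0).
    rewrite -[s]splitK; case: (fintype.split s) => s' /=; last by rewrite col_mxEd mxE.
    rewrite col_mxEu -[s']splitK; case: (fintype.split s') => s2 /=; last by rewrite col_mxEd mxE.
    by rewrite col_mxEu.
  by case: (t == c); rewrite ?mulr1 ?mulr0.
have AY : A *m Y = col_mx (col_mx (g *m y) (x1 *m y)) 0.
  by rewrite /A /blk /Y !mul_block_col !mulmx0 !mul0mx !addr0.
have cA : (delta_mx 0 c : 'rV[F]_n) *m A = delta_mx 0 c.
  rewrite -rowE -[RHS]mulmx1 -rowE; apply/rowP => t; rewrite [LHS]mxE [RHS]mxE -blk1 /A.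
  have [[s es ->]|[s ->]] : (exists2 s : 'I_j, s = a.+1 :> nat & c = lshift i.+1 (rshift m s)) \/
      (exists s : 'I_i.+1, c = rshift (m + j) s).
  - case: (ltnP a.+1 j) => aj; [left | right].
      by exists (Ordinal aj) => //; apply: val_inj; rewrite /= addnS.
    by exists ord0; apply: val_inj; rewrite /=; have := ltn_ord a; lia.
  - rewrite /blk -[t]splitK; case: (fintype.split t) => t' /=; last by rewrite !block_mxEur.
    rewrite !block_mxEul -[t']splitK; case: (fintype.split t') => t2 /=; last by rewrite !block_mxEdr.
    by rewrite !block_mxEdl !mxE es ltnn.
  - by rewrite /blk -[t]splitK; case: (fintype.split t) => t' /=; rewrite ?block_mxEdl ?block_mxEdr.
pose u' := 1%:M + (A *m Y) *m delta_mx 0 c.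
have Au : A *m u = u' *m A.
  by rewrite /u /u' mulmxDr mulmx1 mulmxDl mul1mx -!mulmxA cA.
have x1y s : (x1 *m y) s 0 = if (s <= a)%N then x s b * z else 0.
  rewrite mxE (bigD1 b) //= !mxE !eqxx mulr1 big1 ?addr0; last first.
    by move=> t tb; rewrite !mxE (negPf tb) !mulr0.
  by case: ifP; rewrite ?mul0r.
have lta : (m + a < n)%N by have := ltn_ord a; lia.
pose a0 : 'I_n := Ordinal lta.
have hu' : unipotent u'.
  apply: unipotent_delta => s cs; rewrite AY.
  move: cs; rewrite -[s]splitK; case: splitP => s' es /= cs; last by rewrite col_mxEd mxE.
  rewrite col_mxEu; move: cs; rewrite -[s']splitK; case: splitP => s2 es2 /= cs.
    by have := ltn_ord s2; move: cs es es2; rewrite /=; lia.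
  rewrite col_mxEd x1y; case: leqP => //; move: cs es es2; rewrite /=; lia.
have sd : superdiag u' = x a b * z.
  rewrite (@superdiag_delta _ _ _ a0) // AY.
  have -> : a0 = lshift i.+1 (rshift m a) by apply: val_inj.
  by rewrite col_mxEu col_mxEd x1y leqnn.
have e : W (blk g x) = theta (x a b * z) * W (blk g x).
  rewrite -sd -eW ?hA ?unitmx_mul ?iA // mulmxA -Au.
  rewrite -[LHS](lW _ (invmx h *m u *m h)) ?unitmx_mul ?iA //.
    by rewrite !mulmxA mulmxK.
  apply: (@cong_conj _ _ _ B) => //; first by apply: blk_in_pow => //; lia.
  by rewrite hinv; apply: blk_in_pow => //; [lia | apply: mx_in_powN].
by apply: (mulIf (x := W (blk g x))); [exact/eqP | rewrite mul1r -e].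
Qed.

Variables (W : 'M[F]_n -> R) (W' : 'M[F]_m -> R).
Hypotheses (hW : whit_fun theta W) (hW' : whit_fun (char_inv theta) W') (m0 : (0 < m)%N).

Definition lt_integrand (k0 : int) (x : 'M[F]_(j, m)) (g : 'M[F]_m) : R :=
  if lf_val (\det g) == k0 then W (blk g x) * W' g else 0.

(** For fixed [x], right translation by [blk 1 x] reduces to [x = 0]; the gauge
    then applies on the torus of the larger group, whose last entry is 1. *)
Lemma Cc_lt_integrand k0 x : Cc_quot (lt_integrand k0 x).
Proof.
have [eW [N N0 lW]] := hW; have [eW' [N' N'0 lW']] := hW'.
pose Wx A := W (A *m blk 1%:M x).
have ux : blk 1%:M x \in unitmx by apply: blk_unit; rewrite unitmx1.
have eWx : equivariant theta Wx.
  by move=> u g hu ug; rewrite /Wx -mulmxA eW // unitmx_mul ug.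
have [B1 hB1] := mx_in_pow_ex (blk 1%:M x); have [B2 hB2] := mx_in_pow_ex (invmx (blk 1%:M x)).
pose B := maxn B1 B2; pose Nx := (N + B + B)%N.
have lWx : of_level Nx Wx.
  move=> g k ug ck; rewrite /Wx.
  have -> : g *m k *m blk 1%:M x = g *m blk 1%:M x *m (invmx (blk 1%:M x) *m k *m blk 1%:M x).
    by rewrite !mulmxA mulmxK.
  rewrite lW ?unitmx_mul ?ug //; apply: cong_conj ck => //.
    by apply: mx_in_pow_le hB1; rewrite /B; lia.
  by apply: mx_in_pow_le hB2; rewrite /B; lia.
have Nx0 : (0 < Nx)%N by rewrite !addn_gt0 N0.
have WE g : W (blk g x) = Wx (blk g 0) by rewrite /Wx blkM mulmx1 mul0mx add0r.
set phi := lt_integrand k0 x.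
have iphi : N_invariant phi.
  move=> u g hu ug; have uu := unipotent_unit hu.
  rewrite /phi /lt_integrand detVal_mul // unipotent_det // lf_val1 add0r; case: eqP => // _.
  have -> : blk (u *m g) x = blk u 0 *m blk g x by rewrite blkM mul0mx add0r.
  rewrite eW ?blk_unit //; last exact: blk_unipotent.
  by rewrite blk_superdiag eW' // /char_inv mulrACA mulfV ?char_neq0 // mul1r.
have [C hC] := gauge sth nth Nx0.
apply/Cc_quotP; exists (maxn Nx N').
have [|||M hM] := @torus_support F R m phi (`|0%:Z|%N + n * `|C|%N) k0.
- exact: iphi.
- by move=> g; rewrite /phi /lt_integrand; case: eqP.
- move=> d k rd Gk ne s.
  have neW : Wx (blk (diag_mx d *m k) 0) <> 0.
    rewrite -WE; move: ne; rewrite /phi /lt_integrand; case: ifP => // _ /eqP.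
    by rewrite mulf_eq0 negb_or => /andP[/eqP].
  pose d' : 'rV[F]_n := row_mx (row_mx d (const_mx 1)) (const_mx 1).
  have rd' : regular_diag d'.
    move=> t; rewrite -[t]splitK; case: (fintype.split t) => t' /=; last by rewrite row_mxEr mxE oner_neq0.
    rewrite row_mxEl -[t']splitK; case: (fintype.split t') => t2 /=; last by rewrite row_mxEr mxE oner_neq0.
    by rewrite row_mxEl.
  have eb : blk (diag_mx d *m k) 0 = diag_mx d' *m blk k 0.
    rewrite /d' !diag_mx_row !diag_const_mx.
    by have := blkM (diag_mx d) 0 k 0; rewrite mul0mx addr0 => <-.
  have Gk' : GLo (blk k 0) by apply: GLo_block; [apply: GLo_block => //; exact: GLo1 | exact: GLo1].
  rewrite eb in neW.
  have := @chain_bound n (fun t => lf_val (d' 0 t)) C 0 (hC n Wx d' _ eWx lWx rd' Gk' neW) _ (lshift _ (lshift _ s)).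
  rewrite !row_mxEl; apply=> t et.
  have -> : t = rshift (m + j) (ord_max : 'I_i.+1) by apply: val_inj; rewrite /=; lia.
  by rewrite row_mxEr mxE lf_val1.
exists M; split=> //; first by rewrite leq_max Nx0.
move=> g k ug ck.
have ckN : cong Nx k by apply: cong_le ck; rewrite leq_max leqnn.
have ckN' : cong N' k by apply: cong_le ck; rewrite leq_max leqnn orbT.
have Gk := cong_GLo Nx0 ckN; have [uk _ _] := Gk.
rewrite /phi /lt_integrand detVal_mul // (GLo_det Gk) addr0; case: eqP => // _.
rewrite !WE lW' //; congr (_ * _).
have -> : blk (g *m k) 0 = blk g 0 *m blk k 0 by rewrite blkM mul0mx add0r.
by rewrite lWx ?blk_unit //; apply: blk_cong => //; apply: mx_in_pow0.
Qed.

(** This is where the bound on [x] must be uniform in [g]. *)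
Lemma Cc_lt_outer mu k0 : haar_quot mu -> Cc_mx (fun x => mu (lt_integrand k0 x)).
Proof.
move=> hmu; have [eW [N N0 lW]] := hW; have [M hM] := blk_support N0.
split.
  exists N%:Z => x y hy; apply: haar_ext => //; first exact: Cc_lt_integrand.
  move=> g ug; rewrite /lt_integrand; case: eqP => // _; congr (_ * _).
  have -> : blk g (x + y) = blk g x *m blk 1%:M y by rewrite blkM !mulmx1.
  by rewrite lW ?blk_unit //; apply: blk_cong => //; exact: cong1.
exists M => x ne; apply: contrapT => nx; apply: ne.
rewrite -(haar_0 hmu); apply: haar_ext => //; first exact: Cc_lt_integrand.
move=> g ug; rewrite /lt_integrand; case: eqP => // _.
suff -> : W (blk g x) = 0 by rewrite mul0r.
by apply: contrapT => ne; apply: nx; apply: (hM W g).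
Qed.
End UnequalRank.

(** * Duality *)

Section Dual.
Variables (F : local_field) (R : fieldType).
Implicit Types (theta : F -> R) (n : nat).

Lemma w_mx_perm n m : exists s : 'S_n, w_mx F n m = perm_mx s /\ (m = 0%N -> forall i, s i = rev_ord i).
Proof.
pose f (i : 'I_n) : 'I_n := if (i < m)%N then i else insubd i (m + n.-1 - i)%N.
have fE (i : 'I_n) : f i = (if i < m then i : nat else m + n.-1 - i)%N :> nat.
  rewrite /f; case: ltnP => // mi; rewrite val_insubd; case: ltnP => //.
  by have := ltn_ord i; lia.
have finj : injective f.
  move=> i j /(congr1 (@nat_of_ord n)); rewrite !fE => h; apply: val_inj => /=.
  move: h; have := ltn_ord i; have := ltn_ord j; move: (nat_of_ord i) (nat_of_ord j) => a b.
  by case: (ltnP a m) => ha; case: (ltnP b m) => hb; lia.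
exists (perm finj); split.
  apply/matrixP => i j; rewrite !mxE permE -!val_eqE /= fE; case: ltnP => mi //.
  by congr (nat_of_bool _)%:R; have := ltn_ord i; have := ltn_ord j; lia.
move=> m0 i; rewrite permE; apply: val_inj; rewrite /= fE m0 ltn0 /=.
by have := ltn_ord i; lia.
Qed.

Lemma w_mx_GLo n m : GLo (w_mx F n m).
Proof. by have [s [-> _]] := w_mx_perm n m; apply: GLo_perm. Qed.

Lemma w_mx_unit n m : w_mx F n m \in unitmx.
Proof. by case: (w_mx_GLo n m). Qed.

Lemma w0_conjE n (X : 'M[F]_n) i j : (w_mx F n 0 *m X *m w_mx F n 0) i j = X (rev_ord i) (rev_ord j).
Proof.
have [s [-> /(_ erefl) hs]] := w_mx_perm n 0.
have e : (s^-1)%g = s by apply/permP => k; apply: (@perm_inj _ s); rewrite permKV !hs rev_ordK.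
by rewrite -{2}e -col_permE -row_permE !mxE !hs.
Qed.

Lemma w0_sq n : w_mx F n 0 *m w_mx F n 0 = 1%:M.
Proof.
apply/matrixP => i j; have := w0_conjE 1%:M i j; rewrite mulmx1 => ->.
by rewrite !mxE (inj_eq rev_ord_inj).
Qed.

(** Inverse transposition makes [u] lower triangular, and the antidiagonal
    permutation reverses the order of rows and columns; the superdiagonal is
    read backwards, with the opposite sign. *)
Lemma w0_conj_unipotent n (u : 'M[F]_n) : unipotent u -> let u' := w_mx F n 0 *m trmx (invmx u) *m w_mx F n 0 in
  unipotent u' /\ superdiag u' = - superdiag u.
Proof.
move=> hu u'; have hv := unipotentV hu; split.
  move=> i j ji; rewrite w0_conjE mxE hv; first by rewrite (inj_eq rev_ord_inj) eq_sym.
  by rewrite /=; have := ltn_ord i; lia.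
rewrite -superdiagV // /superdiag.
rewrite [RHS](reindex_inj rev_ord_inj) /=.
under [RHS]eq_bigr => i _ do rewrite (reindex_inj rev_ord_inj) /= big_mkcond /=.
under [LHS]eq_bigr => i _ do rewrite big_mkcond /=.
rewrite [RHS]exchange_big /=; apply: eq_bigr => i _; apply: eq_bigr => j _.
rewrite w0_conjE mxE; congr (if _ then _ else _).
by have := ltn_ord i; have := ltn_ord j; lia.
Qed.

Lemma whit_fun_tilde theta n (W : 'M[F]_n -> R) : smooth_char theta ->
  whit_fun theta W -> whit_fun (char_inv theta) (W_tilde W).
Proof.
move=> sth [eW [N N0 lW]]; split.
  move=> u g hu ug; have uu := unipotent_unit hu; rewrite /W_tilde.
  have [hu' su'] := w0_conj_unipotent hu.
  have -> : w_mx F n 0 *m trmx (invmx (u *m g)) =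
      (w_mx F n 0 *m trmx (invmx u) *m w_mx F n 0) *m (w_mx F n 0 *m trmx (invmx g)).
    by rewrite invmx_mul // trmx_mul -!mulmxA [X in _ *m (_ *m X)]mulmxA w0_sq mul1mx.
  by rewrite eW ?su' ?charN // unitmx_mul w_mx_unit unitmx_tr unitmx_inv.
exists N => // g k ug ck; rewrite /W_tilde invmx_mul //; last by case: ck.
rewrite trmx_mul mulmxA lW // ?unitmx_mul ?w_mx_unit ?unitmx_tr ?unitmx_inv //.
by apply: cong_tr; apply: congV.
Qed.

Lemma whit_fun_rho theta n m (W : 'M[F]_n -> R) : whit_fun theta W -> whit_fun theta (rho_w m W).
Proof.
move=> [eW [N N0 lW]]; split.
  by move=> u g hu ug; rewrite /rho_w -mulmxA eW // unitmx_mul ug w_mx_unit.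
exists N => // g k ug ck; rewrite /rho_w.
have uw := w_mx_unit n m.
have -> : g *m k *m w_mx F n m = g *m w_mx F n m *m (invmx (w_mx F n m) *m k *m w_mx F n m).
  by rewrite !mulmxA mulmxK.
by rewrite lW ?unitmx_mul ?ug //; apply: cong_conj_GLo => //; apply: w_mx_GLo.
Qed.

(** Conjugation by this matrix changes the sign of the superdiagonal, so it
    exchanges Whittaker models for [theta] and for [theta^-1]. *)
Definition signs n : 'M[F]_n := diag_mx (\row_i (-1) ^+ i).

Lemma signs_regular n : regular_diag (\row_(i < n) (-1 : F) ^+ i).
Proof. by move=> i; rewrite mxE signr_eq0. Qed.

Lemma signs_unit n : signs n \in unitmx.
Proof. exact/diag_unit/signs_regular. Qed.

Lemma signs_sq n : signs n *m signs n = 1%:M.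
Proof.
rewrite mulmx_diag -[RHS]diag_const_mx; congr diag_mx; apply/rowP => i.
by rewrite !mxE -exprMn mulrNN mulr1 expr1n.
Qed.

Lemma signs_conj n (u : 'M[F]_n) : unipotent u ->
  unipotent (signs n *m u *m signs n) /\ superdiag (signs n *m u *m signs n) = - superdiag u.
Proof.
move=> hu; have e : invmx (signs n) = signs n.
  by apply: (can_inj (mulKmx (signs_unit n))); rewrite mulmxV ?signs_sq ?signs_unit.
rewrite -{2 4}e; split; first by apply: unipotent_conj_diag => //; exact: signs_regular.
rewrite /superdiag -sumrN; apply: eq_bigr => i _; rewrite -sumrN; apply: eq_bigr => j /eqP ji.
rewrite diag_conjE; last exact: signs_regular.
rewrite !mxE ji exprS mulN1r invrN mulrN mulrAC divff ?mul1r //.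
by rewrite signr_eq0.
Qed.
End Dual.

Section Representations.
Variables (F : local_field) (R : fieldType).
Implicit Types (theta : F -> R) (n : nat).

Lemma smooth_tilde n (pi : prerep F R n) : smooth_rep pi -> smooth_rep (rep_tilde pi).
Proof.
move=> [h1 h2 h3 h4]; split => /=.
- by move=> g ug; apply: h1; rewrite unitmx_tr unitmx_inv.
- by move=> v; rewrite invmx1 trmx1 h2.
- by move=> g h v ug uh; rewrite invmx_mul // trmx_mul h3 // unitmx_tr unitmx_inv.
- move=> v; have [N hN] := h4 v; exists N.+1 => g cg; apply: hN.
  by apply: (@cong_le _ _ N.+1) => //; apply: cong_tr; apply: congV.
Qed.

(** An induced representation is modelled on functions of [ind_fun], where the
    group acts by right translation. *)
Lemma ind_smooth sq n1 n2 n (e : (n1 + n2)%N = n) (s1 : prerep F R n1) (s2 : prerep F R n2)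
  (pi : prerep F R n) : is_ind sq e s1 s2 pi -> smooth_rep pi.
Proof.
move=> [T [b [aT [E [_ _ linE actE [injE imE _]]]]]].
have inj v w : (forall x, x \in unitmx -> E v x = E w x) -> v = w.
  move=> h; apply/eqP; rewrite -subr_eq0; apply/eqP; apply: injE => x ux.
  have el := linE x ux (-1) w v; rewrite !scaleN1r in el.
  by rewrite addrC el h // addNr.
split.
- move=> g ug a u v; apply: inj => x ux.
  by rewrite actE // (linE x ux) (linE _ _ a u v) ?unitmx_mul ?ux // !actE.
- by move=> v; apply: inj => x ux; rewrite actE ?unitmx1 // mulmx1.
- by move=> g h v ug uh; apply: inj => x ux; rewrite !actE ?unitmx_mul ?ug ?ux // mulmxA.
- move=> v; have [_ [N hN]] := imE v; exists N => g cg; apply: inj => x ux.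
  by rewrite actE ?hN //; case: cg.
Qed.

Lemma whittaker_smooth sq theta n (pi : prerep F R n) : whittaker_type sq theta pi -> smooth_rep pi.
Proof.
elim=> [k s [r [rho [a [b [_ _ _ _ [[[hs _ _] _] _]]]]]]|n1 n2 k e s tau pi' _ _ _ hi] //.
exact: ind_smooth hi.
Qed.

Lemma whittaker_gt0 sq theta n (pi : prerep F R n) : whittaker_type sq theta pi -> (0 < n)%N.
Proof.
have h k (s : prerep F R k) : is_Lseg sq theta s -> (0 < k)%N.
  move=> [r [rho [a [b [r0 _ _ _ [_ [Pi hPi _]]]]]]].
  by elim: hPi => // a' m n' e *; rewrite -e addn_gt0 r0.
elim=> [k s /h //|n1 n2 k e s tau pi' /h n10 _ _ _].
by rewrite -e addn_gt0 n10.
Qed.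

Lemma whit_whit_fun theta n (pi : prerep F R n) W : smooth_rep pi -> whit theta pi W -> whit_fun theta W.
Proof.
move=> [h1 h2 h3 h4] [lam [[slam elam] _ [v ->]]]; split.
  move=> u g hu ug; have uu := unipotent_unit hu.
  by rewrite unitmx_mul uu ug /= h3 // elam.
have [N hN] := h4 v; exists N.+1 => // g k ug ck; have [uk _] := ck.
rewrite unitmx_mul ug uk /= h3 // hN //.
exact: cong_le ck.
Qed.

(** If [lam] is a Whittaker functional for [t], then [lam] composed with the
    action of [d] is one for the conjugate character [s]. *)
Lemma whit_left (s t : F -> R) n (pi : prerep F R n) (W : 'M[F]_n -> R) (d : 'M[F]_n) :
  smooth_rep pi -> d \in unitmx ->
  (forall u, unipotent u -> unipotent (d *m u *m invmx d) /\
     t (superdiag (d *m u *m invmx d)) = s (superdiag u)) ->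
  whit t pi W -> whit s pi (fun g => W (d *m g)).
Proof.
move=> [h1 h2 h3 h4] ud hd [lam [[slam elam] [v0 hv0] [v ->]]].
have lind := h1 _ ud.
exists (fun w => lam (act d w)); split.
- split; first by move=> a x y; rewrite lind slam.
  move=> u w hu; have uu := unipotent_unit hu; have [hu' e] := hd u hu.
  have uu' := unipotent_unit hu'.
  have -> : act d (act u w) = act (d *m u *m invmx d) (act d w).
    by rewrite -!h3 // ?unitmx_mul ?ud // mulmxKV.
  by rewrite elam // /theta_N -/(superdiag _) e.
- exists (act (invmx d) v0); rewrite -h3 ?unitmx_inv // mulmxV // h2 //.
- exists v; apply/funext => g; rewrite unitmx_mul ud /=.
  by case: ifP => // ug; rewrite h3.
Qed.

Lemma whit_signs theta n (pi : prerep F R n) W : smooth_char theta -> smooth_rep pi ->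
  whit theta pi W -> whit (char_inv theta) pi (fun g => W (signs F n *m g)).
Proof.
move=> sth spi; apply: whit_left => //; first exact: signs_unit.
have e : invmx (signs F n) = signs F n.
  by apply: (can_inj (mulKmx (signs_unit F n))); rewrite mulmxV ?signs_sq ?signs_unit.
by move=> u hu; rewrite e; have [h ->] := signs_conj hu; rewrite charN.
Qed.

Lemma whit_signs_inv theta n (pi : prerep F R n) W : smooth_char theta -> smooth_rep pi ->
  whit (char_inv theta) pi W -> whit theta pi (fun g => W (signs F n *m g)).
Proof.
move=> sth spi h; rewrite -[theta]char_invK; apply: whit_signs => //.
exact: smooth_char_inv.
Qed.

(** A Whittaker functional of [rep_tilde pi] for [theta], composed with the
    action of the antidiagonal permutation, is one of [pi] for [theta^-1]. *)
Lemma whit_tilde theta n (pi : prerep F R n) W : smooth_char theta -> smooth_rep pi ->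
  whit theta (rep_tilde pi) W -> exists2 W0, whit (char_inv theta) pi W0 &
    forall g, g \in unitmx -> W g = W0 (w_mx F n 0 *m trmx (invmx g)).
Proof.
move=> sth [h1 h2 h3 h4] [lam [[slam elam] [v0 hv0] [v ->]]].
have uw := w_mx_unit F n 0; have winv : invmx (w_mx F n 0) = w_mx F n 0.
  by apply: (can_inj (mulKmx uw)); rewrite mulmxV ?w0_sq.
pose pact := @act F R n pi.
exists (fun g => if g \in unitmx then lam (pact (w_mx F n 0) (pact g v)) else 0).
  exists (fun w : pi => lam (pact (w_mx F n 0) w)); split.
  - have lind := h1 _ uw; split; first by move=> a x y; rewrite /pact lind slam.
    move=> u w hu; have uu := unipotent_unit hu; have [hu' su'] := w0_conj_unipotent hu.
    set u' := _ *m _ in hu' su'; have uu' := unipotent_unit hu'.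
    have eu : w_mx F n 0 *m u = trmx (invmx u') *m w_mx F n 0.
      have -> : invmx u' = w_mx F n 0 *m trmx u *m w_mx F n 0.
        apply: (can_inj (mulKmx uu')); rewrite mulmxV // /u'.
        rewrite !mulmxA -[X in X *m _ *m _]mulmxA w0_sq mulmx1 -!mulmxA [trmx _ *m (trmx _ *m _)]mulmxA.
        by rewrite -trmx_mul mulmxV // trmx1 mul1mx w0_sq.
      have tw : trmx (w_mx F n 0) = w_mx F n 0.
        by apply/matrixP => i j; rewrite !mxE !ltn0 addnC.
      by rewrite !trmx_mul trmxK tw !mulmxA -!mulmxA w0_sq mulmx1.
    rewrite /pact -h3 // eu h3 // ?unitmx_tr ?unitmx_inv //.
    have := elam u' (pact (w_mx F n 0) w) hu'; rewrite /= => ->.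
    by rewrite /theta_N -!/(superdiag _) su' charN.
  - exists (pact (w_mx F n 0) v0); rewrite /pact -h3 // w0_sq h2 //.
  - by exists v.
move=> g ug; rewrite ug unitmx_mul uw unitmx_tr unitmx_inv ug /=.
by rewrite /pact -h3 ?unitmx_mul ?uw ?unitmx_tr ?unitmx_inv // mulmxA w0_sq mul1mx.
Qed.
End Representations.

(** * Laurent series and gamma factors *)

Section LaurentSeries.
Variable R : fieldType.
Implicit Types (P Q : {poly R}) (f g : int -> R).
Notation pms := (@poly_mul_series R).

Lemma pmsE P f k N : (size P <= N)%N -> pms P f k = \sum_(i < N) P`_i * f (k - i%:Z).
Proof.
move=> h; rewrite /poly_mul_series (big_ord_widen N (fun i => P`_i * f (k - i%:Z)) h).
rewrite big_mkcond /=; apply: eq_bigr => i _; case: ltnP => // hi.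
by rewrite nth_default // mul0r.
Qed.

Lemma pmsD P Q f k : pms (P + Q) f k = pms P f k + pms Q f k.
Proof.
pose N := maxn (size P) (size Q).
rewrite !(@pmsE _ _ _ N) ?leq_maxl ?leq_maxr // ?size_polyD //.
by rewrite -big_split; apply: eq_bigr => i _; rewrite coefD mulrDl.
Qed.

Lemma pmsC c f k : pms c%:P f k = c * f k.
Proof. by rewrite (@pmsE _ _ _ 1) ?size_polyC_leq1 // big_ord1 coefC subr0. Qed.

Lemma pmsMX P f k : pms (P * 'X) f k = pms P f (k - 1).
Proof.
rewrite (@pmsE (P * 'X) _ _ (size P).+1); last first.
  by apply: leq_trans (size_polyMleq _ _) _; rewrite size_polyX addn2.
rewrite big_ord_recl coefMX mul0r add0r; apply: eq_bigr => i _.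
by rewrite coefMX /=; congr (_ * f _); rewrite /bump /=; lia.
Qed.

Lemma pmsCM c P f k : pms (c%:P * P) f k = c * pms P f k.
Proof.
rewrite mul_polyC (@pmsE (c *: P) _ _ (size P)) ?size_scale_leq // mulr_sumr.
by apply: eq_bigr => i _; rewrite coefZ mulrA.
Qed.

Lemma pmsM P Q f k : pms (P * Q) f k = pms P (pms Q f) k.
Proof.
elim/poly_ind: P k => [|P c IH] k.
  by rewrite mul0r -[0]polyC0 !pmsC !mul0r.
by rewrite mulrDl pmsD pmsCM [P * 'X * Q]mulrAC pmsMX IH pmsD pmsMX pmsC.
Qed.

Lemma pms_comm P Q f k : pms P (pms Q f) k = pms Q (pms P f) k.
Proof. by rewrite -!pmsM mulrC. Qed.

Lemma pms_shift P f d k : pms P (fun j => f (j - d)) k = pms P f (k - d).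
Proof. by apply: eq_bigr => i _; congr (_ * f _); lia. Qed.

Lemma pms_scale P f c k : pms P (fun j => c * f j) k = c * pms P f k.
Proof. by rewrite mulr_sumr; apply: eq_bigr => i _; rewrite mulrCA. Qed.

Lemma eq_pms P f g : f =1 g -> pms P f =1 pms P g.
Proof. by move=> h k; apply: eq_bigr => i _; rewrite h. Qed.

Lemma pms_low P f N : (forall k, k < N -> f k = 0) -> forall k, k < N -> pms P f k = 0.
Proof. by move=> h k hk; rewrite /poly_mul_series big1 // => i _; rewrite h ?mulr0 //; lia. Qed.

(** The lowest term of a Laurent series survives multiplication by a polynomial
    with constant term 1. *)
Lemma pms_neq0 P f k0 : P`_0 = 1 -> laurent_series f -> f k0 <> 0 -> exists k, pms P f k <> 0.
Proof.
move=> P0 [N hN] fk0; pose S (i : nat) := f (N + i%:Z) != 0.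
have exS : exists i, S i.
  have h : N <= k0 by rewrite leNgt; apply/negP => /hN.
  exists `|k0 - N|%N; rewrite /S; apply/eqP.
  by have -> : N + `|k0 - N|%N%:Z = k0 by lia.
have [i Si mi] := ex_minnP exS; exists (N + i%:Z).
rewrite (@pmsE _ _ _ (size P).+1) // big_ord_recl P0 mul1r big1; first by rewrite subr0 addr0; apply/eqP.
move=> j _; have [h|h] := ltrP (N + i%:Z - (lift ord0 j : nat)%:Z) N; first by rewrite hN ?mulr0.
have [->|ne] := eqVneq (f (N + i%:Z - (lift ord0 j : nat)%:Z)) 0; first by rewrite mulr0.
have li : (lift ord0 j : nat) = j.+1 by [].
have := mi (i - j.+1)%N; rewrite /S.
have -> : N + (i - j.+1)%N%:Z = N + i%:Z - (lift ord0 j : nat)%:Z by rewrite li; rewrite li in h; lia.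
by move=> /(_ ne); rewrite li in h; lia.
Qed.

(** The geometric series of [1 - P]. *)
Lemma inverse_series P : P`_0 = 1 -> exists f, (forall k, k < 0 -> f k = 0) /\
  forall k, pms P f k = (k == 0)%:R.
Proof.
move=> P0; pose S (N : nat) := \sum_(i < N) (1 - P) ^+ i.
have low i k : (k < i)%N -> ((1 - P) ^+ i)`_k = 0.
  have [T eT] : exists T, 1 - P = T * 'X.
    exists (drop_poly 1 (1 - P)); apply/polyP => -[|j]; rewrite coefMX /= ?coefB ?P0 ?coef1 ?subrr //.
    by rewrite coef_drop_poly coefB coef1 addn1.
  by move=> ki; rewrite eT exprMn coefMXn ki.
have stable N k : (k < N)%N -> (S N)`_k = (S k.+1)`_k.
  elim: N => // N IH kN; have [->//|ne] := eqVneq k N.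
  have lt : (k < N)%N by rewrite ltn_neqAle ne.
  by rewrite /S big_ord_recr /= coefD low // addr0 -/(S N) IH.
have inv N : P * S N = 1 - (1 - P) ^+ N.
  by apply: oppr_inj; rewrite opprB subrX1 [1 - P - 1]addrAC subrr sub0r mulNr.
exists (fun k => if k is Posz n then (S n.+1)`_n else 0); split=> [[n|n]//|k].
case: k => n; last first.
  by rewrite (@pms_low _ _ 0) // => -[].
transitivity ((P * S n.+1)`_n); last by rewrite inv coefB coef1 low // subr0 eqz_nat.
rewrite coefM.
rewrite (@pmsE _ _ _ (maxn (size P) n.+1)) ?leq_maxl //.
rewrite (big_ord_widen (maxn (size P) n.+1) (fun i => P`_i * (S n.+1)`_(n - i))) ?leq_maxr //.
rewrite [RHS]big_mkcond /=; apply: eq_bigr => i _; rewrite ltnS; case: leqP => hi.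
  have -> : Posz n - (i : nat)%:Z = Posz (n - i)%N by lia.
  by rewrite (stable n.+1) // ltnS leq_subr.
have [j ->] : exists j, Posz n - (i : nat)%:Z = Negz j by exists (i - n).-1; lia.
by rewrite mulr0.
Qed.

Notation FF := {fraction {poly R}}.
Notation X := (tofrac 'X : FF).

Lemma X_neq0 : X != 0.
Proof. by rewrite tofrac_eq0 polyX_eq0. Qed.
Hint Resolve X_neq0 : core.

(** [f] is the coefficient function of the Laurent polynomial [x]; the
    numerator and the exponent of the denominator are not unique. *)
Definition lval f (x : FF) := exists (N : nat) (p : {poly R}),
  (forall k : int, f k = if 0 <= k + N%:Z then p`_`|(k + N%:Z)%R|%N else 0) /\
  x = tofrac p / X ^+ N.

Lemma lval_raise f x : lval f x -> exists N0 : nat, forall N, (N0 <= N)%N -> exists p : {poly R},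
  (forall k : int, f k = if 0 <= k + N%:Z then p`_`|(k + N%:Z)%R|%N else 0) /\
  x = tofrac p / X ^+ N.
Proof.
move=> [N0 [p [hp ->]]]; exists N0 => N /subnK <-; set j := (N - N0)%N.
exists (p * 'X^j); split; last first.
  by rewrite rmorphM rmorphXn exprD /= -mulrA invfM [X in _ = _ * X]mulrA divff ?mul1r ?expf_neq0.
move=> k; rewrite hp coefMXn; case: (lerP 0 (k + N0%:Z)) => h1.
  have -> : 0 <= k + (j + N0)%N%:Z by lia.
  have -> : (`|(k + (j + N0)%N%:Z)%R| < j)%N = false by lia.
  by congr (nth _ _ _); lia.
case: (lerP 0 (k + (j + N0)%N%:Z)) => h2 //.
by have -> : (`|(k + (j + N0)%N%:Z)%R| < j)%N by lia.
Qed.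

Lemma lval_inj f x y : lval f x -> lval f y -> x = y.
Proof.
move=> /lval_raise[N1 h1] /lval_raise[N2 h2]; pose N := maxn N1 N2.
have [p [hp ->]] := h1 N (leq_maxl _ _); have [r [hr ->]] := h2 N (leq_maxr _ _).
congr (tofrac _ / _); apply/polyP => i.
have := hp (i%:Z - N%:Z); rewrite hr subrK /=.
by [].
Qed.

Lemma lval_ext f g x : f =1 g -> lval f x -> lval g x.
Proof. by move=> e [N [p [hp ->]]]; exists N, p; split=> // k; rewrite -e. Qed.

Lemma lval_add f g x y : lval f x -> lval g y -> lval (fun k => f k + g k) (x + y).
Proof.
move=> /lval_raise[N1 h1] /lval_raise[N2 h2]; pose N := maxn N1 N2.
have [p [hp ->]] := h1 N (leq_maxl _ _); have [r [hr ->]] := h2 N (leq_maxr _ _).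
exists N, (p + r); split; last by rewrite rmorphD mulrDl.
by move=> k; rewrite hp hr coefD; case: ifP; rewrite ?addr0.
Qed.

Lemma lval_scale c f x : lval f x -> lval (fun k => c * f k) (tofrac c%:P * x).
Proof.
move=> [N [p [hp ->]]]; exists N, (c%:P * p); split; last by rewrite rmorphM mulrA.
by move=> k; rewrite hp coefCM; case: ifP; rewrite ?mulr0.
Qed.

Lemma lval_0 : lval (fun=> 0) 0.
Proof. by exists 0%N, 0; split; [move=> k; rewrite coef0 if_same | rewrite rmorph0 mul0r]. Qed.

Lemma lval_sum (I : Type) (s : seq I) (f : I -> int -> R) (x : I -> FF) :
  (forall i, lval (f i) (x i)) -> lval (fun k => \sum_(i <- s) f i k) (\sum_(i <- s) x i).
Proof.
move=> h; elim: s => [|i s IH].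
  by rewrite big_nil; apply: lval_ext lval_0 => k; rewrite big_nil.
by rewrite big_cons; apply: lval_ext (lval_add (h i) IH) => k; rewrite big_cons.
Qed.

Lemma lval_shift f x d : lval f x -> lval (fun k => f (k - d)) (x * X ^ d).
Proof.
move=> /lval_raise[N0 h]; pose N := (N0 + `|d|)%N.
have [p [hp ->]] := h N (leq_addr _ _).
have [M eM] : exists M : nat, M%:Z = N%:Z - d by exists `|N%:Z - d|%N; rewrite /N; lia.
exists M, p; split.
  by move=> k; rewrite hp; have -> : k - d + N%:Z = k + M%:Z by lia.
rewrite -mulrA; congr (_ * _).
by rewrite !exprnN -expfzDr // (_ : - N%:Z + d = - M%:Z) //; lia.
Qed.

Lemma lval_exists f : laurent_poly f -> exists x, lval f x.
Proof.
move=> [N0 h]; pose N := `|N0|%N.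
exists (tofrac (\poly_(i < N + N.+1) f (i%:Z - N%:Z)) / X ^+ N), N, (\poly_(i < N + N.+1) f (i%:Z - N%:Z)).
split=> // k; rewrite coef_poly; case: ifP => hk; last by apply: h; rewrite /N in hk *; lia.
case: ltnP => hi; first by congr f; lia.
by apply: h; rewrite /N in hk hi *; lia.
Qed.

Lemma lval_neq0 f x k : lval f x -> f k <> 0 -> x != 0.
Proof.
move=> [N [p [hp ->]]] fk; apply: mulf_neq0; last by rewrite invr_eq0 expf_neq0.
by rewrite tofrac_eq0; apply/eqP => p0; apply: fk; rewrite hp p0 coef0 if_same.
Qed.

Lemma lval_laurent f x : lval f x -> laurent_poly f.
Proof.
have aux (k : int) (N s : nat) : (N + s)%N%:Z < `|k| -> 0 <= k + N%:Z -> (s <= `|(k + N%:Z)%R|)%N by lia.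
move=> [N [p [hp _]]]; exists (N + size p)%N%:Z => k hk; rewrite hp.
by case: ifP => // h; rewrite nth_default //; apply: aux.
Qed.

Lemma laurent_poly_series f : laurent_poly f -> laurent_series f.
Proof.
have aux (k N : int) : k < - N -> N < `|k| by lia.
by move=> [N h]; exists (- N) => k hk; apply: h; apply: aux.
Qed.

Lemma lval_delta : lval (fun k => (k == 0)%:R) 1.
Proof.
exists 0%N, 1; split; last by rewrite rmorph1 expr0 divr1.
by move=> k; rewrite addr0 coef1; case: k => n //=.
Qed.

Lemma tofrac_poly P : tofrac P = \sum_(i < size P) tofrac (P`_i)%:P * X ^ i :> FF.
Proof.
rewrite -[P in LHS]coefK poly_def rmorph_sum; apply: eq_bigr => i _.
by rewrite -mul_polyC rmorphM rmorphXn.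
Qed.

Lemma lval_pms P f x : lval f x -> lval (pms P f) (tofrac P * x).
Proof.
move=> h; rewrite tofrac_poly mulr_suml.
apply: (@lval_sum _ _ (fun i : 'I_(size P) => fun k => P`_i * f (k - (i : nat)%:Z))) => i.
by rewrite -mulrA [X ^ _ * x]mulrC; apply: lval_scale; apply: lval_shift.
Qed.

Section Dual.
Variable q : nat.
Hypothesis q0 : q%:R != 0 :> R.

(** The action of [P((q X)^-1)] on coefficient functions. *)
Definition pmd P f : int -> R := fun k => \sum_(i < size P) P`_i * q%:R ^- i * f (k + (i : nat)%:Z).

Definition dual_value P : FF := (map_poly (fun c : R => tofrac c%:P) P).[(q%:R * X)^-1].

Lemma subst_dual_pms P f k : subst_dual q (pms P f) k = pmd P (subst_dual q f) k.
Proof.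
rewrite /subst_dual /poly_mul_series mulr_suml; apply: eq_bigr => i _.
rewrite opprD -!mulrA; congr (_ * _); rewrite mulrCA; congr (_ * _).
by rewrite expfzDr // -exprnP mulrCA mulVf ?mulr1 // expf_neq0.
Qed.

Lemma pms_pmd P Q f k : pms P (pmd Q f) k = pmd Q (pms P f) k.
Proof.
rewrite /poly_mul_series /pmd; under eq_bigr do rewrite mulr_sumr.
rewrite exchange_big /=; apply: eq_bigr => i _; rewrite mulr_sumr; apply: eq_bigr => j _.
by rewrite mulrCA; congr (_ * (_ * f _)); lia.
Qed.

Lemma eq_pmd P f g : f =1 g -> pmd P f =1 pmd P g.
Proof. by move=> h k; apply: eq_bigr => i _; rewrite h. Qed.

Lemma dual_value_sum P : dual_value P = \sum_(i < size P) tofrac (P`_i * q%:R ^- i)%:P * X ^ (- (i : nat)%:Z).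
Proof.
rewrite /dual_value /map_poly horner_poly; apply: eq_bigr => i _.
have -> : (q%:R * X)^-1 = tofrac (q%:R^-1)%:P * X^-1.
  have e : tofrac (q%:R^-1)%:P * q%:R = 1 :> FF.
    have -> : (q%:R : FF) = tofrac (q%:R)%:P by rewrite polyC_natr rmorph_nat.
    by rewrite -rmorphM -polyCM mulVf // polyC1 rmorph1.
  have qn : (q%:R : FF) != 0 by apply/eqP => z; move: e; rewrite z mulr0 => /eqP; rewrite eq_sym oner_eq0.
  by rewrite invfM; congr (_ * _); apply: (mulIf qn); rewrite mulVf.
by rewrite exprMn mulrA -exprnN [(X^-1) ^+ _]exprVn; congr (_ * _); rewrite -rmorphXn -rmorphM -polyC_exp -polyCM exprVn.
Qed.

Lemma lval_pmd P f x : lval f x -> lval (pmd P f) (dual_value P * x).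
Proof.
move=> h; rewrite dual_value_sum mulr_suml.
apply: (@lval_sum _ _ (fun i : 'I_(size P) => fun k => P`_i * q%:R ^- i * f (k + (i : nat)%:Z))) => i.
rewrite -mulrA [X ^ _ * x]mulrC; apply: lval_scale.
by apply: lval_ext (lval_shift (- (i : nat)%:Z) h) => k; rewrite opprK.
Qed.

Lemma dual_value_neq0 P : P`_0 = 1 -> dual_value P != 0.
Proof.
move=> P0; have := lval_pmd P lval_delta; rewrite mulr1 => /(@lval_neq0 _ _ 0); apply.
have sP : size P = (size P).-1.+1.
  by rewrite prednK // size_poly_gt0; apply/eqP => z; move/eqP: P0; rewrite z coef0 eq_sym oner_eq0.
rewrite /pmd sP big_ord_recl /= P0 mul1r expr0 invr1 mul1r big1 ?addr0; last first.
  by move=> i _; rewrite /= mulr0.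
by apply/eqP; rewrite oner_eq0.
Qed.

Lemma gammaE (f : factors R) :
  gamma q f = tofrac (eps_coef f)%:P * X ^ eps_deg f * (dual_value (lfac_dual f))^-1 * tofrac (lfac f).
Proof. by rewrite /gamma invrK. Qed.

Lemma cancel_common (E : fieldType) (vd vq s a a' y z x t t' : E) :
  s != 0 -> x != 0 -> vd != 0 -> vq != 0 ->
  vq * (s * (a * (y * x * t))) = vd * (s * (a' * (z * x * t'))) ->
  a * t * vd^-1 * y = a' * t' * vq^-1 * z.
Proof.
move=> s0 x0 vd0 vq0 h; have n0 : vd * vq * s * x != 0 by rewrite !mulf_neq0.
apply: (mulIf n0); transitivity (vq * (s * (a * (y * x * t)))); first by field.
by rewrite h; field.
Qed.

(** Multiply each functional equation by the dual polynomial of the other one: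
    both left-hand sides become equal, and the nonzero Laurent polynomials that
    they involve cancel. *)
Lemma gamma_unique (P Pd Q Qd : {poly R}) (s a a' : R) (d d' : int) (I Id : int -> R) :
  P`_0 = 1 -> Pd`_0 = 1 -> Qd`_0 = 1 -> s != 0 ->
  (forall k, subst_dual q (pms Pd Id) k = s * (a * pms P I (k - d))) ->
  (forall k, subst_dual q (pms Qd Id) k = s * (a' * pms Q I (k - d'))) ->
  laurent_poly (pms P I) -> (exists k, pms P I k <> 0) ->
  gamma q (Factors P Pd a d) = gamma q (Factors Q Qd a' d').
Proof.
move=> P0 Pd0 Qd0 s0 H1 H2 lJ [k0 hk0].
have [x hx] := lval_exists lJ; have x0 := lval_neq0 hx hk0.
set J := pms P I in hx hk0 lJ.
have e k : pmd Qd (fun k => s * (a * pms P J (k - d))) k =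
           pmd Pd (fun k => s * (a' * pms Q J (k - d'))) k.
  transitivity (pms P (pmd Qd (subst_dual q (pms Pd Id))) k).
    rewrite pms_pmd; apply: eq_pmd => k1.
    by rewrite (eq_pms _ H1) pms_scale pms_scale pms_shift.
  transitivity (pms P (pmd Pd (subst_dual q (pms Qd Id))) k).
    apply: eq_pms => k1; rewrite -!subst_dual_pms; rewrite /subst_dual pms_comm //.
  rewrite pms_pmd; apply: eq_pmd => k1.
  by rewrite (eq_pms _ H2) pms_scale pms_scale pms_shift /J pms_comm.
have l1 := lval_pmd Qd (lval_scale s (lval_scale a (lval_shift d (lval_pms P hx)))).
have l2 := lval_pmd Pd (lval_scale s (lval_scale a' (lval_shift d' (lval_pms Q hx)))).
have := lval_inj (lval_ext e l1) l2 => h.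
rewrite !gammaE /=.
have n1 := dual_value_neq0 Pd0; have n2 := dual_value_neq0 Qd0.
have s1 : tofrac s%:P != 0 :> FF by rewrite tofrac_eq0 polyC_eq0.
exact: (cancel_common s1 x0 n1 n2 h).
Qed.
End Dual.

(** A power of the variable is prime to [P], because [P] has constant term 1,
    so it can be cancelled from a Laurent polynomial quotient. *)
Lemma dvdp_of_laurent P Q f : P`_0 = 1 -> (forall k, pms P f k = (k == 0)%:R) ->
  laurent_poly (pms Q f) -> P %| Q.
Proof.
move=> P0 hf /lval_exists[x hx].
have e : tofrac Q = tofrac P * x.
  apply: (@lval_inj (pms Q (fun k => (k == 0)%:R))).
    by rewrite -[tofrac Q]mulr1; apply: lval_pms; exact: lval_delta.
  apply: lval_ext (lval_pms P hx) => k.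
  by rewrite pms_comm; apply: eq_pms.
have [N [p [_ ex]]] := hx.
have e2 : Q * 'X^N = P * p.
  have XN : X ^+ N != 0 by rewrite expf_neq0.
  have inj (a b : {poly R}) : tofrac a = tofrac b -> a = b by move/eqP; rewrite tofrac_eq => /eqP.
  apply: inj; rewrite (tofracM Q) (tofracM P) tofracXn e ex -[LHS]mulrA (divfK XN).
  reflexivity.
have cp : coprimep P 'X^N.
  by apply: coprimep_expr; rewrite coprimepX /root horner_coef0 P0 oner_neq0.
by rewrite -(Gauss_dvdpl _ cp) e2 dvdp_mulr.
Qed.
End LaurentSeries.

(** * Reduction of the integrals *)

Section Lifting.
Variables (p l : nat) (F : local_field) (D : ladic_data l).
Hypotheses (prl : prime l) (resp : res_char F p) (lp : l <> p).
Notation int := (@ld_int l D).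
Notation red := (@ld_red l D).
Notation K := (ld_K D).
Notation k := (ld_k D).
Notation q := (lf_q F).
Notation pms := (@poly_mul_series _).

(** [C] is the domain of integrability, and [S] the set on which the values of
    the integrand matter. *)
Definition compatible (V : Type) (C : (V -> K) -> Prop) (S : V -> Prop)
    (muK : (V -> K) -> K) (muk : (V -> k) -> k) (c : K) :=
  forall phi, C phi -> (forall g, S g -> int (phi g)) ->
    int (c * muK phi) /\ red (c * muK phi) = muk (red \o phi).

Section Integrals.
Variable theta : F -> K.
Hypotheses (sth : smooth_char theta) (nth : nontrivial_char theta).

Lemma RS_eqE (R : fieldType) m mu (W W' : 'M[F]_m -> R) Phi z : RS_eq (erefl m) mu W W' Phi z =
  mu (fun g => if lf_val (\det g) == z then W g * W' g * Phi (Defs.eta F m *m g) else 0).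
Proof. by congr mu; apply/funext => g; rewrite castmx_id. Qed.

Lemma RS_ltE (R : fieldType) sq m j i mu dx (W : 'M[F]_(m + j + i.+1) -> R) W' z :
  RS_lt sq (erefl (m + j + i.+1)%N) mu dx W W' z =
  dx (fun x => mu (lt_integrand W W' z x)) * sq ^ (z * (m + j + i.+1 - m)%N%:Z).
Proof.
by congr (dx _ * _); apply/funext => x; congr mu.
Qed.

(** The coefficients are integrals of integrable functions with integral values,
    built from [W], [W'] and [Phi] by operations that commute with reduction. *)
Lemma RS_eq_reduction m n (e : m = n) muK muk c (W : 'M[F]_n -> K) (W' : 'M[F]_m -> K) Phi :
  (0 < m)%N -> compatible (@Cc_quot F K n) (fun g => g \in unitmx) muK muk c ->
  whit_fun theta W -> whit_fun (char_inv theta) W' ->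
  (forall g, int (W g)) -> (forall g, int (W' g)) -> Cc_mx Phi -> (forall x, int (Phi x)) ->
  forall z, int (c * RS_eq e muK W W' Phi z) /\
    red (c * RS_eq e muK W W' Phi z) = RS_eq e muk (red \o W) (red \o W') (red \o Phi) z.
Proof.
case: n / e W Phi muK muk => W Phi muK muk m0 hc hW hW' iW iW' cPhi iPhi z.
rewrite !RS_eqE; have [|h1 h2] := hc _ (Cc_RS_eq z sth nth m0 hW hW' cPhi).
  by move=> g _; case: eqP => _; [apply: intM => //; exact: intM | exact: int0].
split=> //; rewrite h2; congr muk; apply/funext => g /=; case: eqP => _; last exact: red0.
by rewrite !ld_redM //; exact: intM.
Qed.

(** Here the inner integral has to be reduced first, the result being the
    integrand of the outer one. *)
Lemma RS_lt_reduction sq m j i n (e : (m + j + i.+1)%N = n) muK muk c dK dk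
    (W : 'M[F]_n -> K) (W' : 'M[F]_m -> K) :
  (0 < m)%N -> int sq -> int sq^-1 -> haar_quot muK -> additive_haar dK ->
  compatible (@Cc_quot F K m) (fun g => g \in unitmx) muK muk c ->
  compatible (@Cc_mx F K j m) (fun=> True) dK dk 1 ->
  whit_fun theta W -> whit_fun (char_inv theta) W' ->
  (forall g, int (W g)) -> (forall g, int (W' g)) ->
  forall z, int (c * RS_lt sq e muK dK W W' z) /\
    red (c * RS_lt sq e muK dK W W' z) = RS_lt (red sq) e muk dk (red \o W) (red \o W') z.
Proof.
case: n / e W => W m0 isq isqV hmu hdKa hc hd hW hW' iW iW' z.
rewrite !RS_ltE.
have inner x : int (c * muK (lt_integrand W W' z x)) /\
    red (c * muK (lt_integrand W W' z x)) = muk (lt_integrand (red \o W) (red \o W') z x).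
  have [|h1 h2] := hc _ (Cc_lt_integrand sth nth hW hW' m0 z x).
    by move=> g _; rewrite /lt_integrand; case: eqP => _; [exact: intM | exact: int0].
  split=> //; rewrite h2; congr muk; apply/funext => g; rewrite /lt_integrand /=.
  by case: eqP => _; [rewrite ld_redM | exact: red0].
have cout := Cc_lt_outer sth nth hW hW' m0 z hmu.
have cout' : Cc_mx (fun x => c * muK (lt_integrand W W' z x)).
  have -> : (fun x => c * muK (lt_integrand W W' z x)) = (fun x => c * muK (lt_integrand W W' z x) + 0).
    by apply/funext => x; rewrite addr0.
  by apply: Cc_mx_lin => //; exact: Cc_mx_0.
have ec : c * dK (fun x => muK (lt_integrand W W' z x)) = dK (fun x => c * muK (lt_integrand W W' z x)).
  transitivity (dK (fun x => c * muK (lt_integrand W W' z x) + 0)).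
    by rewrite hdKa.1 ?add_haar_0 ?addr0 //; exact: Cc_mx_0.
  by congr dK; apply/funext => x; rewrite addr0.
have [|h1 h2] := hd _ cout'; first by move=> x _; case: (inner x).
rewrite mul1r in h1 h2; rewrite mulrA ec.
have is_ : int (sq ^ (z * (m + j + i.+1 - m)%N%:Z)) by apply: intXz.
split; first exact: intM.
rewrite ld_redM // h2 redXz //; congr (dk _ * _); apply/funext => x /=.
by have [_ ->] := inner x.
Qed.

(** A Fourier transform is an integral of an integrable function against values
    of [theta], which are integral. *)
Lemma fourier_reduction a b dK dk (Phi : 'M[F]_(a, b) -> K) :
  additive_haar dK -> compatible (@Cc_mx F K a b) (fun=> True) dK dk 1 -> Cc_mx Phi -> (forall x, int (Phi x)) ->
  (forall y, int (fourier theta dK Phi y)) /\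
  red \o fourier theta dK Phi = fourier (red \o theta) dk (red \o Phi).
Proof.
move=> hdK hc cPhi iPhi.
have h y : int (fourier theta dK Phi y) /\ red (fourier theta dK Phi y) = fourier (red \o theta) dk (red \o Phi) y.
  have ith x := int_char prl resp lp sth x.
  have cy := Cc_fourier_integrand sth y cPhi.
  have [|h1 h2] := hc _ cy; first by move=> x _; apply: intM.
  rewrite !mul1r in h1 h2; split=> //; rewrite /fourier h2; congr dk; apply/funext => x /=.
  by rewrite ld_redM.
by split=> [y|]; [case: (h y) | apply/funext => y /=; case: (h y)].
Qed.
End Integrals.

(** Compose with a set-theoretic section of the reduction that fixes 0. *)
Lemma lift_Cc_mx a b (Phi : 'M[F]_(a, b) -> k) : Cc_mx Phi ->
  exists Phi' : 'M[F]_(a, b) -> K, [/\ Cc_mx Phi', forall x, int (Phi' x) & red \o Phi' = Phi].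
Proof.
move=> [[N h1] [M h2]].
have /boolp.choice[s hs] (y : k) : exists x : K, [/\ int x, red x = y & (y = 0 -> x = 0)].
  have [->|y0] := eqVneq y 0; first by exists 0; split; [exact: int0 | exact: red0 |].
  by have [x ix rx] := ld_red_surj y; exists x; split=> // e; move: y0; rewrite e eqxx.
exists (s \o Phi); split=> [|x|].
- split; first by exists N => x y hy /=; rewrite h1.
  by exists M => x /= ne; apply: h2 => e; apply: ne; case: (hs (Phi x)) => _ _; apply.
- by case: (hs (Phi x)).
- by apply/funext => x /=; case: (hs (Phi x)).
Qed.

Lemma lift_scalar (y : k) : exists2 x : K, int x & red x = y.
Proof. by have [x ix rx] := ld_red_surj y; exists x. Qed.

(** * Lifts of Whittaker functions *)
Section Lifts.
Variables (sq : K) (theta : F -> K).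
Hypotheses (sth : smooth_char theta).
Notation thetak := (red \o theta).

Lemma lift_whit n (tau : prerep F K n) (pi : prerep F k n) W' :
  whittaker_lift sq theta tau pi -> whit thetak pi W' ->
  exists W, [/\ whit theta tau W, forall g, int (W g) & red \o W = W'].
Proof.
move=> [_ _ _ [Lam [h1 _ _ h4]]] /h4[W LW ->]; have [h5 h6] := h1 _ LW.
by exists W.
Qed.

Definition bounded (V : Type) (f : V -> K) := exists2 b, b != 0 & forall g, int (b * f g).

(** A Whittaker function is a finite combination of the basis of a lattice that
    consists of integral functions. *)
Lemma whit_bounded n (tau : prerep F K n) (pi : prerep F k n) W :
  whittaker_lift sq theta tau pi -> whit theta tau W -> bounded W.
Proof.
move=> [_ _ _ [Lam [h1 _ [I [b [_ hS hL]]] _]]] /hS[s [c ->]].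
have ib i g : int (b i g).
  have : Lam (b i).
    apply/hL; exists [:: i], (fun=> 1); split; first by move=> _; exact: int1.
    by rewrite big_seq1 scale1r.
  by move=> /h1[].
have [be be0 hbe] := common_denominator prl (map c s).
exists be => // g; rewrite fct_sumE mulr_sumr big_seq; apply: int_sum => i si.
by rewrite -[X in be * X]/(c i * b i g) mulrA; apply: intM => //; apply: hbe; apply: map_f.
Qed.

(** The lattice is one of Whittaker functions for [theta]; the alternating
    signs carry the lifting property over to [theta^-1]. *)
Lemma lift_whit_inv n (tau : prerep F K n) (pi : prerep F k n) W' :
  whittaker_lift sq theta tau pi -> whit (char_inv thetak) pi W' ->
  exists W, [/\ whit (char_inv theta) tau W, forall g, int (W g) & red \o W = W'].
Proof.
move=> hl hW'; have [_ /whittaker_smooth st /whittaker_smooth sp _] := hl.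
have hW1 := whit_signs_inv (smooth_char_red prl resp lp sth) sp hW'.
have [W [h1 h2 h3]] := lift_whit hl hW1.
exists (fun g => W (signs F n *m g)); split=> [|g|]; [exact: whit_signs | exact: h2 |].
apply/funext => g /=; have := congr1 (fun f => f (signs F n *m g)) h3 => /= ->.
by rewrite mulmxA signs_sq mul1mx.
Qed.

Lemma whit_inv_bounded n (tau : prerep F K n) (pi : prerep F k n) W :
  whittaker_lift sq theta tau pi -> whit (char_inv theta) tau W -> bounded W.
Proof.
move=> hl hW; have [_ /whittaker_smooth st _ _] := hl.
have [b b0 hb] := whit_bounded hl (whit_signs_inv sth st hW).
by exists b => // g; have := hb (signs F n *m g); rewrite mulmxA signs_sq mul1mx.
Qed.

Lemma whit_tilde_bounded n (tau : prerep F K n) (pi : prerep F k n) W :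
  whittaker_lift sq theta tau pi -> whit theta (rep_tilde tau) W -> bounded W.
Proof.
move=> hl hW; have [_ /whittaker_smooth st _ _] := hl.
have [W0 hW0 e] := whit_tilde sth st hW.
have [b b0 hb] := whit_inv_bounded hl hW0; exists b => // g.
case: (boolP (g \in unitmx)) => ug; first by rewrite e.
by have [lam [_ _ [v ->]]] := hW; rewrite (negPf ug) mulr0; exact: int0.
Qed.

Lemma whit_tilde_inv_bounded n (tau : prerep F K n) (pi : prerep F k n) W :
  whittaker_lift sq theta tau pi -> whit (char_inv theta) (rep_tilde tau) W -> bounded W.
Proof.
move=> hl hW; have [_ /whittaker_smooth st _ _] := hl.
have [W0 hW0 e] := whit_tilde (smooth_char_inv sth) st hW.
rewrite char_invK in hW0.
have [b b0 hb] := whit_bounded hl hW0; exists b => // g.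
case: (boolP (g \in unitmx)) => ug; first by rewrite e.
by have [lam [_ _ [v ->]]] := hW; rewrite (negPf ug) mulr0; exact: int0.
Qed.

Lemma Cc_mx_bounded a b (Phi : 'M[F]_(a, b) -> K) : Cc_mx Phi -> bounded Phi.
Proof.
move=> [[N h1] [M h2]]; have [s hs] := add_haar_formula F a b N M.
have [hv _] := hs _ Phi h1 h2.
have [be be0 hbe] := common_denominator prl (map Phi s).
exists be => // x; have [->|/eqP ne] := eqVneq (Phi x) 0; first by rewrite mulr0; exact: int0.
by have [y ys ->] := hv x ne; apply: hbe; apply: map_f.
Qed.
End Lifts.

End Lifting.

(** * Fractional ideals *)

Section FractionalIdeals.
Variables (l : nat) (D : ladic_data l).
Hypothesis prl : prime l.
Notation int := (@ld_int l D).
Notation K := (ld_K D).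
Notation pms := (@poly_mul_series _).

Lemma spans_mem (R : fieldType) (A : (ssrint.int -> R) -> Prop) (P : {poly R}) I :
  spans_inv A P -> A I -> laurent_series I /\ laurent_poly (pms P I).
Proof.
move=> hs AI; apply/hs; exists 1%N, (fun=> 1), (fun=> 0), (fun=> I); split=> // z.
by rewrite big_ord1 mul1r subr0.
Qed.

Lemma spans_inverse (R : fieldType) (A : (ssrint.int -> R) -> Prop) (P : {poly R}) :
  P`_0 = 1 -> spans_inv A P -> exists f, [/\ laurent_span A f, forall z, z < 0 -> f z = 0 &
    forall z, pms P f z = (z == 0)%:R].
Proof.
move=> P0 hs; have [f [f0 fP]] := inverse_series P0; exists f; split=> //.
by apply/hs; split; [exists 0 | apply: (lval_laurent (x := 1)); apply: lval_ext (lval_delta R) => z].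
Qed.

Lemma spans_nonzero (R : fieldType) (A : (ssrint.int -> R) -> Prop) (P : {poly R}) :
  P`_0 = 1 -> spans_inv A P -> exists2 I, A I & exists z, I z <> 0.
Proof.
move=> P0 hs; have [f [[N [c [d [I [AI fE]]]]] f0 fP]] := spans_inverse P0 hs.
apply: contrapT => h.
have I0 i z : I i z = 0 by apply: contrapT => ne; apply: h; exists (I i) => //; exists z.
have fz z : f z = 0 by rewrite fE big1 // => i _; rewrite I0 mulr0.
have := fP 0; rewrite eqxx /poly_mul_series big1 => [|i _]; last by rewrite fz mulr0.
by move/eqP; rewrite eq_sym oner_eq0.
Qed.

(** The series [1 / Q] lies in the span, so its denominators are bounded.  For a
    root [x] of [Q], so are those of [1 / (X - x)], whose coefficients are the
    powers of [x^-1] up to a constant; thus [x^-1] is integral by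
    [almost_int], and [Q] is the product of the factors [1 - x^-1 X]. *)
Lemma int_poly_of_bounded (A : (ssrint.int -> K) -> Prop) (Q : {poly K}) :
  Q`_0 = 1 -> spans_inv A Q -> (forall I, A I -> bounded I) -> int_poly Q.
Proof.
move=> Q0 hs hb; have [f [[N [c [d [I [AI fE]]]]] f0 fQ]] := spans_inverse Q0 hs.
have bf : bounded f.
  have /boolp.choice[b hI] (i : 'I_N) : exists b, b != 0 /\ forall z, int (b * I i z).
    by have [b b0 h] := hb _ (AI i); exists b.
  have [be be0 hbe] := common_denominator prl [seq c i / b i | i <- enum 'I_N].
  exists be => // z; rewrite fE mulr_sumr; apply: int_sum => i _.
  have -> : be * (c i * I i (z - d i)) = (be * (c i / b i)) * (b i * I i (z - d i)).
    by have [bi _] := hI i; field.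
  apply: intM; last by case: (hI i).
  by apply: hbe; apply/mapP; exists i; rewrite ?mem_enum.
have bpms (T : {poly K}) : bounded (pms T f).
  have [b b0 hbf] := bf; have [be be0 hbe] := common_denominator prl T.
  exists (be * b); first by rewrite mulf_neq0.
  move=> z; rewrite mulr_sumr; apply: int_sum => i _.
  have -> : be * b * (T`_i * f (z - (i : nat)%:Z)) = (be * T`_i) * (b * f (z - (i : nat)%:Z)) by ring.
  by apply: intM => //; apply: hbe; apply: mem_nth.
have root_int x : root Q x -> int x^-1.
  move=> /factor_theorem[T eQ].
  have x0 : x != 0.
    apply/eqP => e; move/eqP: Q0; rewrite eQ e subr0 coefMX eq_sym oner_eq0 //.
  pose h := pms T f; have [b b0 hbh] := bpms T.
  have eh z : h (z - 1) - x * h z = (z == 0)%:R.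
    have := fQ z; rewrite eQ mulrC pmsM -/h pmsD -[- x%:P]polyCN pmsC mulNr => <-; congr (_ - _).
    by have := pmsMX 1 h z; rewrite mul1r -(polyC1 K) pmsC mul1r => ->.
  have hneg z : z < 0 -> h z = 0 by apply: pms_low.
  have hE (n : nat) : h n%:Z = - (x^-1 * x^-1 ^+ n).
    elim: n => [|n IH].
      have := eh 0; rewrite hneg // sub0r eqxx => e1.
      by apply: (mulfI x0); rewrite expr0 mulr1 mulrN mulfV //; apply: oppr_inj; rewrite opprK e1.
    have := eh n.+1%:Z; have -> : n.+1%:Z - 1 = n%:Z by lia.
    rewrite IH => /eqP; rewrite subr_eq add0r => /eqP e1.
    by apply: (mulfI x0); rewrite -e1 exprS; field.
  apply: (@almost_int _ _ prl (- b * x^-1)); first by rewrite mulf_neq0 ?oppr_eq0 ?invr_eq0.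
  by move=> n; have := hbh n%:Z; rewrite -/h hE mulrN -!mulNr mulrA.
have [r eQ] := closed_field_poly_normal Q.
have rr z : z \in r -> z != 0 /\ int z^-1.
  move=> zr; have rz : root Q z by rewrite eQ rootZ ?root_prod_XsubC // lead_coef_eq0 -size_poly_eq0;
    apply/eqP => s0; move/eqP: Q0; rewrite nth_default ?s0 // eq_sym oner_eq0.
  split; last exact: root_int.
  by apply/eqP => z0; move: rz; rewrite z0 /root horner_coef0 Q0 oner_eq0.
pose T := \prod_(z <- r) (1 - z^-1 *: 'X : {poly K}).
have eT : Q = T.
  have e1 : \prod_(z <- r) ('X - z%:P) = (\prod_(z <- r) (- z)) *: T.
    rewrite /T; elim: r rr {eQ T} => [|z r IH] rr; first by rewrite !big_nil scale1r.
    rewrite !big_cons IH => [|y yr]; last by apply: rr; rewrite inE yr orbT.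
    have [z0 _] := rr z (mem_head _ _).
    have -> : 'X - z%:P = (- z) *: (1 - z^-1 *: 'X).
      by rewrite scalerBr scalerA mulNr mulfV // scaleN1r opprK addrC scaleNr alg_polyC.
    by rewrite -scalerAl -scalerAr scalerA.
  have T0 : T`_0 = 1.
    rewrite -horner_coef0 /T horner_prod big1 // => z _.
    by rewrite hornerD hornerN hornerZ hornerX mulr0 subr0 hornerC.
  have e2 : Q = (lead_coef Q * \prod_(z <- r) (- z)) *: T by rewrite {1}eQ e1 scalerA.
  by move: Q0; rewrite e2 coefZ T0 mulr1 => ->; rewrite scale1r.
move=> i; rewrite eT /T; elim: r rr {eQ eT T} i => [|z r IH] rr i.
  by rewrite big_nil coef1; exact: int_nat.
rewrite big_cons coefM; apply: int_sum => j _; apply: intM.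
  rewrite coefB coef1 coefZ coefX; apply: intB; first exact: int_nat.
  by apply: intM; [case: (rr z (mem_head _ _)) | exact: int_nat].
by apply: IH => y yr; apply: rr; rewrite inE yr orbT.
Qed.
End FractionalIdeals.

(** * Reduction of L-factors and functional equations *)

Section Reduction.
Variables (l : nat) (F : local_field) (D : ladic_data l).
Notation int := (@ld_int l D).
Notation red := (@ld_red l D).
Notation K := (ld_K D).
Notation k := (ld_k D).
Notation q := (lf_q F).
Notation pms := (@poly_mul_series _).

Lemma coef_red (Q : {poly K}) i : (map_poly red Q)`_i = red Q`_i.
Proof. by rewrite coef_map_id0 // red0. Qed.

Lemma red_pms (Q : {poly K}) f z : int_poly Q -> (forall z, int (f z)) ->
  int (pms Q f z) /\ red (pms Q f z) = pms (map_poly red Q) (red \o f) z.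
Proof.
move=> iQ if_; split; first by apply: int_sum => i _; exact: intM.
rewrite red_sum; last by move=> i _; exact: intM.
rewrite (@pmsE _ (map_poly red Q) _ _ (size Q)) ?size_poly //.
by apply: eq_bigr => i _; rewrite ld_redM // coef_red.
Qed.

(** Write [1 / P] as a combination of l-modular series and lift each of them.
    [Q] times the lifted combination is an integral Laurent polynomial, so the
    reduction of [Q] times [1 / P] is one too. *)
Lemma dvdp_of_lifts (AK : (ssrint.int -> K) -> Prop) (Ak : (ssrint.int -> k) -> Prop)
    (Q : {poly K}) (P : {poly k}) :
  spans_inv AK Q -> spans_inv Ak P -> P`_0 = 1 -> int_poly Q ->
  (forall I, Ak I -> exists J c, [/\ AK J, forall z, int (c * J z) & forall z, red (c * J z) = I z]) ->
  P %| map_poly red Q.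
Proof.
move=> sK sk P0 iQ hl; have [f [[N [c [d [I [AI fE]]]]] f0 fP]] := spans_inverse P0 sk.
have /boolp.choice[J /boolp.choice[g hJ]] (i : 'I_N) := hl _ (AI i).
have /boolp.choice[c' hc'] (i : 'I_N) : exists x, int x /\ red x = c i.
  by have [x ix rx] := lift_scalar (c i); exists x.
pose f' z := \sum_i (c' i * g i) * J i (z - d i).
have [_ [B hB]] : laurent_series f' /\ laurent_poly (pms Q f').
  by apply/sK; exists N, (fun i => c' i * g i), d, J; split=> // i; have [] := hJ i.
have term i z : int ((c' i * g i) * J i z) /\ red ((c' i * g i) * J i z) = c i * I i z.
  have [_ h1 h2] := hJ i; have [h3 h4] := hc' i.
  by rewrite -mulrA; split; [exact: intM | rewrite ld_redM // h2 h4].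
have if' z : int (f' z) by apply: int_sum => i _; case: (term i (z - d i)).
have rf' : red \o f' = f.
  apply/funext => z; rewrite /= fE red_sum; last by move=> i _; case: (term i (z - d i)).
  by apply: eq_bigr => i _; case: (term i (z - d i)).
apply: dvdp_of_laurent P0 fP _; exists B => z /hB h.
by have [_] := red_pms z iQ if'; rewrite rf' h red0.
Qed.

Lemma int_inv_of_unit (x : K) : int x -> red x <> 0 -> x != 0 /\ int x^-1.
Proof.
move=> ix /eqP rx; split; last exact: red_unit.
by apply/eqP => e; move: rx; rewrite e red0 eqxx.
Qed.

(** The l-adic functional equation reduces to one between the l-modular series,
    so [gamma_unique] applies.  For it to reduce, [eps_coef h] has to be a unit:
    both sides of the equation have a coefficient that is a unit, because the
    reduced series do not vanish. *)
Lemma gamma_reduction (A B : ssrint.int -> K) (f : factors k) (h : factors K) (s : K) :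
  q%:R != 0 :> k ->
  (forall z, int (A z)) -> (forall z, int (B z)) ->
  int_poly (lfac h) -> int_poly (lfac_dual h) ->
  (lfac h)`_0 = 1 -> (lfac_dual h)`_0 = 1 -> (lfac f)`_0 = 1 -> (lfac_dual f)`_0 = 1 ->
  s ^+ 2 = 1 -> eps_coef f != 0 ->
  (forall z, subst_dual q (pms (lfac_dual h) B) z = s * (eps_coef h * pms (lfac h) A (z - eps_deg h))) ->
  (forall z, subst_dual q (pms (lfac_dual f) (red \o B)) z =
     red s * (eps_coef f * pms (lfac f) (red \o A) (z - eps_deg f))) ->
  laurent_poly (pms (lfac f) (red \o A)) -> (exists z, red (A z) <> 0) -> laurent_series (red \o A) ->
  integral_factors h /\ gamma q f = gamma q (red_factors h).
Proof.
case: f h => [P Pd ak dk] [Q Qd a d] /= qk iA iB iQ iQd Q0 Qd0 P0 Pd0 ss ak0 HK Hk lJ [z0 Az0] lA.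
have is_ : int s.
  apply: (@int_root _ _ _ ('X^2 - 1)).
  - by rewrite -(@polyC1 K); exact: monicXnsubC.
  - by rewrite /root hornerD hornerN hornerXn hornerC ss subrr.
  by move=> i; rewrite coefB coefXn coef1; apply: intB; exact: int_nat.
have s0 : s != 0 by apply/eqP => e; move/eqP: ss; rewrite e expr0n eq_sym oner_eq0.
have isV : int s^-1 by have -> : s^-1 = s by apply: (mulfI s0); rewrite mulfV // -expr2 ss.
have rs0 : red s != 0 by apply: unit_red.
have iqz z : int (q%:R ^ z) by apply: int_qz.
have rqz z : red (q%:R ^ z) != 0 by rewrite red_qz // expfz_neq0.
have qK : q%:R != 0 :> K by apply/eqP => e; move: qk; rewrite -(red_nat D) e red0 eqxx.
have rQ0 : (map_poly red Q)`_0 = 1 by rewrite coef_red Q0 ld_red1.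
have rQd0 : (map_poly red Qd)`_0 = 1 by rewrite coef_red Qd0 ld_red1.
have iQA z := (red_pms z iQ iA).1; have rQA z := (red_pms z iQ iA).2.
have iQB z := (red_pms z iQd iB).1; have rQB z := (red_pms z iQd iB).2.
(* [eps_coef h] is a quotient of an integer by a unit, up to sign: here the
   unit is a coefficient of the right-hand side *)
have [z1 hz1] : exists z, pms (map_poly red Q) (red \o A) z <> 0 by apply: pms_neq0 Az0.
have [n1 i1] : pms Q A z1 != 0 /\ int (pms Q A z1)^-1 by apply: int_inv_of_unit; rewrite ?rQA.
have ia : int a.
  have -> : a = s^-1 * (subst_dual q (pms Qd B) (z1 + d) * (pms Q A z1)^-1).
    by rewrite HK addrK; field; rewrite n1 s0.
  by apply: intM => //; apply: intM => //; apply: intM.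
(* for the inverse, the unit is a coefficient of the left-hand side; the dual
   series does not vanish modulo l by the l-modular functional equation *)
have [z2 hz2] : exists z, pms (map_poly red Qd) (red \o B) z <> 0.
  have [z3 hz3] : exists z, pms P (red \o A) z <> 0 by apply: pms_neq0 Az0.
  have hJd z : pms Pd (red \o B) z = q%:R ^ z * (red s * (ak * pms P (red \o A) (- z - dk))).
    rewrite -Hk /subst_dual opprK mulrC -mulrA -expfzDr // addNr expr0z mulr1 //.
  have lJd : laurent_poly (pms Pd (red \o B)).
    have aux (M' z : ssrint.int) : `|M'| + `|dk| < `|z| -> M' < `|- z - dk| by lia.
    by have [M hM] := lJ; exists (`|M| + `|dk|) => z hz; rewrite hJd hM ?mulr0 //; apply: aux.
  have [|z4 hz4] := @pms_neq0 _ (map_poly red Qd) (pms Pd (red \o B)) (- z3 - dk) rQd0 (laurent_poly_series lJd).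
    have ez : - (- z3 - dk) - dk = z3 by lia.
    rewrite hJd ez => /eqP; rewrite !mulf_eq0 expfz_eq0 (negPf qk) andbF.
    by rewrite (negPf rs0) (negPf ak0) /= => /eqP.
  apply: contrapT => hn; apply: hz4.
  have hn0 z : pms (map_poly red Qd) (red \o B) z = 0 by apply: contrapT => ne; apply: hn; exists z.
  by rewrite pms_comm (eq_pms _ hn0); apply: big1 => i _; rewrite mulr0.
have [n2 i2] : pms Qd B z2 != 0 /\ int (pms Qd B z2)^-1 by apply: int_inv_of_unit; rewrite ?rQB.
have e2 : pms Qd B z2 = q%:R ^ z2 * (s * (a * pms Q A (- z2 - d))).
  by rewrite -HK /subst_dual opprK mulrC -mulrA -expfzDr // addNr expr0z mulr1.
have a0 : a != 0 by apply/eqP => e; move: n2; rewrite e2 e mul0r !mulr0 eqxx.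
have iaV : int a^-1.
  have -> : a^-1 = q%:R ^ z2 * (s * pms Q A (- z2 - d)) * (pms Qd B z2)^-1.
    have n3 : q%:R ^ z2 * (s * (a * pms Q A (- z2 - d))) != 0 by rewrite -e2.
    rewrite e2; field; rewrite a0 s0 expfz_neq0 //=.
    by move: n3; rewrite !mulf_eq0 !negb_or => /and4P[_ _ _ ->].
  by apply: intM => //; apply: intM => //; apply: intM.
split; first by split=> //; apply/eqP.
apply: (gamma_unique qk P0 Pd0 rQd0 rs0 Hk _ lJ); last by apply: pms_neq0 Az0.
move=> z; transitivity (red (subst_dual q (pms Qd B) z)).
  by rewrite /subst_dual ld_redM // rQB red_qz.
by rewrite HK !ld_redM ?rQA //; exact: intM.
Qed.
End Reduction.

(** * Factors of Whittaker lifts *)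

Section Comparison.
Variables (p l : nat) (F : local_field) (D : ladic_data l).
Hypotheses (prl : prime l) (resp : res_char F p) (lp : l <> p).
Notation int := (@ld_int l D).
Notation red := (@ld_red l D).
Notation K := (ld_K D).
Notation k := (ld_k D).
Notation q := (lf_q F).
Notation pms := (@poly_mul_series _).

Lemma whit_fun_scale (R : fieldType) (theta : F -> R) n (W : 'M[F]_n -> R) b :
  whit_fun theta W -> whit_fun theta (fun g => b * W g).
Proof.
move=> [eW [N N0 lW]]; split; first by move=> u g hu ug; rewrite eW // mulrCA.
by exists N => // g x ug cx; rewrite lW.
Qed.

Lemma Cc_mx_scale (R : fieldType) a b (Phi : 'M[F]_(a, b) -> R) c : Cc_mx Phi -> Cc_mx (fun x => c * Phi x).
Proof.
move=> [[N h1] [M h2]]; split; first by exists N => x y hy; rewrite h1.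
by exists M => x ne; apply: h2 => e; apply: ne; rewrite e mulr0.
Qed.

Section Uniqueness.
Variables (R : fieldType) (theta : F -> R).
Hypotheses (sth : smooth_char theta) (nth : nontrivial_char theta).

(** Two self-dual measures agree on the unit box of matrices. *)
Lemma selfdual_unique a b sqR (dx dx' : ('M[F]_(a, b) -> R) -> R) : q%:R != 0 :> R ->
  haar_selfdual sqR theta dx -> haar_selfdual sqR theta dx' -> forall Phi, Cc_mx Phi -> dx' Phi = dx Phi.
Proof.
move=> q0 h h' Phi [[N h1] [M h2]]; have [s hs] := add_haar_formula F a b N M.
have [_ hd] := hs _ Phi h1 h2; have ad := selfdual_additive h; have ad' := selfdual_additive h'.
rewrite (hd dx) // (hd dx') // (box_volume ad N q0) (box_volume ad' N q0).
have [c cc] := conductor_exists sth nth.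
have [_ _ _ /(_ _ cc) v] := h; have [_ _ _ /(_ _ cc) v'] := h'.
by rewrite -[dx' (box _ 0)]/(dx' (fun x => _)) v' -[dx (box _ 0)]/(dx (fun x => _)) v.
Qed.

Variables (m n : nat) (W : 'M[F]_n -> R) (W' : 'M[F]_m -> R).
Hypotheses (hW : whit_fun theta W) (hW' : whit_fun (char_inv theta) W') (m0 : (0 < m)%N).

Lemma RS_eq_scale (e : m = n) mu mu' c Phi z : (forall phi, Cc_quot phi -> mu' phi = c * mu phi) ->
  Cc_mx Phi -> RS_eq e mu' W W' Phi z = c * RS_eq e mu W W' Phi z.
Proof using hW hW' m0 sth nth.
move: mu mu' Phi hW; case: n / e W => V mu mu' Phi hV h cPhi.
by rewrite !RS_eqE h //; apply: (Cc_RS_eq z sth nth m0 hV hW' cPhi).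
Qed.

Lemma RS_eq_nonzero (e : m = n) mu Phi z : haar_quot mu ->
  RS_eq e mu W W' Phi z <> 0 -> exists2 g, g \in unitmx & W' g <> 0.
Proof using Type.
move: mu Phi; case: n / e W => V mu Phi hmu ne; apply: contrapT => h; apply: ne.
rewrite RS_eqE -[RHS](haar_0 hmu); apply/esym; apply: haar_ext => //; first exact: Cc_0.
move=> g ug; case: eqP => // _; suff -> : W' g = 0 by rewrite mulr0 mul0r.
by apply: contrapT => ne; apply: h; exists g.
Qed.

Lemma RS_lt_scale sqR j i (e : (m + j + i.+1)%N = n) mu mu' c dx dx' z : haar_quot mu -> q%:R != 0 :> R ->
  (forall phi, Cc_quot phi -> mu' phi = c * mu phi) ->
  haar_selfdual sqR theta dx -> haar_selfdual sqR theta dx' ->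
  RS_lt sqR e mu' dx' W W' z = c * RS_lt sqR e mu dx W W' z.
Proof using hW hW' m0 sth nth.
move: hW; case: n / e W => V hV hmu q0 h hd hd'; rewrite !RS_ltE mulrA; congr (_ * _).
have cout := Cc_lt_outer sth nth hV hW' m0 z hmu; have ad := selfdual_additive hd.
transitivity (dx (fun x => c * mu (lt_integrand V W' z x) + 0)); last first.
  by rewrite ad.1 ?add_haar_0 ?addr0 //; exact: Cc_mx_0.
have e1 : (fun x => mu' (lt_integrand V W' z x)) = (fun x => c * mu (lt_integrand V W' z x) + 0).
  by apply/funext => x; rewrite addr0 h //; exact: (Cc_lt_integrand sth nth hV hW' m0 z x).
rewrite e1; apply: (selfdual_unique q0 hd hd').
by apply: Cc_mx_lin => //; exact: Cc_mx_0.
Qed.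

Lemma RS_lt_nonzero sqR j i (e : (m + j + i.+1)%N = n) mu dx z : haar_quot mu -> additive_haar dx ->
  RS_lt sqR e mu dx W W' z <> 0 -> exists2 g, g \in unitmx & W' g <> 0.
Proof using Type.
case: n / e W => V hmu hdx ne; apply: contrapT => h; apply: ne.
rewrite RS_ltE; suff -> : (fun x => mu (lt_integrand V W' z x)) = (fun=> 0) by rewrite add_haar_0 ?mul0r.
apply/funext => x; rewrite -[RHS](haar_0 hmu); apply/esym; apply: haar_ext => //; first exact: Cc_0.
move=> g ug; rewrite /lt_integrand; case: eqP => // _; suff -> : W' g = 0 by rewrite mulr0.
by apply: contrapT => ne; apply: h; exists g.
Qed.
End Uniqueness.

Lemma qK_neq0 : q%:R != 0 :> k -> q%:R != 0 :> K.
Proof. by move=> qk; apply/eqP => e; move: qk; rewrite -(red_nat D) e red0 eqxx. Qed.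

Section Theta.
Variables (theta : F -> K).
Hypotheses (sth : smooth_char theta) (nth : nontrivial_char theta).

Lemma RS_eq_bounded m n (e : m = n) muK muk c (W : 'M[F]_n -> K) (W' : 'M[F]_m -> K) Phi :
  (0 < m)%N -> c != 0 -> haar_quot muK ->
  compatible (@Cc_quot F K n) (fun g => g \in unitmx) muK muk c ->
  whit_fun theta W -> whit_fun (char_inv theta) W' -> Cc_mx Phi ->
  bounded W -> bounded W' -> bounded (RS_eq e muK W W' Phi).
Proof.
move=> m0 c0 hmu hc hW hW' cPhi [b b0 hb] [b' b'0 hb'].
have [b2 b20 hb2] := Cc_mx_bounded prl cPhi.
exists (c * (b * b' * b2)); first by rewrite !mulf_neq0.
move=> z.
have [] := RS_eq_reduction sth nth e m0 hc (whit_fun_scale b hW) (whit_fun_scale b' hW') hb hb'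
  (Cc_mx_scale b2 cPhi) hb2 z.
rewrite -mulrA; suff -> : RS_eq e muK (fun g => b * W g) (fun g => b' * W' g) (fun x => b2 * Phi x) z =
  b * b' * b2 * RS_eq e muK W W' Phi z by [].
case: n / e W Phi muK muk hmu hc hW hb cPhi hb2 => W Phi muK muk hmu hc hW hb cPhi hb2.
rewrite !RS_eqE -(haar_scale hmu); last by apply: (Cc_RS_eq z sth nth m0 hW hW' cPhi).
by congr muK; apply/funext => g; case: eqP => _; [ring | rewrite mulr0].
Qed.

Lemma RS_lt_bounded sq m j i n (e : (m + j + i.+1)%N = n) muK muk c dK dk
    (W : 'M[F]_n -> K) (W' : 'M[F]_m -> K) :
  (0 < m)%N -> int sq -> int sq^-1 -> c != 0 -> haar_quot muK -> haar_selfdual sq theta dK ->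
  compatible (@Cc_quot F K m) (fun g => g \in unitmx) muK muk c ->
  compatible (@Cc_mx F K j m) (fun=> True) dK dk 1 ->
  whit_fun theta W -> whit_fun (char_inv theta) W' ->
  bounded W -> bounded W' -> bounded (RS_lt sq e muK dK W W').
Proof.
move=> m0 isq isqV c0 hmu hd hc hcd hW hW' [b b0 hb] [b' b'0 hb'].
exists (c * (b * b')); first by rewrite !mulf_neq0.
move=> z.
have [] := RS_lt_reduction sth nth e m0 isq isqV hmu (selfdual_additive hd) hc hcd (whit_fun_scale b hW) (whit_fun_scale b' hW') hb hb' z.
rewrite -mulrA; suff -> : RS_lt sq e muK dK (fun g => b * W g) (fun g => b' * W' g) z =
  b * b' * RS_lt sq e muK dK W W' z by [].
case: n / e W hW hb => W hW hb.
rewrite !RS_ltE mulrA; congr (_ * _); have ad := selfdual_additive hd.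
have cout := Cc_lt_outer sth nth hW hW' m0 z hmu.
transitivity (dK (fun x => b * b' * muK (lt_integrand W W' z x) + 0)); last first.
  by rewrite ad.1 ?add_haar_0 ?addr0 //; exact: Cc_mx_0.
congr dK; apply/funext => x; rewrite addr0 -(haar_scale hmu); last exact: (Cc_lt_integrand sth nth hW hW' m0 z x).
by congr muK; apply/funext => g; rewrite /lt_integrand; case: eqP => _; [ring | rewrite mulr0].
Qed.
End Theta.

Variables (sq : K) (theta : F -> K).
Hypotheses (sqE : sq ^+ 2 = q%:R) (sth : smooth_char theta) (nth : nontrivial_char theta).
Notation thetak := (red \o theta).

Lemma rank_cases m n : (m <= n)%N -> m = n \/ exists i, (m + 0 + i.+1)%N = n.
Proof.
rewrite leq_eqVlt => /orP[/eqP|h]; [by left | right; exists (n - m).-1; lia].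
Qed.

Lemma Lfactor_q_neq0 (R : fieldType) (sqR : R) (th : F -> R) n m (pi : prerep F R n) (pi' : prerep F R m) P :
  (0 < m)%N -> (m <= n)%N -> is_Lfactor_le sqR th pi pi' P -> q%:R != 0 :> R.
Proof.
move=> m0 mn [_ h1 h2]; case: (rank_cases mn) => [e|[i e]].
  by have [mu hmu _] := h1 e; apply: haar_q_neq0 hmu; rewrite -e.
by have [mu [dx [hmu _] _]] := h2 0%N i e; apply: haar_q_neq0 hmu.
Qed.

Lemma add_haar_compatible a b dK dk : q%:R != 0 :> k ->
  haar_selfdual sq theta dK -> haar_selfdual (red sq) thetak dk ->
  compatible (@Cc_mx F K a b) (fun=> True) dK dk 1.
Proof.
move=> qk hK hk Phi cPhi iPhi; rewrite mul1r.
by apply: (add_haar_reduction prl resp lp sth nth sqE qk hK hk cPhi) => x; apply: iPhi.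
Qed.

(** The l-modular factor enters through the existence of an l-modular invariant
    integral, which makes q a unit. *)
Lemma Lfactor_integral n m (tau : prerep F K n) (tau' : prerep F K m) (pi : prerep F k n)
    (pi' : prerep F k m) (P : {poly k}) (Q : {poly K}) :
  (0 < m)%N -> (m <= n)%N -> smooth_rep tau -> smooth_rep tau' ->
  (forall W, whit theta tau W -> bounded W) -> (forall W, whit (char_inv theta) tau' W -> bounded W) ->
  is_Lfactor_le (red sq) thetak pi pi' P -> is_Lfactor_le sq theta tau tau' Q -> int_poly Q.
Proof.
move=> m0 mn st st' hb hb' hk [Q0 K1 K2]; have qk := Lfactor_q_neq0 m0 mn hk.
have qK := qK_neq0 qk; have [isq isqV] := int_sqrt_q sqE qk.
have [_ k1 k2] := hk; case: (rank_cases mn) => [e|[i e]].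
  have [muK hK sK] := K1 e; have [muk hk' _] := k1 e.
  have [c c0 hc] := haar_reduction qk qK hK hk'.
  apply: (int_poly_of_bounded prl Q0 sK) => _ [W [W' [Phi [hW hW' cPhi ->]]]].
  exact: (RS_eq_bounded sth nth e m0 c0 hK hc (whit_whit_fun st hW) (whit_whit_fun st' hW') cPhi (hb _ hW) (hb' _ hW')).
have [muK [dK [hK hdK] sK]] := K2 0%N i e; have [muk [dk [hk' hdk] _]] := k2 0%N i e.
have [c c0 hc] := haar_reduction qk qK hK hk'.
have hd := add_haar_compatible qk hdK hdk.
apply: (int_poly_of_bounded prl Q0 sK) => _ [W [W' [hW hW' ->]]].
exact: (RS_lt_bounded sth nth e m0 isq isqV c0 hK hdK hc hd (whit_whit_fun st hW) (whit_whit_fun st' hW') (hb _ hW) (hb' _ hW')).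
Qed.

Section Lifted.
Variables (n m : nat) (tau : prerep F K n) (tau' : prerep F K m) (pi : prerep F k n) (pi' : prerep F k m).
Hypotheses (lift : whittaker_lift sq theta tau pi) (lift' : whittaker_lift sq theta tau' pi').
Hypothesis mn : (m <= n)%N.

Let st : smooth_rep tau. Proof. by case: lift => _ /whittaker_smooth. Qed.
Let st' : smooth_rep tau'. Proof. by case: lift' => _ /whittaker_smooth. Qed.
Let sp : smooth_rep pi. Proof. by case: lift => _ _ /whittaker_smooth. Qed.
Let sp' : smooth_rep pi'. Proof. by case: lift' => _ _ /whittaker_smooth. Qed.
Let m0 : (0 < m)%N. Proof. by case: lift' => _ /whittaker_gt0. Qed.

Lemma Lfactor_lift_integral P Q :
  is_Lfactor_le (red sq) thetak pi pi' P -> is_Lfactor_le sq theta tau tau' Q -> int_poly Q.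
Proof.
apply: Lfactor_integral => // W hW; first exact: (whit_bounded prl lift hW).
exact: (whit_inv_bounded prl sth lift' hW).
Qed.

Lemma Lfactor_tilde_integral P Q :
  is_Lfactor_le (red sq) thetak (rep_tilde pi) (rep_tilde pi') P ->
  is_Lfactor_le sq theta (rep_tilde tau) (rep_tilde tau') Q -> int_poly Q.
Proof.
apply: Lfactor_integral => //; try exact: smooth_tilde.
  by move=> W hW; exact: (whit_tilde_bounded prl sth lift hW).
by move=> W hW; exact: (whit_tilde_inv_bounded prl sth lift' hW).
Qed.

(** Whittaker functions and Schwartz functions lift, hence so does every series
    of the l-modular ideal. *)
Lemma Lfactor_divides P Q :
  is_Lfactor_le (red sq) thetak pi pi' P -> is_Lfactor_le sq theta tau tau' Q ->
  P %| map_poly red Q.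
Proof.
move=> hk hK; have iQ := Lfactor_lift_integral hk hK.
have qk := Lfactor_q_neq0 m0 mn hk; have qK := qK_neq0 qk; have [isq isqV] := int_sqrt_q sqE qk.
have [P0 k1 k2] := hk; have [Q0 K1 K2] := hK; case: (rank_cases mn) => [e|[i e]].
  have [muK hmK sK] := K1 e; have [muk hmk sk] := k1 e.
  have [c c0 hc] := haar_reduction qk qK hmK hmk.
  apply: (dvdp_of_lifts sK sk P0 iQ) => _ [W [W' [Phi [hW hW' cPhi ->]]]].
  have [V [hV iV rV]] := lift_whit lift hW.
  have [V' [hV' iV' rV']] := lift_whit_inv prl resp lp sth lift' hW'.
  have [Psi [cPsi iPsi rPsi]] := lift_Cc_mx cPhi.
  exists (RS_eq e muK V V' Psi), c; split; first by exists V, V', Psi.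
    by move=> z; case: (RS_eq_reduction sth nth e m0 hc (whit_whit_fun st hV) (whit_whit_fun st' hV') iV iV' cPsi iPsi z).
  move=> z; rewrite -rV -rV' -rPsi.
  by case: (RS_eq_reduction sth nth e m0 hc (whit_whit_fun st hV) (whit_whit_fun st' hV') iV iV' cPsi iPsi z).
have [muK [dK [hmK hdK] sK]] := K2 0%N i e; have [muk [dk [hmk hdk] sk]] := k2 0%N i e.
have [c c0 hc] := haar_reduction qk qK hmK hmk; have hd := add_haar_compatible qk hdK hdk.
apply: (dvdp_of_lifts sK sk P0 iQ) => _ [W [W' [hW hW' ->]]].
have [V [hV iV rV]] := lift_whit lift hW.
have [V' [hV' iV' rV']] := lift_whit_inv prl resp lp sth lift' hW'.
have h z := RS_lt_reduction sth nth e m0 isq isqV hmK (selfdual_additive hdK) hc hd (whit_whit_fun st hV) (whit_whit_fun st' hV') iV iV' z.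
exists (RS_lt sq e muK dK V V'), c; split; first by exists V, V'.
  by move=> z; case: (h z).
by move=> z; rewrite -rV -rV'; case: (h z).
Qed.

(** The values of the central characters at -1 are read on a pair of functions
    [W], [W'] of which one reduces to the other. *)
Lemma central_sign (cK : F -> K) (ck : F -> k) W W' (N : nat) g :
  is_central_char tau' cK -> is_central_char pi' ck ->
  whit (char_inv theta) tau' W -> whit (char_inv thetak) pi' W' ->
  (forall h, int (W h)) -> red \o W = W' -> g \in unitmx -> W' g <> 0 ->
  (cK (-1) ^+ N) ^+ 2 = 1 /\ red (cK (-1) ^+ N) = ck (-1) ^+ N.
Proof.
move=> hK hk hW hW' iW rW ug neW.
have n1 : (-1 : F) != 0 by rewrite oppr_eq0 oner_neq0.
have u1 : ((-1)%:M : 'M[F]_m) \in unitmx by rewrite unitmxE det_scalar unitrX // unitrN1.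
have act1 (R : fieldType) (th : F -> R) (r : prerep F R m) c V h : smooth_rep r -> is_central_char r c ->
    whit th r V -> h \in unitmx -> V ((-1)%:M *m h) = c (-1) * V h.
  move=> [_ _ h3 _] hc [lam [[slam _] _ [v ->]]] uh; rewrite unitmx_mul u1 uh /= h3 // hc //.
  have := slam (c (-1)) (act h v) 0; rewrite addr0 => ->.
  by have := slam (-1) 0 0; rewrite scaler0 addr0 => e; rewrite -[X in _ + X]/(lam 0) e mulN1r addNr addr0.
have eK h := @act1 K _ _ cK W h st' hK hW; have ek := @act1 k _ _ ck W' g sp' hk hW' ug.
have W0 : W g != 0 by apply/eqP => e; apply: neW; rewrite -rW /= e red0.
have c2 : cK (-1) ^+ 2 = 1.
  apply: (mulIf W0); rewrite mul1r expr2 -mulrA -eK // -eK ?unitmx_mul ?u1 //.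
  by rewrite mulmxA -scalar_mxM mulrNN mulr1 mul1mx.
have ic : int (cK (-1)).
  apply: (@int_root _ _ _ ('X^2 - 1)).
  - by rewrite -(@polyC1 K); exact: monicXnsubC.
  - by rewrite /root hornerD hornerN hornerXn hornerC c2 subrr.
  by move=> i; rewrite coefB coefXn coef1; apply: intB; exact: int_nat.
split; first by rewrite exprAC c2 expr1n.
rewrite redX //; congr (_ ^+ _).
have neW' : W' g != 0 by apply/eqP.
by apply: (mulIf neW'); rewrite -ek -rW /= eK // ld_redM.
Qed.

(** The part of the argument that is common to the integrals for [m = n] and
    [m < n].  [A] and [B] are the two sides of the l-adic functional equation,
    and [IL] is the l-modular series for the measure that occurs in the
    definition of the L-factor, which may differ by a scalar [s] from the one
    in the functional equation. *)
Lemma gamma_of_series (f : factors k) (h : factors K) (cK : F -> K) (ck : F -> k) N V' W' g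
    (A B : ssrint.int -> K) (Ik Bk IL : ssrint.int -> k) c s z0 :
  q%:R != 0 :> k -> int_poly (lfac h) -> int_poly (lfac_dual h) ->
  (lfac h)`_0 = 1 -> (lfac_dual h)`_0 = 1 -> (lfac f)`_0 = 1 -> (lfac_dual f)`_0 = 1 -> eps_coef f != 0 ->
  is_central_char tau' cK -> is_central_char pi' ck ->
  whit (char_inv theta) tau' V' -> whit (char_inv thetak) pi' W' ->
  (forall h, int (V' h)) -> red \o V' = W' -> g \in unitmx -> W' g <> 0 ->
  (forall z, int (c * A z) /\ red (c * A z) = Ik z) -> (forall z, int (c * B z) /\ red (c * B z) = Bk z) ->
  (forall z, subst_dual q (pms (lfac_dual h) B) z =
     cK (-1) ^+ N * (eps_coef h * pms (lfac h) A (z - eps_deg h))) ->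
  (forall z, subst_dual q (pms (lfac_dual f) Bk) z =
     ck (-1) ^+ N * (eps_coef f * pms (lfac f) Ik (z - eps_deg f))) ->
  s != 0 -> (forall z, Ik z = s * IL z) -> laurent_series IL /\ laurent_poly (pms (lfac f) IL) -> IL z0 <> 0 ->
  integral_factors h /\ gamma q f = gamma q (red_factors h).
Proof.
move=> qk iQ iQd Q0 Qd0 P0 Pd0 ak0 hcK hck hV' hW' iV' rV' ug neW hA hB HK Hk s0 hs [[M lIL] [M' lJ]] hz0.
have [sq1 rs] := central_sign N hcK hck hV' hW' iV' rV' ug neW.
have eA : (red \o (fun z => c * A z)) = Ik by apply/funext => z; case: (hA z).
have eB : (red \o (fun z => c * B z)) = Bk by apply/funext => z; case: (hB z).
apply: (@gamma_reduction l F D (fun z => c * A z) (fun z => c * B z) f h (cK (-1) ^+ N)) => //.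
- by move=> z; case: (hA z).
- by move=> z; case: (hB z).
- by move=> z; rewrite /subst_dual !pms_scale -mulrA -[X in c * X]/(subst_dual q _ z) HK; ring.
- by move=> z; rewrite eB eA Hk rs.
- by exists M' => z hz; rewrite eA (eq_pms _ hs) pms_scale lJ ?mulr0.
- exists z0; case: (hA z0) => _ ->; rewrite hs => /eqP; rewrite mulf_eq0 (negPf s0) /=.
  by move/eqP.
- by exists M => z hz; rewrite eA hs lIL ?mulr0.
Qed.

(** The ideal generated by [L(X, pi, pi')] is nonzero, so some l-modular
    integral is; the functions that define it are lifted. *)
Lemma gamma_lift_le (f : factors k) (h : factors K) :
  is_Lfactor_le (red sq) thetak pi pi' (lfac f) -> is_Lfactor_le sq theta tau tau' (lfac h) ->
  is_Lfactor_le (red sq) thetak (rep_tilde pi) (rep_tilde pi') (lfac_dual f) ->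
  is_Lfactor_le sq theta (rep_tilde tau) (rep_tilde tau') (lfac_dual h) ->
  is_epsilon_le (red sq) thetak pi pi' (lfac f) (lfac_dual f) (eps_coef f) (eps_deg f) ->
  is_epsilon_le sq theta tau tau' (lfac h) (lfac_dual h) (eps_coef h) (eps_deg h) ->
  integral_factors h /\ gamma q f = gamma q (red_factors h).
Proof.
move=> hk hK hkd hKd [ck [ak0 cck ek1 ek2]] [cK [aK0 ccK eK1 eK2]].
have iQ := Lfactor_lift_integral hk hK; have iQd := Lfactor_tilde_integral hkd hKd.
have qk := Lfactor_q_neq0 m0 mn hk; have qK := qK_neq0 qk; have [isq isqV] := int_sqrt_q sqE qk.
have [Pd0 _ _] := hkd; have [Qd0 _ _] := hKd; have [Q0 _ _] := hK; have [P0 k1 k2] := hk.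
have sthV := smooth_char_inv sth; have nthV := nontrivial_char_inv nth.
have thV : red \o char_inv theta = char_inv thetak by rewrite (char_inv_red prl resp lp sth).
have sthk := smooth_char_red prl resp lp sth.
have nthk : nontrivial_char thetak.
  by case: nth => x hx; exists x => /(red_char_eq1 prl resp lp sth).
case: (rank_cases mn) => [e|[i e]].
  have [muL hmuL sL] := k1 e.
  have [muK [dK [hmK hdK] HK]] := eK1 e; have [muk [dk [hmk hdk] Hk]] := ek1 e.
  have [c c0 hc] := haar_reduction qk qK hmK hmk.
  have hd := add_haar_compatible qk hdK hdk; have aK := selfdual_additive hdK.
  have [_ [W [W' [Phi [hW hW' cPhi ->]]]] [z0 hz0]] := spans_nonzero P0 sL.
  have [V [hV iV rV]] := lift_whit lift hW.
  have [V' [hV' iV' rV']] := lift_whit_inv prl resp lp sth lift' hW'.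
  have [Psi [cPsi iPsi rPsi]] := lift_Cc_mx cPhi.
  have fV := whit_whit_fun st hV; have fV' := whit_whit_fun st' hV'.
  have fW := whit_whit_fun sp hW; have fW' := whit_whit_fun sp' hW'.
  have fVt := whit_fun_tilde sth fV; have fVt' := whit_fun_tilde sthV fV'.
  have red1 := RS_eq_reduction sth nth e m0 hc fV fV' iV iV' cPsi iPsi.
  have [ifou rfou] := fourier_reduction prl resp lp sth aK hd cPsi iPsi.
  have red2 := RS_eq_reduction sthV nthV e m0 hc fVt fVt' (fun g => iV _) (fun g => iV' _)
    (Cc_fourier sth nth aK cPsi) ifou.
  have [s s0 hs] := haar_unique hmuL hmk qk.
  have [g ug neg] := RS_eq_nonzero hmuL hz0.
  have [hL1 hL2] := spans_mem sL (ex_intro _ W (ex_intro _ W' (ex_intro _ Phi (And4 hW hW' cPhi erefl)))).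
  apply: (@gamma_of_series f h cK ck m.-1 V' W' g (RS_eq e muK V V' Psi)
    (RS_eq e muK (W_tilde V) (W_tilde V') (fourier theta dK Psi)) (RS_eq e muk W W' Phi)
    (RS_eq e muk (W_tilde W) (W_tilde W') (fourier thetak dk Phi)) (RS_eq e muL W W' Phi) c s z0) => //.
  - by move=> z; rewrite -rV -rV' -rPsi; exact: red1.
  - by move=> z; have := red2 z; rewrite rfou rPsi -rV -rV'.
  - by move=> z; apply: HK.
  - by move=> z; apply: Hk.
  - by move=> z; apply: (RS_eq_scale sthk nthk fW fW' m0 e z hs cPhi).
have [muL [dL [hmuL hdL] sL]] := k2 0%N i e.
have e' : (m + i + 0.+1)%N = n by rewrite -e addn0 addn1 addnS.
have [muK [dK [dK' [hmK hdK hdK'] HK]]] := eK2 0%N i e e'.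
have [muk [dk [dk' [hmk hdk hdk'] Hk]]] := ek2 0%N i e e'.
have [c c0 hc] := haar_reduction qk qK hmK hmk.
have hd := add_haar_compatible qk hdK hdk; have hd' := add_haar_compatible qk hdK' hdk'.
have [_ [W [W' [hW hW' ->]]] [z0 hz0]] := spans_nonzero P0 sL.
have [V [hV iV rV]] := lift_whit lift hW.
have [V' [hV' iV' rV']] := lift_whit_inv prl resp lp sth lift' hW'.
have fV := whit_whit_fun st hV; have fV' := whit_whit_fun st' hV'.
have fW := whit_whit_fun sp hW; have fW' := whit_whit_fun sp' hW'.
have fVt := whit_fun_rho m (whit_fun_tilde sth fV); have fVt' := whit_fun_tilde sthV fV'.
have red1 := RS_lt_reduction sth nth e m0 isq isqV hmK (selfdual_additive hdK) hc hd fV fV' iV iV'.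
have red2 := RS_lt_reduction sthV nthV e' m0 isq isqV hmK (selfdual_additive hdK') hc hd' fVt fVt' (fun g => iV _) (fun g => iV' _).
have [s s0 hs] := haar_unique hmuL hmk qk.
have [g ug neg] := RS_lt_nonzero hmuL (selfdual_additive hdL) hz0.
have [hL1 hL2] := spans_mem sL (ex_intro _ W (ex_intro _ W' (And3 hW hW' erefl))).
apply: (@gamma_of_series f h cK ck m.-1 V' W' g (RS_lt sq e muK dK V V')
    (RS_lt sq e' muK dK' (rho_w m (W_tilde V)) (W_tilde V')) (RS_lt (red sq) e muk dk W W')
    (RS_lt (red sq) e' muk dk' (rho_w m (W_tilde W)) (W_tilde W')) (RS_lt (red sq) e muL dL W W') c s z0) => //.
- by move=> z; rewrite -rV -rV'; exact: red1.
- by move=> z; have := red2 z; rewrite -rV -rV'.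
- by move=> z; apply: HK.
- by move=> z; apply: Hk.
- by move=> z; apply: (RS_lt_scale sthk nthk fW fW' m0 e z hmuL qk hs hdL hdk).
Qed.
End Lifted.
End Comparison.

(** * Laurent series fields *)

(** Power series are wrapped in a record so that they receive the ring structure
    of the Cauchy product rather than that of pointwise multiplication. *)
Record power_series (k : fieldType) := PowerSeries { psc : nat -> k }.
HB.instance Definition _ (k : fieldType) := gen_eqMixin (power_series k).
HB.instance Definition _ (k : fieldType) := gen_choiceMixin (power_series k).

Section PowerSeriesRing.
Variable k : fieldType.
Notation ps := (power_series k).
Implicit Types f g h : ps.

Lemma psP f g : (forall n, psc f n = psc g n) -> f = g.
Proof. by case: f g => [f] [g] /= h; congr PowerSeries; apply/funext. Qed.

Definition ps_add f g : ps := PowerSeries (fun n => psc f n + psc g n).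
Definition ps_opp f : ps := PowerSeries (fun n => - psc f n).
Definition ps_const (c : k) : ps := PowerSeries (fun n => if n == 0%N then c else 0).
Definition ps_mul f g : ps := PowerSeries (fun n => \sum_(i < n.+1) psc f i * psc g (n - i)).

Lemma ps_addA : associative ps_add.
Proof. by move=> f g h; apply: psP => n /=; rewrite addrA. Qed.
Lemma ps_addC : commutative ps_add.
Proof. by move=> f g; apply: psP => n /=; rewrite addrC. Qed.
Lemma ps_add0 : left_id (ps_const 0) ps_add.
Proof. by move=> f; apply: psP => n /=; rewrite if_same add0r. Qed.
Lemma ps_addN : left_inverse (ps_const 0) ps_opp ps_add.
Proof. by move=> f; apply: psP => n /=; rewrite if_same addNr. Qed.
HB.instance Definition _ := GRing.isZmodule.Build ps ps_addA ps_addC ps_add0 ps_addN.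

(** Associativity of the Cauchy product is inherited from polynomials, by
    truncation. *)
Lemma coef_mul_agree n f g (p q : {poly k}) : (forall i, (i <= n)%N -> p`_i = psc f i) ->
  (forall i, (i <= n)%N -> q`_i = psc g i) -> (p * q)`_n = psc (ps_mul f g) n.
Proof.
move=> hp hq; rewrite coefM /=; apply: eq_bigr => i _; rewrite hp ?hq ?leq_subr //.
by rewrite -ltnS.
Qed.

Definition truncate n f : {poly k} := \poly_(i < n.+1) psc f i.

Lemma coef_truncate n f i : (i <= n)%N -> (truncate n f)`_i = psc f i.
Proof. by move=> h; rewrite coef_poly ltnS h. Qed.

Lemma psc_mul n f g : psc (ps_mul f g) n = (truncate n f * truncate n g)`_n.
Proof. by apply/esym/coef_mul_agree => i; apply: coef_truncate. Qed.

Lemma truncate_mul n f g i : (i <= n)%N -> (truncate n f * truncate n g)`_i = psc (ps_mul f g) i.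
Proof. by move=> h; apply: coef_mul_agree => j hj; apply: coef_truncate; apply: leq_trans h. Qed.

Lemma ps_mulA : associative ps_mul.
Proof.
move=> f g h; apply: psP => n.
transitivity ((truncate n f * (truncate n g * truncate n h))`_n).
  by apply/esym/coef_mul_agree => i hi; [apply: coef_truncate | apply: truncate_mul].
rewrite mulrA; apply: coef_mul_agree => i hi; [exact: truncate_mul | exact: coef_truncate].
Qed.
Lemma ps_mulC : commutative ps_mul.
Proof. by move=> f g; apply: psP => n; rewrite !psc_mul mulrC. Qed.
Lemma ps_mul1 : left_id (ps_const 1) ps_mul.
Proof.
by move=> f; apply: psP => n /=; rewrite big_ord_recl mul1r subn0 big1 ?addr0 // => i _; rewrite mul0r.
Qed.
Lemma ps_mulDl : left_distributive ps_mul ps_add.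
Proof.
move=> f g h; apply: psP => n /=; rewrite -big_split; apply: eq_bigr => i _.
by rewrite mulrDl.
Qed.
Lemma ps_neq0 : ps_const 1 != 0 :> ps.
Proof. by apply/eqP => /(congr1 (fun f => psc f 0)) /= /eqP; rewrite oner_eq0. Qed.
HB.instance Definition _ := GRing.Zmodule_isComNzRing.Build ps ps_mulA ps_mulC ps_mul1 ps_mulDl ps_neq0.

Lemma pscD f g n : psc (f + g) n = psc f n + psc g n. Proof. by []. Qed.
Lemma pscN f n : psc (- f) n = - psc f n. Proof. by []. Qed.
Lemma psc0 n : psc (0 : ps) n = 0. Proof. by rewrite /= if_same. Qed.
Lemma psc1 n : psc (1 : ps) n = (n == 0%N)%:R. Proof. by rewrite /=; case: n. Qed.
Lemma pscM f g n : psc (f * g) n = \sum_(i < n.+1) psc f i * psc g (n - i). Proof. by []. Qed.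

Definition ps_unit : {pred ps} := fun f => `[< exists g, g * f = 1 >].
Definition ps_inv f : ps := if pselect (exists g, g * f = 1) is left h then sval (cid h) else f.

Lemma ps_mulV : {in ps_unit, left_inverse 1 ps_inv *%R}.
Proof. by move=> f /asboolP h; rewrite /ps_inv; case: pselect => // h'; case: (cid h'). Qed.
Lemma ps_unitPl f g : g * f = 1 -> ps_unit f.
Proof. by move=> h; apply/asboolP; exists g. Qed.
Lemma ps_inv_out : {in [predC ps_unit], ps_inv =1 id}.
Proof.
move=> f; rewrite inE => /asboolP nf; by rewrite /ps_inv; case: pselect.
Qed.
HB.instance Definition _ := GRing.ComNzRing_hasMulInverse.Build ps ps_mulV ps_unitPl ps_inv_out.

Definition ps_t : ps := PowerSeries (fun n => (n == 1%N)%:R).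
Definition ps_shift n f : ps := PowerSeries (fun i => psc f (i + n)).

Lemma psc_tM f n : psc (ps_t * f) n = if n is m.+1 then psc f m else 0.
Proof.
rewrite pscM; case: n => [|n]; first by rewrite big_ord1 /= mul0r.
rewrite big_ord_recl /= mul0r add0r big_ord_recl /= mul1r subSS subn0.
by rewrite big1 ?addr0 // => i _; rewrite mul0r.
Qed.

Lemma psc_tXM d f n : psc (ps_t ^+ d * f) n = if (n < d)%N then 0 else psc f (n - d).
Proof.
elim: d n => [|d IH] n; first by rewrite expr0 mul1r subn0.
by rewrite exprS -mulrA psc_tM; case: n => [|n] //; rewrite IH ltnS subSS.
Qed.

Lemma ps_shiftK n f : (forall i, (i < n)%N -> psc f i = 0) -> f = ps_t ^+ n * ps_shift n f.
Proof.
move=> h; apply: psP => i; rewrite psc_tXM; case: ltnP => hi; first exact: h.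
by rewrite /= subnK.
Qed.

Lemma ps_factor f : f != 0 -> exists n u, f = ps_t ^+ n * u /\ psc u 0 != 0.
Proof.
move=> f0; have ex : exists n, psc f n != 0.
  apply: contrapT => h; case/eqP: f0; apply: psP => n; rewrite psc0; apply/eqP/negPn/negP => hn.
  by apply: h; exists n.
have [n hn mn] := ex_minnP ex.
exists n, (ps_shift n f); split=> //; apply: ps_shiftK => i hi.
by apply/eqP/negPn/negP => /mn; rewrite leqNgt hi.
Qed.

Lemma ps_integral f g : f * g = 0 -> (f == 0) || (g == 0).
Proof.
move=> fg; case: eqVneq => //= f0; apply/eqP; apply: contrapT => /eqP g0.
have [n [u [ef u0]]] := ps_factor f0; have [m [w [eg w0]]] := ps_factor g0.
have : psc (f * g) (n + m) = psc u 0 * psc w 0.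
  by rewrite ef eg mulrACA -exprD psc_tXM ltnn subnn pscM big_ord1.
by rewrite fg psc0 => /esym/eqP; rewrite mulf_eq0 (negPf u0) (negPf w0).
Qed.
HB.instance Definition _ := GRing.ComUnitRing_isIntegral.Build ps ps_integral.

(** The geometric series of [1 - f / f(0)]. *)
Lemma ps_invertible f : psc f 0 != 0 -> exists g, g * f = 1.
Proof.
move=> f0; pose c := ps_const (psc f 0)^-1; pose u := 1 - c * f.
have u0 : psc u 0 = 0.
  by rewrite pscD pscN pscM big_ord1 /= mulVf ?subrr.
have eu : u = ps_t * ps_shift 1 u.
  by rewrite -[ps_t]expr1; apply: ps_shiftK => -[].
have low i n : (n < i)%N -> psc (u ^+ i) n = 0 by move=> h; rewrite eu exprMn psc_tXM h.
pose S (N : nat) := \sum_(i < N) u ^+ i.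
have stable N n : (n < N)%N -> psc (S N) n = psc (S n.+1) n.
  elim: N => // N IH nN; have [->//|ne] := eqVneq n N.
  have lt : (n < N)%N by rewrite ltn_neqAle ne.
  by rewrite /S big_ord_recr pscD low // addr0 -/(S N) IH.
have geom N : (1 - u) * S N = 1 - u ^+ N.
  by rewrite -opprB mulNr -subrX1 opprB.
pose G : ps := PowerSeries (fun n => psc (S n.+1) n).
exists (G * c); rewrite -mulrA; have -> : c * f = 1 - u by rewrite /u opprB addrC subrK.
apply: psP => n; rewrite mulrC.
transitivity (psc ((1 - u) * S n.+1) n); last by rewrite geom pscD pscN low // subr0.
rewrite !pscM; apply: eq_bigr => i _; congr (_ * _).
by rewrite /= (stable n.+1) // ltnS leq_subr.
Qed.
End PowerSeriesRing.

Section LaurentField.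
Variable k : finFieldType.
Notation ps := (power_series k).
Notation L := {fraction (power_series k)}.
Notation T := (tofrac (ps_t k) : L).
Notation c0 f := (psc f 0).

Lemma ps_t_neq0 : ps_t k != 0.
Proof. by apply/eqP => /(congr1 (fun f => psc f 1)) /= /eqP; rewrite oner_eq0. Qed.

Lemma T_neq0 : T != 0.
Proof. by rewrite tofrac_eq0 ps_t_neq0. Qed.
Hint Resolve T_neq0 : core.

Lemma tofrac_inj (f g : ps) : tofrac f = tofrac g -> f = g.
Proof. by move/eqP; rewrite tofrac_eq => /eqP. Qed.

Lemma fractionE (x : L) : exists a b : ps, b != 0 /\ x = tofrac a / tofrac b.
Proof.
elim/quotW: x => r; exists (frac r).1, (frac r).2; split; first exact: denom_ratioP.
apply: (canRL (mulfK _)); first by rewrite tofrac_eq0 denom_ratioP.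
rewrite -[LHS]/(FracField.mul _ _) !piE; apply/eqP; rewrite FracField.equivf_def.
by rewrite /FracField.mulf !numden_Ratio ?oner_neq0 ?mulr1 ?denom_ratioP // mulrC.
Qed.

Definition has_val (x : L) (z : int) := exists u : ps, c0 u != 0 /\ x = T ^ z * tofrac u.

(** Every element is a quotient of two power series, and each of these is a
    power of [t] times an invertible one. *)
Lemma has_val_exists x : x != 0 -> exists z, has_val x z.
Proof.
have [a [b [b0 ->]]] := fractionE x; move=> x0.
have a0 : a != 0 by apply: contra_neq x0 => ->; rewrite tofrac0 mul0r.
have [n [u [-> u0]]] := ps_factor a0; have [m [w [-> w0]]] := ps_factor b0.
have [w' hw'] := ps_invertible w0.
exists (n%:Z - m%:Z), (u * w'); split.
  rewrite pscM big_ord1; apply: mulf_neq0 => //=.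
  have := congr1 (fun f => c0 f) hw'; rewrite pscM big_ord1 psc1 /= => h.
  by apply/eqP => e; move/eqP: h; rewrite e mul0r eq_sym oner_eq0.
have wn : tofrac w != 0 :> L.
  rewrite tofrac_eq0; apply/eqP => e; move: w0; rewrite e psc0 eqxx //.
have -> : tofrac (u * w') = tofrac u / tofrac w :> L.
  by apply: (mulIf wn); rewrite divfK // -tofracM -mulrA hw' mulr1.
rewrite !tofracM !tofracXn expfzDr // -exprnP -exprnN.
by rewrite mulf_div.
Qed.

Lemma has_val_unique x z z' : has_val x z -> has_val x z' -> z = z'.
Proof.
wlog le : z z' / z <= z'.
  move=> h h1 h2; case: (leP z z') => [le|/ltW le]; first exact: h.
  by apply/esym/h.
move=> [u [u0 ->]] [w [w0 e]]; apply/eqP; rewrite eq_le le /= leNgt; apply/negP => lt.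
have [d dE] : exists d : nat, z' = z + d.+1%:Z by exists (`|z' - z|%N.-1); lia.
have Tz : T ^ z != 0 by rewrite expfz_neq0.
have : u = ps_t k ^+ d.+1 * w.
  apply: tofrac_inj; rewrite tofracM tofracXn; apply: (mulfI Tz); rewrite e dE expfzDr //.
  by rewrite -exprnP mulrA.
by move=> eu; move: u0; rewrite eu psc_tXM eqxx.
Qed.

Definition laurent_val (x : L) : int :=
  if pselect (exists z, has_val x z) is left h then sval (cid h) else 0.

Lemma laurent_valE x z : has_val x z -> laurent_val x = z.
Proof.
move=> h; rewrite /laurent_val; case: pselect => [h'|[]]; last by exists z.
by case: (cid h') => z' /= hz'; apply: has_val_unique hz' h.
Qed.

Lemma laurent_valP x : x != 0 -> has_val x (laurent_val x).
Proof. by move=> /has_val_exists[z h]; rewrite (laurent_valE h). Qed.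

Lemma laurent_valM (x y : L) : x != 0 -> y != 0 -> laurent_val (x * y) = laurent_val x + laurent_val y.
Proof.
move=> /laurent_valP[u [u0 eu]] /laurent_valP[w [w0 ew]]; apply: laurent_valE.
exists (u * w); split; first by rewrite pscM big_ord1 mulf_neq0.
by rewrite {1}eu {1}ew tofracM mulrACA expfzDr.
Qed.

(** [t^N k[[t]]] *)
Definition in_tpow (N : int) (x : L) := exists f : ps, x = T ^ N * tofrac f.

Lemma in_tpowP N x : ((x == 0) || (N <= laurent_val x)) <-> in_tpow N x.
Proof.
have [->|x0] /= := eqVneq x 0.
  by split=> // _; exists 0; rewrite tofrac0 mulr0.
split=> [h|[f e]].
  have [u [u0 eu]] := laurent_valP x0.
  exists (ps_t k ^+ `|laurent_val x - N| * u); rewrite {1}eu tofracM tofracXn mulrA exprnP -expfzDr //.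
  by congr (T ^ _ * _); lia.
have f0 : f != 0 by apply: contra_neq x0; rewrite e => ->; rewrite tofrac0 mulr0.
have [n [u [ef u0]]] := ps_factor f0.
rewrite (@laurent_valE x (N + n%:Z)); first lia.
by exists u; split=> //; rewrite e ef tofracM tofracXn mulrA exprnP -expfzDr.
Qed.

Lemma laurent_valD (x y : L) : x != 0 -> y != 0 -> x + y != 0 ->
  Num.min (laurent_val x) (laurent_val y) <= laurent_val (x + y).
Proof.
move=> x0 y0 xy0; set N := Num.min _ _.
have /in_tpowP[f ef] : (x == 0) || (N <= laurent_val x) by rewrite ge_min lexx orbT.
have /in_tpowP[g eg] : (y == 0) || (N <= laurent_val y) by rewrite ge_min lexx !orbT.
have /in_tpowP : in_tpow N (x + y).
  by exists (f + g); rewrite tofracD mulrDr -ef -eg.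
by rewrite (negPf xy0).
Qed.

Lemma laurent_unif : exists2 x : L, x != 0 & laurent_val x = 1.
Proof.
exists T => //; apply: laurent_valE; exists 1; split; first by rewrite /= oner_neq0.
by rewrite tofrac1 mulr1 expr1z.
Qed.

Lemma in_tpow0 (x : L) : in_tpow 0 x <-> exists f : ps, x = tofrac f.
Proof. by split=> -[f ->]; exists f; rewrite expr0z mul1r. Qed.

Lemma laurent_residue : exists s : seq L,
    [/\ size s = #|k|, uniq s,
        forall x, x \in s -> (x == 0) || (0 <= laurent_val x),
        forall x y, x \in s -> y \in s ->
          (x - y == 0) || (1 <= laurent_val (x - y)) -> x = y
      & forall x, (x == 0) || (0 <= laurent_val x) ->
          exists2 y, y \in s & (x - y == 0) || (1 <= laurent_val (x - y))].
Proof.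
pose em (c : k) : L := tofrac (ps_const c).
have emB c d : in_tpow 1 (em c - em d) -> c = d.
  move=> [f]; rewrite -tofracB expr1z -tofracM => /tofrac_inj /(congr1 (fun g => c0 g)).
  by rewrite pscD pscN psc_tM /= => /eqP; rewrite subr_eq0 => /eqP.
exists [seq em c | c <- enum k]; split.
- by rewrite size_map -cardE.
- rewrite map_inj_uniq ?enum_uniq // => c d e; apply: emB.
  by exists 0; rewrite e subrr tofrac0 mulr0.
- by move=> x /mapP[c _ ->]; apply/in_tpowP/in_tpow0; exists (ps_const c).
- by move=> x y /mapP[c _ ->] /mapP[d _ ->] /in_tpowP /emB ->.
- move=> x /in_tpowP/in_tpow0[f ->]; exists (em (c0 f)); first by apply: map_f; rewrite mem_enum.
  apply/in_tpowP; exists (ps_shift 1 (f - ps_const (c0 f))).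
  rewrite expr1z -tofracM -tofracB; congr tofrac.
  rewrite -[ps_t k]expr1; apply: ps_shiftK => -[] // _.
  by rewrite pscD pscN /= subrr.
Qed.

(** The terms of a Cauchy sequence differ from one of them by power series,
    whose coefficients are eventually constant. *)
Lemma laurent_complete (u : nat -> L) :
    (forall N : int, exists n0 : nat, forall i j : nat,
       (n0 <= i)%N -> (n0 <= j)%N ->
       (u i - u j == 0) || (N <= laurent_val (u i - u j))) ->
    exists x : L, forall N : int, exists n0 : nat, forall i : nat,
       (n0 <= i)%N -> (u i - x == 0) || (N <= laurent_val (u i - x)).
Proof.
move=> hu.
have [n0 h0] := hu 0.
have /boolp.choice[s hs] (i : nat) : exists f : ps, (n0 <= i)%N -> u i = u n0 + tofrac f.
  case: (leqP n0 i) => hi; last by exists 0.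
  have /in_tpowP/in_tpow0[f e] := h0 i n0 hi (leqnn _).
  by exists f => _; rewrite -e addrC subrK.
have /boolp.choice[m hm] (N : nat) : exists m0 : nat, (n0 <= m0)%N /\
    forall i j n, (m0 <= i)%N -> (m0 <= j)%N -> (n < N)%N -> psc (s i) n = psc (s j) n.
  have [m0 h] := hu N%:Z; exists (maxn n0 m0); split; first exact: leq_maxl.
  move=> i j n hi hj nN; rewrite !geq_max in hi hj.
  have [/andP[i0 i1] /andP[j0 j1]] := (hi, hj).
  have /in_tpowP[f] := h i j i1 j1.
  rewrite (hs i i0) (hs j j0) opprD addrACA subrr add0r -tofracB -exprnP -tofracXn -tofracM.
  move=> /tofrac_inj /(congr1 (fun g => psc g n)); rewrite psc_tXM nN pscD pscN => /eqP.
  by rewrite subr_eq0 => /eqP.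
pose lim : ps := PowerSeries (fun n => psc (s (m n.+1)) n).
exists (u n0 + tofrac lim) => N; pose N' := `|N|%N; exists (m N') => i hi.
have i0 : (n0 <= i)%N by apply: leq_trans hi; case: (hm N').
apply/in_tpowP; exists (ps_t k ^+ (`|N'%:Z - N|) * ps_shift N' (s i - lim)).
rewrite (hs i i0) opprD addrACA subrr add0r -tofracB tofracM tofracXn mulrA exprnP -expfzDr //.
have -> : N + `|N'%:Z - N|%N%:Z = N'%:Z by rewrite /N'; lia.
rewrite -exprnP -tofracXn -tofracM; congr tofrac; apply: ps_shiftK => n hn.
rewrite pscD pscN /=; apply/eqP; rewrite subr_eq0; apply/eqP.
have [_ h1] := hm N'; have [_ h2] := hm n.+1.
pose j := maxn (m N') (m n.+1).
by rewrite (h1 i j n hi (leq_maxl _ _) hn); apply: h2; rewrite ?leq_maxr.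
Qed.

Definition laurent_field : local_field :=
  @LocalField L laurent_val #|k| laurent_valM laurent_valD laurent_unif laurent_residue laurent_complete.
End LaurentField.

Definition F3t : local_field := laurent_field 'F_3.

Lemma F3t_q : lf_q F3t = 3.
Proof. exact: card_Fp. Qed.

Lemma F3t_res_char : res_char F3t 3.
Proof.
split=> //; rewrite /in_pow; apply/orP; left.
have -> : (3%:R : F3t) = tofrac (3%:R : power_series 'F_3) by rewrite -[RHS]/(tofrac (1 *+ 3)) tofracMn tofrac1.
rewrite tofrac_eq0; apply/eqP/psP => n.
rewrite psc0 !mulrS mulr0n !pscD psc0 addr0 psc1.
by case: n => [|n] //=; apply: val_inj.
Qed.

(** * The Haar integral on F^x *)

Lemma principal_unit (F : local_field) (c : F) : in_pow 1 c -> 1 + c != 0 /\ lf_val (1 + c) = 0.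
Proof.
move=> ic; have n1 : ~~ in_pow 1 (1 + c).
  apply/negP => h; have : in_pow 1 (1 : F) by rewrite -(addrK c 1); apply: in_powB.
  by rewrite in_powE ?oner_neq0 // lf_val1.
have c0 : 1 + c != 0 by apply/eqP => e; move: n1; rewrite e in_pow0.
split=> //; have : in_pow 0 (1 + c) by apply: in_powD => //; apply: in_pow_le ic.
by move: n1; rewrite !in_powE //; lia.
Qed.

Section HaarExistence.
Variables (F : local_field) (R : fieldType).
Notation q := (lf_q F).
Hypothesis q0 : q%:R != 0 :> R.

Section Decompositions.
Variable n : nat.
Notation G := 'M[F]_n.
Implicit Types (phi : G -> R) (H : seq G) (x g h : G).

(** Lists like those of [Cc_decomposition]. *)
Definition rep_list N M H := (forall h, h \in H -> h \in unitmx) /\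
  forall phi, N_invariant phi -> of_level N phi -> supported M phi ->
  forall g, g \in unitmx -> phi g = \sum_(h <- H) phi h * ind R (dcoset h N) g.

Lemma dcoset_invariant N x : (0 < N)%N -> x \in unitmx ->
  N_invariant (ind R (dcoset x N)) /\ of_level N (ind R (dcoset x N)).
Proof.
move=> N0 ux; split=> [u g hu ug|g k ug ck]; apply: ind_iff.
  have d : dcoset g N (u *m g) by exists u, 1%:M; split; [| exact: cong1 | rewrite mulmx1].
  split=> h; apply: dcoset_trans h _ => //; apply: dcoset_sym => //.
have d : dcoset g N (g *m k) by exists 1%:M, k; split; [exact: unipotent1 | | rewrite mul1mx].
by split=> h; apply: dcoset_trans h _ => //; apply: dcoset_sym.
Qed.

Lemma eq_dcoset N phi x g : N_invariant phi -> of_level N phi -> x \in unitmx ->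
  dcoset x N g -> phi g = phi x.
Proof.
move=> h1 h2 ux [u [k [hu ck ->]]]; rewrite h2 // ?h1 //.
by rewrite unitmx_mul ux unipotent_unit.
Qed.

Lemma dcoset_supported N M phi x : N_invariant phi -> of_level N phi -> supported M phi ->
  x \in unitmx -> phi x <> 0 -> supported M (ind R (dcoset x N)).
Proof.
move=> h1 h2 h3 ux ne g ug; case: (EM (dcoset x N g)) => [d _|nd]; last by rewrite indF.
by apply: h3 => //; rewrite (eq_dcoset h1 h2 ux d).
Qed.

(** Decompose the indicator function of the double coset and evaluate it at
    [x]. *)
Lemma rep_list_dcoset N M H x : (0 < N)%N -> rep_list N M H -> x \in unitmx ->
  supported M (ind R (dcoset x N)) -> \sum_(h <- H) ind R (dcoset x N) h = 1.
Proof.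
move=> N0 [uH hH] ux sx; have [i1 i2] := dcoset_invariant N0 ux.
have := hH _ i1 i2 sx x ux; rewrite (indT _ (dcoset_refl N x)) => ->.
rewrite !big_seq; apply: eq_bigr => h /uH uh.
case: (EM (dcoset x N h)) => d; last by rewrite indF // mul0r.
by rewrite !indT ?mul1r //; apply: dcoset_sym.
Qed.
End Decompositions.

Notation G := 'M[F]_1.

Lemma unipotent_dim1 (u : G) : unipotent u -> u = 1%:M.
Proof. by move=> hu; apply/matrixP => i j; rewrite !ord1 hu // mxE. Qed.

Lemma dcoset_dim1 N (h g : G) : h \in unitmx -> g \in unitmx ->
  dcoset h N g <-> in_pow N%:Z (g 0 0 / h 0 0 - 1).
Proof.
move=> uh ug; have h0 : h 0 0 != 0 by move: uh; rewrite unitmxE det_mx11 unitfE.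
have e : invmx h *m g = (g 0 0 / h 0 0)%:M.
  apply: (can_inj (mulKmx uh)); rewrite mulKVmx // mul_mx_scalar.
  by apply/matrixP => i j; rewrite !ord1 mxE divfK.
split=> [[u [k [/unipotent_dim1 -> [uk ck] eg]]]|hg].
  have := ck 0 0; have -> : k = invmx h *m g by rewrite eg mul1mx mulKmx.
  by rewrite e !mxE.
exists 1%:M, (invmx h *m g); split; [exact: unipotent1 | | by rewrite mul1mx mulKVmx].
split; first by rewrite unitmx_mul unitmx_inv uh.
by move=> i j; rewrite e !ord1 !mxE eqxx.
Qed.

(** [1 + varpi^N o] is the disjoint union of the cosets [(1 + c) (1 + varpi^(N + j) o)],
    [c] running through representatives of [varpi^N o / varpi^(N + j) o]. *)
Lemma dcoset_dim1_tile N j (h : G) : (0 < N)%N -> h \in unitmx ->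
  exists s : seq G, [/\ size s = (q ^ j)%N, forall x, x \in s -> x \in unitmx /\ dcoset h N x
    & forall g, g \in unitmx -> ind R (dcoset h N) g = \sum_(x <- s) ind R (dcoset x (N + j)) g].
Proof.
move=> N0 uh; have [s [ss us is_ js es]] := pow_reps F N%:Z j.
have h0 : h 0 0 != 0 by move: uh; rewrite unitmxE det_mx11 unitfE.
have one_unit (c : F) : in_pow N%:Z c -> 1 + c != 0 /\ lf_val (1 + c) = 0.
  by move=> ic; apply: principal_unit; apply: in_pow_le ic; lia.
have unit1 (c : F) (ic : in_pow N%:Z c) := proj1 (one_unit c ic).
have val1 (c : F) (ic : in_pow N%:Z c) := proj2 (one_unit c ic).
have u1 (c : F) : in_pow N%:Z c -> ((h 0 0 * (1 + c))%:M : G) \in unitmx.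
  by move=> ic; rewrite unitmxE det_scalar expr1 unitfE mulf_neq0 ?unit1.
exists [seq (h 0 0 * (1 + c))%:M | c <- s]; split; first by rewrite size_map.
  move=> x /mapP[c /is_ ic ->]; split; first exact: u1.
  by apply/dcoset_dim1; rewrite ?u1 // !mxE eqxx mulr1n mulrAC divff // mul1r addrAC subrr add0r.
move=> g ug; rewrite big_map.
have dE c : c \in s -> dcoset (h 0 0 * (1 + c))%:M (N + j) g <->
    in_pow (N%:Z + j%:Z) (g 0 0 / h 0 0 - 1 - c).
  move=> /is_ ic; rewrite dcoset_dim1 ?u1 //.
  have c0 := unit1 c ic; have v1 := val1 c ic.
  have -> : g 0 0 / h 0 0 - 1 - c = (g 0 0 / (h 0 0 * (1 + c)) - 1) * (1 + c).
    by field; rewrite c0.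
  rewrite !mxE eqxx mulr1n /in_pow mulf_eq0 (negPf c0) orbF.
  by have [//|z0] := eqVneq (g 0 0 / (h 0 0 * (1 + c)) - 1) 0; rewrite /= lf_valM // v1 addr0.
case: (EM (dcoset h N g)) => d.
  have /dcoset_dim1 d' := d; have [c cs hc] := es _ (d' uh ug).
  rewrite (indT _ d) (bigD1_seq c) //= (indT _ (proj2 (dE c cs) hc)) big_seq_cond big1 ?addr0 //.
  move=> c' /andP[cs' ne]; apply: indF => /(dE c' cs') hc'.
  case/eqP: ne; apply: js => //; have -> : c' - c = (g 0 0 / h 0 0 - 1 - c) - (g 0 0 / h 0 0 - 1 - c') by ring.
  exact: in_powB.
rewrite (indF _ d) big_seq big1 // => c cs; apply: indF => /(dE c cs) hc; apply: d.
apply/dcoset_dim1 => //; rewrite -[X in in_pow _ X](subrK c); apply: in_powD; last exact: is_.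
by apply: in_pow_le hc; lia.
Qed.

(** Expand [phi] along [H] and exchange the sums: each coset of level [N]
    contains [q^j] elements of [H'].  In particular the sum does not depend on
    the representatives. *)
Lemma rep_list_sum N j M M' H H' (phi : G -> R) : (0 < N)%N ->
  N_invariant phi -> of_level N phi -> supported M phi -> supported M' phi ->
  rep_list N M H -> rep_list (N + j) M' H' ->
  \sum_(h <- H') phi h = q%:R ^+ j * \sum_(h <- H) phi h.
Proof.
move=> N0 h1 h2 h3 h3' [uH hH] sH'; have [uH' _] := sH'.
have Nj0 : (0 < N + j)%N by rewrite addn_gt0 N0.
transitivity (\sum_(h' <- H') \sum_(h <- H) phi h * ind R (dcoset h N) h').
  by rewrite !big_seq; apply: eq_bigr => h' /uH' uh'; apply: hH.
rewrite exchange_big /= mulr_sumr !big_seq; apply: eq_bigr => h /uH uh.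
rewrite -mulr_sumr mulrC.
have [->|ne] := eqVneq (phi h) 0; first by rewrite !mulr0.
congr (_ * _); have [s [ss us hs]] := dcoset_dim1_tile j N0 uh.
transitivity (\sum_(h' <- H') \sum_(x <- s) ind R (dcoset x (N + j)) h').
  by rewrite !big_seq; apply: eq_bigr => h' /uH' uh'; apply: hs.
rewrite exchange_big /= -natrX -ss -sum1_size natr_sum !big_seq.
apply: eq_bigr => x /us[ux dx]; apply: (rep_list_dcoset Nj0 sH') => //.
have h2' : of_level (N + j) phi by apply: of_level_le h2; apply: leq_addr.
apply: (dcoset_supported h1 h2' h3' ux); rewrite (eq_dcoset h1 h2 uh dx).
exact/eqP.
Qed.

(** The Haar integral on [F^x] gives [1 + varpi^N o] the volume [q^-N]. *)
Definition gl1_sum (phi : G -> R) (y : R) := exists N M H,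
  [/\ (0 < N)%N, N_invariant phi, of_level N phi, supported M phi &
    rep_list N M H /\ y = q%:R ^- N * \sum_(h <- H) phi h].

Lemma gl1_sum_at N M H (phi : G -> R) y : gl1_sum phi y ->
  (0 < N)%N -> of_level N phi -> supported M phi -> rep_list N M H ->
  y = q%:R ^- N * \sum_(h <- H) phi h.
Proof.
move=> [N' [M' [H' [N0' h1 h2' h3' [sH' ->]]]]] N0 h2 h3 sH.
have [HH sHH] : exists H : seq G, rep_list (N + N') M H.
  by have [|HH [uH hH]] := @Cc_decomposition F 1 (N + N') M; [lia | exists HH; split=> // phi'; apply: hH].
have e1 := rep_list_sum N0 h1 h2 h3 h3 sH sHH.
rewrite addnC in sHH; have e2 := rep_list_sum N0' h1 h2' h3' h3 sH' sHH.
have qX j : q%:R ^+ j != 0 :> R by rewrite expf_neq0.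
by apply: (mulfI (qX N)); rewrite mulrCA -e2 e1 mulKf // mulVKf.
Qed.

Definition gl1_haar (phi : G -> R) : R :=
  if pselect (exists y, gl1_sum phi y) is left h then sval (cid h) else 0.

Lemma gl1_haarP (phi : G -> R) : Cc_quot phi -> gl1_sum phi (gl1_haar phi).
Proof.
move=> /Cc_quotP[N [M [N0 h1 h2 h3]]]; rewrite /gl1_haar; case: pselect => [h|[]].
  by case: (cid h).
have [H [uH hH]] := @Cc_decomposition F 1 N M N0.
by eexists; exists N, M, H; split=> //; split; [split=> // phi'; apply: hH | reflexivity].
Qed.

(** Linearity and invariance hold for the sums once common representatives are
    chosen, since [gl1_sum_at] allows any sufficiently deep level. *)
Lemma haar_dim1 : haar_quot gl1_haar.
Proof.
have reps N M : (0 < N)%N -> exists H, @rep_list 1 N M H.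
  by move=> N0; have [H [uH hH]] := @Cc_decomposition F 1 N M N0; exists H; split=> // phi'; apply: hH.
split.
- move=> phi psi cphi cpsi e; have h := gl1_haarP cphi; have h' := gl1_haarP cpsi.
  have /Cc_quotP[N [M [N0 h1 h2 h3]]] := cphi.
  have [H sH] := reps N M N0; have [uH _] := sH.
  rewrite (gl1_sum_at h N0 h2 h3 sH).
  rewrite (gl1_sum_at h' N0 _ _ sH).
  + by congr (_ * _); rewrite !big_seq; apply: eq_bigr => x /uH; apply: e.
  + by move=> g k ug ck; rewrite -!e ?h2 // unitmx_mul ug; case: ck.
  + by move=> g ug; rewrite -e //; apply: h3.
- move=> a phi psi cphi cpsi.
  have h := gl1_haarP cphi; have h' := gl1_haarP cpsi; have h'' := gl1_haarP (Cc_lin a cphi cpsi).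
  have /Cc_quotP[N [M [N0 h1 h2 h3]]] := cphi.
  have /Cc_quotP[N' [M' [N0' h1' h2' h3']]] := cpsi.
  have /Cc_quotP[N2 [M2 [N02 h12 h22 h32]]] := Cc_lin a cphi cpsi.
  pose K := maxn N (maxn N' N2); pose L := Num.min M (Num.min M' M2).
  have [K1 K2 K3] : [/\ (N <= K)%N, (N' <= K)%N & (N2 <= K)%N] by rewrite /K; split; lia.
  have [L1 L2 L3] : [/\ L <= M, L <= M' & L <= M2] by rewrite /L; split; lia.
  have K0 : (0 < K)%N by lia.
  have [H sH] := reps K L K0.
  rewrite (gl1_sum_at h K0 (of_level_le K1 h2) (supported_le L1 h3) sH).
  rewrite (gl1_sum_at h' K0 (of_level_le K2 h2') (supported_le L2 h3') sH).
  rewrite (gl1_sum_at h'' K0 (of_level_le K3 h22) (supported_le L3 h32) sH).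
  by rewrite big_split /= -mulr_sumr mulrDr mulrCA.
- move=> phi h cphi uh; have cphi' := Cc_translate uh cphi.
  have e := gl1_haarP cphi; have e' := gl1_haarP cphi'.
  have /Cc_quotP[N [M [N0 h1 h2 h3]]] := cphi.
  have /Cc_quotP[N2 [M2 [N02 h12 h22 h32]]] := cphi'.
  pose K := maxn N N2; pose L := Num.min M M2.
  have [K1 K3] : (N <= K)%N /\ (N2 <= K)%N by rewrite /K; split; lia.
  have [L1 L3] : L <= M /\ L <= M2 by rewrite /L; split; lia.
  have K0 : (0 < K)%N by lia.
  have [H sH] := reps K L K0; have [uH hH] := sH.
  have l2 := of_level_le K1 h2; have l3 := supported_le L1 h3.
  have k2 := of_level_le K3 h22; have k3 := supported_le L3 h32.
  rewrite (gl1_sum_at e K0 l2 l3 sH) (gl1_sum_at e' K0 k2 k3 sH); congr (_ * _).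
  transitivity (\sum_(x <- H) \sum_(y <- H) phi y * ind R (dcoset y K) (x *m h)).
    by rewrite !big_seq; apply: eq_bigr => x /uH ux; apply: hH => //; rewrite unitmx_mul ux.
  rewrite exchange_big /= !big_seq; apply: eq_bigr => y /uH uy.
  rewrite -mulr_sumr; have [->|ne] := eqVneq (phi y) 0; first by rewrite mul0r.
  have uyh : y *m invmx h \in unitmx by rewrite unitmx_mul uy unitmx_inv.
  rewrite -[RHS]mulr1; congr (_ * _).
  rewrite -[RHS](@rep_list_dcoset 1 K L H (y *m invmx h)) //; last first.
    by apply: (dcoset_supported h12 k2 k3) => //; rewrite mulmxKV //; apply/eqP.
  rewrite !big_seq; apply: eq_bigr => x /uH ux; apply: ind_iff.
  have uxh : x *m h \in unitmx by rewrite unitmx_mul ux.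
  have c1 : h 0 0 != 0 by move: uh; rewrite unitmxE det_mx11 unitfE.
  have c2 : y 0 0 != 0 by move: uy; rewrite unitmxE det_mx11 unitfE.
  rewrite !dcoset_dim1 //; suff -> : (x *m h) 0 0 / y 0 0 = x 0 0 / (y *m invmx h) 0 0 by [].
  have -> : (y *m invmx h) 0 0 = y 0 0 / h 0 0.
    by apply: (mulIf c1); rewrite divfK // -[in RHS](mulmxKV uh y) [in RHS]mxE big_ord1.
  rewrite [(x *m h) 0 0]mxE big_ord1; field; by rewrite c1 c2.
- have u1 : (1%:M : G) \in unitmx by rewrite unitmx1.
  have c := @Cc_dcoset F 1 R 1%:M 1 isT u1; exists (ind R (dcoset 1%:M 1)) => //.
  have h := gl1_haarP c; have [h1 h2] := @dcoset_invariant 1 1 1%:M isT u1.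
  have /Cc_quotP[N [M [N0 _ _ h3]]] := c.
  have [H sH] := reps 1%N M isT.
  rewrite (gl1_sum_at h (ltn0Sn 0) h2 h3 sH) (rep_list_dcoset (ltn0Sn 0) sH) // mulr1.
  by apply/eqP; rewrite invr_eq0 expf_neq0.
Qed.
End HaarExistence.

(** * Generators of fractional ideals *)

(** The numerators [P I] are Laurent polynomials, and that of [I0] is a nonzero
    constant; thus [f] and the combination of shifts of [I0] with the
    coefficients of [P f] have the same numerator. *)
Lemma spans_inv_of_generator (R : fieldType) (A : (int -> R) -> Prop) (P : {poly R}) I0 (c : R) :
  P`_0 = 1 -> (forall I, A I -> laurent_series I /\ laurent_poly (poly_mul_series P I)) ->
  A I0 -> c != 0 -> (forall k, poly_mul_series P I0 k = c * (k == 0)%:R) -> spans_inv A P.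
Proof.
move=> P0 hA A0 c0 e0 f; split=> [[N [a [d [I [AI fE]]]]]|[[N0 lf] [N hN]]].
  have /boolp.choice[b hb] (i : 'I_N) : exists b : nat,
      (forall k, k < - b%:Z -> I i k = 0) /\ (forall k, b%:Z < `|k| -> poly_mul_series P (I i) k = 0).
    have [[b1 h1] [b2 h2]] := hA _ (AI i); exists (`|b1| + `|b2|)%N.
    by split=> k hk; [apply: h1 | apply: h2]; lia.
  pose B := (\sum_i (b i + `|d i|))%N.
  have hB i : (b i + `|d i| <= B)%N by rewrite /B (bigD1 i) //= leq_addr.
  split.
    exists (- B%:Z) => k hk; rewrite fE big1 // => i _.
    have [h _] := hb i; have := hB i => hi; rewrite h ?mulr0 //; lia.
  exists B%:Z => k hk.
  have -> : poly_mul_series P f k = \sum_i a i * poly_mul_series P (I i) (k - d i).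
    rewrite /poly_mul_series; under eq_bigr do rewrite fE mulr_sumr.
    rewrite exchange_big /=; apply: eq_bigr => i _; rewrite mulr_sumr; apply: eq_bigr => j _.
    by rewrite mulrCA addrAC.
  rewrite big1 // => i _; have [_ h] := hb i; have := hB i => hi; rewrite h ?mulr0 //; lia.
have [[N1 l0] _] := hA _ A0.
pose n := `|N|%N.
pose D (i : 'I_(n + n).+1) : int := i%:Z - n%:Z.
pose a i := c^-1 * poly_mul_series P f (D i).
pose g k := \sum_i a i * I0 (k - D i).
have gE k : poly_mul_series P g k = poly_mul_series P f k.
  have -> : poly_mul_series P g k = \sum_i a i * poly_mul_series P I0 (k - D i).
    rewrite /poly_mul_series; under eq_bigr do rewrite mulr_sumr.
    rewrite exchange_big /=; apply: eq_bigr => i _; rewrite mulr_sumr; apply: eq_bigr => j _.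
    by rewrite mulrCA addrAC.
  have [lt|le] := ltP n%:Z `|k|.
    rewrite hN; last by rewrite /n in lt; lia.
    rewrite big1 // => i _; rewrite e0 (_ : (k - D i == 0) = false) ?mulr0 //.
    by apply/eqP; have := ltn_ord i; rewrite /D; lia.
  have hi : (`|(k + n%:Z)%R|%N < (n + n).+1)%N by lia.
  rewrite (bigD1 (Ordinal hi)) //= big1 => [|i ne].
    have -> : D (Ordinal hi) = k by rewrite /D /=; lia.
    by rewrite e0 subrr eqxx mulr1 addr0 /a mulrC /D /= (_ : `|(k + n%:Z)%R|%N%:Z - n%:Z = k) ?mulVKf //; lia.
  rewrite e0 (_ : (k - D i == 0) = false) ?mulr0 //; apply/eqP => e.
  by case/eqP: ne; apply: val_inj => /=; move: e; rewrite /D; lia.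
exists (n + n).+1, a, D, (fun=> I0); split=> // k.
rewrite -/(g k); apply: contrapT => fg; have ne : f k - g k <> 0 by move=> /subr0_eq.
have [|k' ne'] := @pms_neq0 _ P (fun k => f k - g k) k P0 _ ne.
  pose L := Num.min N0 (N1 - n%:Z); exists L => j hj; rewrite lf; last by rewrite /L in hj; lia.
  rewrite /g big1 ?subrr // => i _; rewrite l0 ?mulr0 //.
  by have := ltn_ord i; rewrite /D /L in hj *; lia.
apply: ne'.
transitivity (poly_mul_series P f k' - poly_mul_series P g k'); last by rewrite gE subrr.
by rewrite /poly_mul_series -sumrB; apply: eq_bigr => i _; rewrite mulrBr.
Qed.

(** * The trivial character of F^x *)

Section TrivialCharacter.
Variables (F : local_field) (R : fieldType).
Notation q := (lf_q F).
Notation G := 'M[F]_1.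

Definition trivial_rep : prerep F R 1 := Prerep (fun (g : G) (v : R^o) => v).

Lemma trivial_smooth : smooth_rep trivial_rep.
Proof. by split=> //= v; exists 0%N. Qed.

Lemma trivial_irreducible : irreducible_rep trivial_rep.
Proof.
split; first exact: trivial_smooth.
  by exists (1 : R^o); apply/eqP; rewrite oner_neq0.
move=> S [S0 SD _]; case: (EM (exists2 v : R, S v & v <> 0)) => [[v Sv /eqP v0]|h].
  right=> w; have -> : w = (w / v) *: (v : R^o) + 0 by rewrite addr0 /GRing.scale /= divfK.
  exact: SD.
by left=> v Sv; apply: contrapT => ne; apply: h; exists v.
Qed.

Lemma trivial_cuspidal sq : cuspidal sq trivial_rep.
Proof. by split=> [|n1 n2 e]; [exact: trivial_irreducible | case: n1 n2 e => [|[|n1]] [|n2]]. Qed.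

Lemma superdiag_dim1 (u : G) : superdiag u = 0.
Proof. by rewrite /superdiag big1 // => i _; rewrite big1 // => j; rewrite !ord1. Qed.

Variable theta : F -> R.
Hypothesis th0 : theta 0 = 1.

Lemma trivial_whit_functional : whit_functional theta (fun v : trivial_rep => v : R).
Proof.
split=> [a u v //|u v _]; rewrite /theta_N -/(superdiag u) superdiag_dim1 th0 mul1r //.
Qed.

Lemma trivial_generic : generic theta trivial_rep.
Proof.
split; first exact: trivial_irreducible.
exists (fun v => v); split; first exact: trivial_whit_functional.
by exists (1 : R); apply/eqP; rewrite oner_neq0.
Qed.

Lemma trivial_whittaker_type sq : lt_e trivial_rep 1 -> whittaker_type sq theta trivial_rep.
Proof.
move=> hlt; apply: whittaker_type_one; exists 1%N, trivial_rep, 0, 0; split=> //.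
  exact: trivial_cuspidal.
split; first exact: trivial_generic.
exists (twist 0 trivial_rep); first exact: seg_prod_last.
exists (fun=> True), (fun v => v); split=> //.
  by move=> g v _ _ /=; rewrite mul0r oppr0 expr0z scale1r.
by move=> w; exists w.
Qed.

(** The Whittaker functions of the trivial character: Whittaker functions are
    extended by 0 outside the group. *)
Definition const_unit (c : R) (g : G) : R := if g \in unitmx then c else 0.

Lemma trivial_whit W : whit theta trivial_rep W <-> exists c, W = const_unit c.
Proof.
split=> [[lam [[slam _] _ [v ->]]]|[c ->]]; first by exists (lam v).
exists (fun v => v); split; first exact: trivial_whit_functional.
  by exists (1 : R); apply/eqP; rewrite oner_neq0.
by exists c.
Qed.
End TrivialCharacter.

(** The coefficients of a combination of multiples of [b] simply add up. *)
Lemma line_lattice l (D : ladic_data l) (V : lmodType (ld_K D)) (b : V) : prime l -> b != 0 ->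
  is_lattice (fun v => exists c, v = c *: b) (fun v => exists2 c, ld_int c & v = c *: b).
Proof.
move=> prl b0; exists unit, (fun=> b); split.
- move=> s c us e i is_; move: e; rewrite (bigD1_seq i) //= big1 => [|j].
    by rewrite addr0 => /eqP; rewrite scaler_eq0 (negPf b0) orbF => /eqP.
  by case: i j {is_} => -[].
- move=> v; split=> [[c ->]|[s [c ->]]]; first by exists [:: tt], (fun=> c); rewrite big_seq1.
  by exists (\sum_(i <- s) c i); rewrite scaler_suml.
- move=> v; split=> [[c ic ->]|[s [c [ic ->]]]].
    by exists [:: tt], (fun=> c); split=> //; rewrite big_seq1.
  by exists (\sum_(i <- s) c i); [apply: int_sum | rewrite scaler_suml].
Qed.

Section TrivialLift.
Variables (F : local_field) (l : nat) (D : ladic_data l).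
Hypotheses (prl : prime l) (q1 : (lf_q F)%:R = 1 :> ld_k D).
Notation K := (ld_K D).
Notation k := (ld_k D).

(** All unramified twists by powers of [nu] are trivial, as [q = 1] in the
    residue field; thus [e = l]. *)
Lemma trivial_orbit : orbit_card (trivial_rep F k) 1.
Proof.
have tw a g : (lf_q F)%:R ^ (- (a * lf_val (\det (g : 'M[F]_1)))) = 1 :> k by rewrite q1 exp1rz.
exists [:: 0]; split=> // [i j|r]; first by rewrite !inE => /eqP-> /eqP->.
exists 0; rewrite ?inE //; exists (fun v => v); last by exists (fun v => v).
by split=> // g v _ /=; rewrite !tw.
Qed.

Lemma trivial_lt_e_modular : lt_e (trivial_rep F k) 1.
Proof.
move=> l' hl'; exists 1%N; first exact: trivial_orbit.
by rewrite ltnn; have /andP[/prime_gt1] := hl'.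
Qed.

(** A prime that vanishes in the l-adic field vanishes in the residue field too,
    so it is [l]; but [l] is nonzero in [Q_l]. *)
Lemma K_pchar l' : l' \notin [pchar K].
Proof.
apply/negP => h; have /andP[pr' /eqP e0] := h.
have e1 : (l'%:R : k) = 0 by rewrite -red_nat e0 red0.
have hk : l' \in [pchar k] by apply/andP; rewrite e1 eqxx.
have := pcharf_eq (pchar_k D prl) => /(_ l'); rewrite hk => /esym; rewrite inE => /eqP el.
have : (l%:R : K) != 0 by rewrite -(rmorph_nat (ld_emb D)) fmorph_eq0 ld_base_l.
by move/eqP; apply; rewrite -e0 el.
Qed.

Lemma trivial_lt_e : lt_e (trivial_rep F K) 1.
Proof. by move=> l' h; have := K_pchar l'; rewrite h. Qed.

Lemma trivial_integral : integral_rep (trivial_rep F K).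
Proof.
split.
  exists 1%N, (fun i v => (0 < i)%N || (v == 0 :> K)); split=> //.
  - move=> [|i]; split=> //=; try by rewrite ?eqxx.
    by move=> a u v /eqP-> /eqP->; rewrite scaler0 addr0 eqxx.
  - by move=> v /eqP.
  - move=> [|i] U sU h1 h2; last by right=> v; split=> // _; apply: h1.
    have [_ _ h] := trivial_irreducible F K.
    by have [h0|hT] := h U sU; [left=> v; split=> [/h0 ->|/h1 //]; rewrite /= eqxx | right].
have [I [b [h1 h2 h3]]] := @line_lattice l D K^o 1 prl (oner_neq0 _).
exists (fun v => exists2 c, ld_int c & v = c *: (1 : K^o)) => //.
exists I, b; split=> // v; split=> // _; apply/h2; exists v.
by rewrite /GRing.scale /= mulr1.
Qed.

Lemma trivial_lift (sq : K) (theta : F -> K) : theta 0 = 1 ->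
  whittaker_lift sq theta (trivial_rep F K) (trivial_rep F k).
Proof.
move=> th0; have rth0 : (@ld_red l D \o theta) 0 = 1 by rewrite /= th0 ld_red1.
have scaleE (c : K) : c *: (const_unit (F := F) 1 : _ -> K^o) = const_unit c.
  apply/funext => g; rewrite /const_unit; transitivity (c * (if g \in unitmx then 1 else 0)) => //.
  by case: ifP; rewrite ?mulr1 ?mulr0.
split.
- exact: trivial_integral.
- exact: (trivial_whittaker_type th0 sq trivial_lt_e).
- exact: (trivial_whittaker_type rth0 _ trivial_lt_e_modular).
have c0 : (const_unit (F := F) 1 : _ -> K^o) != 0.
  by apply/eqP => /(congr1 (fun f => f 1%:M)); rewrite /const_unit unitmx1 => /eqP; rewrite oner_eq0.
exists (fun W => exists2 c, ld_int c & W = c *: (const_unit (F := F) 1 : _ -> K^o)); split.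
- move=> W [c ic ->]; rewrite scaleE; split; first by apply/(trivial_whit th0); exists c.
  by move=> g; rewrite /const_unit; case: ifP => // _; exact: int0.
- move=> h W uh [c ic ->]; exists c => //; apply/funext => g; rewrite scaleE.
  by rewrite /const_unit unitmx_mul uh andbT.
- have [I [b [h1 h2 h3]]] := line_lattice prl c0; exists I, b; split=> // v.
  rewrite -h2; split=> [/(trivial_whit th0)[c ->]|[c ->]]; first by exists c; rewrite scaleE.
  by apply/(trivial_whit th0); exists c; rewrite scaleE.
- have redE c : @ld_red l D \o const_unit (F := F) c = const_unit (ld_red c).
    by apply/funext => g /=; rewrite /const_unit; case: ifP => // _; exact: red0.
  move=> W'; rewrite (trivial_whit rth0); split=> [[c ->]|[W [c ic ->] ->]].
    by have [x ix <-] := ld_red_surj c; exists (const_unit x); [exists x; rewrite ?scaleE | rewrite redE].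
  by exists (ld_red c); rewrite scaleE redE.
Qed.
End TrivialLift.

(** * Tate's integrals *)

Section TrivialIntegrals.
Variables (F : local_field) (R : fieldType) (theta : F -> R) (mu : ('M[F]_1 -> R) -> R).
Notation q := (lf_q F).
Notation G := 'M[F]_1.
Hypotheses (sth : smooth_char theta) (nth : nontrivial_char theta) (hmu : haar_quot mu).
Implicit Types (Phi : 'rV[F]_1 -> R) (z : int).

Let th0 : theta 0 = 1. Proof. exact: char0 sth. Qed.

(** The coefficients of Tate's integral of [Phi(g) X^v(g)] over [F^x]. *)
Definition tate Phi z : R := RS_eq (erefl 1) mu (const_unit 1) (const_unit 1) Phi z.

Lemma const_unit_whit (theta' : F -> R) (a : R) : smooth_char theta' -> whit_fun theta' (const_unit (F := F) a).
Proof.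
move=> sth'; apply: (whit_whit_fun (trivial_smooth F R)).
by apply/(trivial_whit (char0 sth')); exists a.
Qed.

Lemma eta_mul (g : G) : Defs.eta F 1 *m g = g.
Proof. by apply/matrixP => i j; rewrite !ord1 mxE big_ord1 mxE mul1r. Qed.

Lemma Cc_tate Phi z : Cc_mx Phi -> Cc_quot (fun g : G => if lf_val (\det g) == z then
  const_unit 1 g * const_unit 1 g * Phi (Defs.eta F 1 *m g) else 0).
Proof.
move=> cPhi; apply: (Cc_RS_eq (theta := theta)) => //; apply: const_unit_whit => //.
exact: smooth_char_inv.
Qed.

Lemma RS_tate a b Phi z : Cc_mx Phi ->
  RS_eq (erefl 1) mu (const_unit a) (const_unit b) Phi z = a * b * tate Phi z.
Proof.
move=> cPhi; rewrite /tate !RS_eqE -(haar_scale hmu _ (Cc_tate z cPhi)); congr mu; apply/funext => g.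
rewrite /const_unit; case: (_ == z); last by rewrite mulr0.
by case: (g \in unitmx); rewrite ?mul1r ?mulr0 ?mul0r ?mulr0.
Qed.

Definition unit_group (g : G) := g \in unitmx /\ lf_val (\det g) = 0.

Lemma det_dim1 (g : G) : \det g = g 0 0. Proof. exact: det_mx11. Qed.

Lemma Cc_unit_group : Cc_quot (ind R unit_group).
Proof.
apply: Cc_ext (Cc_tate 0 (Cc_box F 1 1 R 0)) => g ug; rewrite eta_mul /const_unit ug !mul1r.
case: eqP => e; last by rewrite indF // => -[].
rewrite indT // box1 // => i j; rewrite !ord1 -det_dim1 /in_pow e lexx orbT //.
Qed.

Notation vol := (mu (ind R unit_group)).

(** The elements of valuation [z] form a translate of the group of units. *)
Lemma tate_const Phi z c : Cc_mx Phi ->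
  (forall g : G, g \in unitmx -> lf_val (\det g) = z -> Phi g = c) -> tate Phi z = c * vol.
Proof.
move=> cPhi hc; have [w w0 vw] := unif_powP F (- z).
have uw : (w%:M : G) \in unitmx by rewrite unitmxE det_scalar expr1 unitfE.
rewrite -(haar_translate hmu Cc_unit_group uw) -(haar_scale hmu); last exact: Cc_translate Cc_unit_group.
rewrite /tate RS_eqE; apply: (haar_ext hmu); first exact: Cc_tate.
move=> g ug; rewrite eta_mul /const_unit ug !mul1r.
have d0 : \det g != 0 by rewrite -unitfE -unitmxE.
have val : lf_val (\det (g *m w%:M)) = lf_val (\det g) - z.
  by rewrite det_mulmx det_scalar expr1 lf_valM // vw.
case: eqP => e.
  by rewrite (hc g ug e) indT ?mulr1 //; split; [rewrite unitmx_mul ug | rewrite val e subrr].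
by rewrite indF ?mulr0 // => -[_]; rewrite val => /subr0_eq /e.
Qed.

Lemma tate_low Phi : Cc_mx Phi -> exists N : int, forall z, z < N -> tate Phi z = 0.
Proof.
move=> cPhi; have [_ [M hM]] := cPhi; exists M => z zM.
rewrite (@tate_const Phi z 0) ?mul0r // => g ug e; apply: contrapT => /hM /(_ 0 0).
by rewrite -det_dim1 in_powE -?unitfE -?unitmxE // e leNgt zM.
Qed.

(** Near 0 the function [Phi] is constant; this is the source of the pole. *)
Lemma tate_high Phi : Cc_mx Phi -> exists N : int, forall z, N <= z -> tate Phi z = Phi 0 * vol.
Proof.
move=> cPhi; have [[N hN] _] := cPhi; exists N => z zN.
apply: tate_const => // g ug e; rewrite -[g]add0r hN // => i j.
by rewrite !ord1 -det_dim1 in_powE -?unitfE -?unitmxE // e.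
Qed.

(** The units of [o] are a union of [q - 1] cosets of [1 + varpi o]. *)
Lemma unit_group_volume : vol = (q%:R - 1) * mu (ind R (dcoset 1%:M 1)).
Proof.
have [s [ss us is_ js es]] := lf_residue F.
have [y ys hy] : exists2 y, y \in s & in_pow 1 (0 - y) by apply: es; exact: in_pow0.
have {}hy : in_pow 1 y by rewrite sub0r in_powN in hy.
have u1 : (1%:M : G) \in unitmx by rewrite unitmx1.
have c1 := @Cc_dcoset F 1 R 1%:M 1 isT u1.
have val c : c \in s -> c != y -> c != 0 /\ lf_val c = 0.
  move=> cs ne; have nin : ~~ in_pow 1 c.
    by apply/negP => h; case/eqP: ne; apply: js => //; apply: in_powB.
  have c0 : c != 0 by apply/eqP => e; move: nin; rewrite e in_pow0.
  split=> //; have := is_ c cs; rewrite (negPf c0) /=; move: nin; rewrite in_powE //; lia.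
have sc c : c != 0 -> (c%:M : G) \in unitmx by move=> c0; rewrite unitmxE det_scalar expr1 unitfE.
pose phi c : G -> R := if c == 0 then fun=> 0 else ind R (dcoset c%:M 1).
have cphi c : Cc_quot (phi c).
  by rewrite /phi; case: eqVneq => c0; [exact: Cc_0 | apply: Cc_dcoset => //; exact: sc].
have dE (c : F) (g : G) : c != 0 -> g \in unitmx -> dcoset c%:M 1 g <-> in_pow 1 (g 0 0 / c - 1).
  by move=> c0 ug; rewrite dcoset_dim1 ?sc // mxE eqxx mulr1n.
have muphi c : c != 0 -> mu (phi c) = mu (ind R (dcoset 1%:M 1)).
  move=> c0; have uc : ((c^-1)%:M : G) \in unitmx by rewrite sc // invr_eq0.
  rewrite -(haar_translate hmu c1 uc); apply: (haar_ext hmu) => // g ug.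
  rewrite /phi (negPf c0); apply: ind_iff; rewrite dE // dcoset_dim1 //; last by rewrite unitmx_mul ug.
  by rewrite mul_mx_scalar !mxE eqxx divr1 mulrC.
transitivity (\sum_(c <- s | c != y) 1 * mu (phi c)).
  rewrite -(haar_sum hmu) //; apply: (haar_ext hmu); first exact: Cc_unit_group.
  move=> g ug; have g0 : g 0 0 != 0 by rewrite -det_dim1 -unitfE -unitmxE.
  under eq_bigr do rewrite mul1r.
  have close c : c \in s -> c != y -> phi c g = (in_pow 1 (g 0 0 - c))%:R.
    move=> cs ne; have [c0 vc] := val c cs ne; rewrite /phi (negPf c0).
    have e : in_pow 1 (g 0 0 / c - 1) = in_pow 1 (g 0 0 - c).
      have -> : g 0 0 - c = (g 0 0 / c - 1) * c by rewrite mulrBl divfK // mul1r.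
      rewrite /in_pow mulf_eq0 (negPf c0) orbF.
      by have [//|z0] := eqVneq (g 0 0 / c - 1) 0; rewrite /= lf_valM // vc addr0.
    rewrite -e; case: (boolP (in_pow 1 (g 0 0 / c - 1))) => h; first by rewrite indT //; apply/dE.
    by rewrite indF // => /(dE _ _ c0 ug); apply/negP.
  case: (EM (unit_group g)) => [[_ vg]|ng].
    rewrite indT //; rewrite det_dim1 in vg.
    have [c cs hc] : exists2 c, c \in s & in_pow 1 (g 0 0 - c) by apply: es; rewrite vg lexx orbT.
    have ne : c != y.
      apply/eqP => e; have : in_pow 1 (g 0 0) by rewrite -[g 0 0](subrK c); apply: (in_powD hc); rewrite e.
      by rewrite in_powE // vg.
    rewrite big_mkcond (bigD1_seq c) //= ne close // hc big_seq_cond big1 ?addr0 // => c' /andP[cs' nc].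
    case: ifP => // ne'.
    rewrite close //; case: (boolP (in_pow 1 _)) => // h; case/eqP: nc; apply: js => //.
    have -> : c' - c = (g 0 0 - c) - (g 0 0 - c') by ring.
    exact: in_powB.
  rewrite indF // big_seq_cond big1 // => c /andP[cs ne]; have [c0 vc] := val c cs ne.
  rewrite close //; case: (boolP (in_pow 1 _)) => // h; case: ng; split=> //; rewrite det_dim1.
  apply/eqP; rewrite eq_le; apply/andP; split.
    rewrite leNgt; apply/negP => lt; have : in_pow 1 c.
      have -> : c = g 0 0 - (g 0 0 - c) by ring.
      by apply: in_powB => //; rewrite in_powE.
    by rewrite in_powE // vc.
  have : in_pow 0 (g 0 0).
    rewrite -[g 0 0](subrK c); apply: in_powD; first by apply: in_pow_le h.
    by rewrite in_powE // vc.
  by rewrite in_powE.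
transitivity (\sum_(c <- s | c != y) mu (ind R (dcoset 1%:M 1))).
  rewrite big_seq_cond [RHS]big_seq_cond; apply: eq_bigr => c /andP[cs ne].
  by rewrite mul1r muphi //; have [] := val c cs ne.
have := big_const_seq 0 +%R s predT (mu (ind R (dcoset 1%:M 1))).
rewrite count_predT ss iter_addr addr0 (bigD1_seq y) //= => e.
by rewrite mulrBl mul1r mulr_natl -e addrAC subrr add0r.
Qed.
End TrivialIntegrals.

(** * Strictness of the division *)

Section TrivialLfactor.
Variables (F : local_field) (R : fieldType) (sq : R) (theta : F -> R).
Notation q := (lf_q F).
Hypotheses (sth : smooth_char theta) (nth : nontrivial_char theta) (q0 : q%:R != 0 :> R).
Notation triv := (trivial_rep F R).
Notation mu := (@gl1_haar F R).
Notation vol := (mu (ind R (@unit_group F))).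

Let hmu : haar_quot mu := haar_dim1 q0.

Lemma trivial_spans (P : {poly R}) Phi0 c : P`_0 = 1 -> c != 0 -> Cc_mx Phi0 ->
  (forall k, poly_mul_series P (tate mu Phi0) k = c * (k == 0)%:R) ->
  (forall Phi, Cc_mx Phi -> laurent_poly (poly_mul_series P (tate mu Phi))) ->
  is_Lfactor sq theta triv triv P.
Proof.
move=> P0 c0 cPhi0 e0 hP; rewrite /is_Lfactor leqnn; split=> // [e|j i e]; last by exfalso; lia.
rewrite (eq_irrelevance e erefl); exists mu => //.
have sth' := smooth_char_inv sth.
have th0 := char0 sth; have th0' := char0 sth'.
have shape a b Phi z : Cc_mx Phi -> RS_eq (erefl 1) mu (const_unit a) (const_unit b) Phi z = a * b * tate mu Phi z.
  by move=> cPhi; apply: (RS_tate sth nth hmu).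
apply: (@spans_inv_of_generator _ _ P (tate mu Phi0) c) => //; last first.
  by exists (const_unit 1), (const_unit 1), Phi0; split=> //; [apply/(trivial_whit th0) | apply/(trivial_whit th0')]; exists 1.
move=> I [W [W' [Phi [/(trivial_whit th0)[a ->] /(trivial_whit th0')[b ->] cPhi ->]]]]; split.
  by have [N h] := tate_low sth nth hmu cPhi; exists N => z /h; rewrite shape // => ->; rewrite mulr0.
have [N h] := hP Phi cPhi; exists N => z /h hz.
rewrite (eq_pms P (fun k => shape a b Phi k cPhi)); rewrite pms_scale hz mulr0 //.
Qed.

(** The pole at [X = 1] is proportional to [Phi 0] times the volume of the
    units, so every integral is a Laurent polynomial; that of the indicator
    function of [1 + varpi o] is a nonzero constant. *)
Lemma trivial_Lfactor_degenerate : vol = 0 -> is_Lfactor sq theta triv triv 1.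
Proof.
move=> v0; have p1 f k : poly_mul_series (1 : {poly R}) f k = f k by rewrite -[1]polyC1 pmsC mul1r.
have c0 := haar_unit_volume hmu q0.
pose Phi0 : 'rV[F]_1 -> R := fun x => box R 1 (x + - (1%:M : 'M[F]_1)).
have cPhi0 : Cc_mx Phi0 by apply: Cc_mx_translate; exact: Cc_box.
apply: (trivial_spans _ c0 cPhi0); first by rewrite coef1.
  move=> k; rewrite p1; have [->|k0] := eqVneq k 0; last first.
    rewrite mulr0 -[RHS](mul0r vol); apply: (tate_const sth nth hmu) => // g ug vg.
    rewrite /Phi0 box0 // => /(_ 0 0); rewrite !mxE eqxx => h.
    have {}h : in_pow 1 (g 0 0 - 1) := h.
    have [_] := principal_unit h; rewrite addrC subrK -det_dim1 vg => e.
    by rewrite e eqxx in k0.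
  rewrite mulr1 /tate RS_eqE; apply: (haar_ext hmu); first exact: (Cc_tate sth nth 0 cPhi0).
  move=> g ug; rewrite eta_mul /const_unit ug !mul1r det_dim1 /Phi0.
  have u1 : (1%:M : 'M[F]_1) \in unitmx by rewrite unitmx1.
  have dE : dcoset 1%:M 1 g <-> in_pow 1 (g 0 0 - 1) by rewrite dcoset_dim1 // !mxE eqxx divr1.
  have bE : mx_in_pow 1 (g + - (1%:M : 'M[F]_1)) <-> in_pow 1 (g 0 0 - 1).
    by split=> [/(_ 0 0)|h i j]; rewrite ?ord1 ?(ord1 j) !mxE eqxx.
  case: (boolP (in_pow 1 (g 0 0 - 1))) => h.
    rewrite (box1 _ (proj2 bE h)) (indT _ (proj2 dE h)).
    have -> // : lf_val (g 0 0) == 0.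
    by have [_] := principal_unit h; rewrite addrC subrK => ->.
  rewrite (indF _ (fun d => negP h (proj1 dE d))) box0 ?if_same // => /bE.
  exact: negP.
move=> Phi cPhi; have [N h1] := tate_low sth nth hmu cPhi; have [M h2] := tate_high sth nth hmu cPhi.
exists (`|N| + `|M|) => z hz; rewrite p1.
by have [lt|le] := ltP z N; [rewrite h1 | rewrite h2 ?v0 ?mulr0 //; lia].
Qed.

(** The indicator function of [o] gives the volume of the units times the
    geometric series. *)
Lemma trivial_Lfactor : vol != 0 -> is_Lfactor sq theta triv triv (1 - 'X).
Proof.
move=> v0; have p1 f k : poly_mul_series (1 - 'X : {poly R}) f k = f k - f (k - 1).
  have -> : 1 - 'X = 1%:P + (-1)%:P * 'X :> {poly R} by rewrite polyCN mulN1r.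
  by rewrite pmsD pmsMX !pmsC mul1r mulN1r.
have cPhi0 : Cc_mx (box R 0 : 'rV[F]_1 -> R) by exact: Cc_box.
apply: (trivial_spans _ v0 cPhi0); first by rewrite coefB coef1 coefX subr0.
  have tE k : tate mu (box R 0) k = (0 <= k)%R%:R * vol.
    apply: (tate_const sth nth hmu) => // g ug vg.
    have d0 : g 0 0 != 0 by rewrite -det_dim1 -unitfE -unitmxE.
    rewrite det_dim1 in vg; case: leP => h.
      by rewrite box1 // => i j; rewrite !ord1 in_powE // vg.
    by rewrite box0 // => /(_ 0 0); rewrite in_powE // vg leNgt h.
  move=> k; rewrite p1 !tE -mulrBl mulrC; congr (_ * _).
  have [->|/eqP k0] := eqVneq k 0; first by rewrite sub0r subr0.
  by rewrite (_ : (0 <= k - 1) = (0 <= k)) ?subrr //; lia.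
move=> Phi cPhi; have [N h1] := tate_low sth nth hmu cPhi; have [M h2] := tate_high sth nth hmu cPhi.
exists (`|N| + `|M| + 1) => z hz; rewrite p1.
by have [lt|le] := ltP z N; [rewrite !h1 ?subrr //; lia | rewrite !h2 ?subrr //; lia].
Qed.
End TrivialLfactor.

(** For [F = F_3((t))] and [l = 2], the volume of the units is [q - 1 = 2] times
    that of [1 + varpi o]: it vanishes modulo 2 only.  The trivial character of
    [F^x] has the factor [1 / (1 - X)] over the l-adic field and the factor 1
    over the l-modular one. *)
Lemma strict_division : exists (p l : nat) (F : local_field),
   [/\ res_char F p, prime l, l <> p &
    forall (D : ladic_data l) (sq : ld_K D) (theta : F -> ld_K D),
    sq ^+ 2 = (lf_q F)%:R -> smooth_char theta -> nontrivial_char theta ->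
    exists (n m : nat)
      (pi : prerep F (ld_k D) n) (pi' : prerep F (ld_k D) m)
      (tau : prerep F (ld_K D) n) (tau' : prerep F (ld_K D) m)
      (P : {poly ld_k D}) (Q : {poly ld_K D}),
      [/\ whittaker_type (ld_red sq) (@ld_red l D \o theta) pi /\
          whittaker_type (ld_red sq) (@ld_red l D \o theta) pi',
          whittaker_lift sq theta tau pi /\ whittaker_lift sq theta tau' pi',
          is_Lfactor (ld_red sq) (@ld_red l D \o theta) pi pi' P /\
          is_Lfactor sq theta tau tau' Q,
          int_poly Q
        & P <> map_poly (@ld_red l D) Q]].
Proof.
exists 3%N, 2%N, F3t; split=> // [|D sq theta _ sth nth]; first exact: F3t_res_char.
have pr2 : prime 2 by []. have ne23 : 2%N <> 3%N by [].
have two : 2%:R = 0 :> ld_k D by have /andP[_ /eqP] := pchar_k D pr2.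
have q1 : (lf_q F3t)%:R = 1 :> ld_k D by rewrite F3t_q (natrD _ 2 1) two add0r.
have qk : (lf_q F3t)%:R != 0 :> ld_k D by rewrite q1 oner_neq0.
have two0 : 2%:R != 0 :> ld_K D.
  by apply/eqP => e; case/negP: (K_pchar D pr2 2); apply/andP; rewrite e eqxx.
have qK : (lf_q F3t)%:R != 0 :> ld_K D.
  by apply/eqP => e; case/eqP: qk; rewrite -red_nat e red0.
have rsth := smooth_char_red pr2 F3t_res_char ne23 sth.
have rnth : nontrivial_char (@ld_red 2 D \o theta).
  by have [x hx] := nth; exists x => /(red_char_eq1 pr2 F3t_res_char ne23 sth).
have lift := trivial_lift pr2 q1 sq (char0 sth).
have [_ _ wt _] := lift.
exists 1%N, 1%N, (trivial_rep F3t _), (trivial_rep F3t _), (trivial_rep F3t _), (trivial_rep F3t _), 1, (1 - 'X).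
split=> //.
- split.
    apply: trivial_Lfactor_degenerate => //.
    by rewrite (unit_group_volume rsth rnth (haar_dim1 qk)) q1 subrr mul0r.
  apply: trivial_Lfactor => //; rewrite (unit_group_volume sth nth (haar_dim1 qK)) F3t_q (natrD _ 2 1) addrK mulf_neq0 //.
  exact: haar_unit_volume (haar_dim1 qK) qK.
- move=> i; rewrite coefB coef1 coefX; apply: intB; exact: int_nat.
- move=> /(congr1 (fun P : {poly ld_k D} => P`_1)); rewrite coef1 coef_map_id0 ?red0 //.
  rewrite coefB coef1 coefX sub0r redN ?ld_red1; last exact: int1.
  by move/esym/eqP; rewrite oppr_eq0 oner_eq0.
Qed.

(** * Reduction of Rankin-Selberg factors modulo l *)

Theorem theorem3p13 :
  (forall (p l : nat) (F : local_field) (D : ladic_data l)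
     (sq : ld_K D) (theta : F -> ld_K D) (n m : nat)
     (pi : prerep F (ld_k D) n) (pi' : prerep F (ld_k D) m)
     (tau : prerep F (ld_K D) n) (tau' : prerep F (ld_K D) m),
   res_char F p -> prime l -> l <> p ->
   sq ^+ 2 = (lf_q F)%:R ->
   smooth_char theta -> nontrivial_char theta ->
   whittaker_type (ld_red sq) (@ld_red l D \o theta) pi ->
   whittaker_type (ld_red sq) (@ld_red l D \o theta) pi' ->
   whittaker_lift sq theta tau pi ->
   whittaker_lift sq theta tau' pi' ->
   (* (1), divisibility *)
   (forall (P : {poly ld_k D}) (Q : {poly ld_K D}),
      is_Lfactor (ld_red sq) (@ld_red l D \o theta) pi pi' P ->
      is_Lfactor sq theta tau tau' Q ->
      int_poly Q /\ P %| map_poly (@ld_red l D) Q) /\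
   (* (2) *)
   (forall (f : factors (ld_k D)) (h : factors (ld_K D)),
      is_factors (ld_red sq) (@ld_red l D \o theta) pi pi' f ->
      is_factors sq theta tau tau' h ->
      integral_factors h /\ gamma (lf_q F) f = gamma (lf_q F) (red_factors h))) /\
  (* (1), the division may be strict *)
  (exists (p l : nat) (F : local_field),
   [/\ res_char F p, prime l, l <> p &
    forall (D : ladic_data l) (sq : ld_K D) (theta : F -> ld_K D),
    sq ^+ 2 = (lf_q F)%:R -> smooth_char theta -> nontrivial_char theta ->
    exists (n m : nat)
      (pi : prerep F (ld_k D) n) (pi' : prerep F (ld_k D) m)
      (tau : prerep F (ld_K D) n) (tau' : prerep F (ld_K D) m)
      (P : {poly ld_k D}) (Q : {poly ld_K D}),
      [/\ whittaker_type (ld_red sq) (@ld_red l D \o theta) pi /\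
          whittaker_type (ld_red sq) (@ld_red l D \o theta) pi',
          whittaker_lift sq theta tau pi /\ whittaker_lift sq theta tau' pi',
          is_Lfactor (ld_red sq) (@ld_red l D \o theta) pi pi' P /\
          is_Lfactor sq theta tau tau' Q,
          int_poly Q
        & P <> map_poly (@ld_red l D) Q]]).
Proof.
split; last exact: strict_division.
move=> p l F D sq theta n m pi pi' tau tau' resp prl lp sqE sth nth _ _ lift lift'.
split=> [P Q|f h]; rewrite /is_Lfactor.
  case: leqP => [mn hk hK|/ltnW nm hk hK].
    split; first exact: (Lfactor_lift_integral prl resp lp sqE sth nth lift lift' mn hk hK).
    exact: (Lfactor_divides prl resp lp sqE sth nth lift lift' mn hk hK).
  split; first exact: (Lfactor_lift_integral prl resp lp sqE sth nth lift' lift nm hk hK).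
  exact: (Lfactor_divides prl resp lp sqE sth nth lift' lift nm hk hK).
rewrite /is_factors /is_Lfactor; case: leqP => [mn|/ltnW nm] [hk hkd ek] [hK hKd eK].
  exact: (gamma_lift_le prl resp lp sqE sth nth lift lift' mn hk hK hkd hKd ek eK).
exact: (gamma_lift_le prl resp lp sqE sth nth lift' lift nm hk hK hkd hKd ek eK).
Qed.
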